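(* For each $n\in\mathbb{N}$, let $d_n\ge1$ be an integer, let $\pi_n\in\mathcal{P}(\mathbb{R}^{d_n})$ be log-concave, i.e. $\pi_n(\mathrm{d}x)=e^{-V_n(x)}\mathrm{d}x$ with $V_n\in C^2(\mathbb{R}^{d_n})$ convex, let $\mu_0^{(n)}\in\mathcal{P}(\mathbb{R}^{d_n})$, and let $h_n>0$. Let $\mathrm{t}_{\mathrm{mix}}^{(n)}(\varepsilon)$ denote the mixing time, with precision $\varepsilon\in(0,1)$, of the Proximal Sampler with target $\pi_n$, initialization $\mu_0^{(n)}$ and step size $h_n$, and for $\mu\in\mathcal{P}(\mathbb{R}^{d_n})$ write $\widehat{C}_{\mathrm P}^{(n)}(\mu)=1+\frac{C_{\mathrm P}(\mu)}{h_n}$. Suppose that for some fixed $\varepsilon_0\in(0,1)$, $$\frac{\mathrm{t}_{\mathrm{mix}}^{(n)}(\varepsilon_0)}{\widehat{C}_{\mathrm P}^{(n)}(\pi_n)+\sqrt{\widehat{C}_{\mathrm P}^{(n)}(\pi_n)\,\widehat{C}_{\mathrm P}^{(n)}(\mu_0^{(n)})}}\ \xrightarrow[n\to\infty]{}\ \infty .$$ Then a cutoff occurs, in the sense that for every $\varepsilon\in(0,1)$, $$\frac{\mathrm{t}_{\mathrm{mix}}^{(n)}(1-\varepsilon)}{\mathrm{t}_{\mathrm{mix}}^{(n)}(\varepsilon)}\ \xrightarrow[n\to\infty]{}\ 1 .$$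
   Context: $\mathcal{P}(\mathbb{R}^d)$ is the set of Borel probability measures on $\mathbb{R}^d$. The Proximal Sampler with target $\pi(\mathrm{d}x)=e^{-V(x)}\mathrm{d}x$ on $\mathbb{R}^d$, initialization $\mu_0$ and step size $h>0$ is the random sequence $X_0,Y_0,X_1,Y_1,\ldots$ of $\mathbb{R}^d$-valued random variables produced by sampling $X_0\sim\mu_0$ and then, inductively for each $k\ge0$: (1) Forward step: conditionally on $(X_0,Y_0,\ldots,X_{k-1},Y_{k-1},X_k)$, $Y_k$ is Gaussian with mean $X_k$ and covariance matrix $hI_d$. (2) Backward step: conditionally on $(X_0,Y_0,\ldots,X_k,Y_k)$, $X_{k+1}$ has density (in $x$, w.r.t. Lebesgue measure) proportional to $\exp\left(-V(x)-\frac{|x-Y_k|^2}{2h}\right)$. Write $\mu_k=\mathrm{law}(X_k)$ for $k\in\mathbb{N}=\{0,1,2,\ldots\}$. Total variation: $\mathrm{TV}(\mu,\pi)=\sup_{A\in\mathcal{B}(\mathbb{R}^d)}|\mu(A)-\pi(A)|$. Mixing time with precision $\varepsilon\in(0,1)$: $\min\{k\in\mathbb{N}:\mathrm{TV}(\mu_k,\pi)\le\varepsilon\}$. Poincaré constant: for $\mu\in\mathcal{P}(\mathbb{R}^d)$, $C_{\mathrm P}(\mu)\in[0,\infty]$ is the smallest number such that $\mathrm{Var}_\mu(f)\le C_{\mathrm P}(\mu)\int|\nabla f|^2\,\mathrm{d}\mu$ for all smooth $f:\mathbb{R}^d\to\mathbb{R}$ (equal to $+\infty$ if there is no such finite number).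 A quotient with finite numerator and infinite denominator is $0$. *)

(* Defs.v *)
From HB Require Import structures.
From mathcomp Require Import all_boot all_order all_algebra.
From mathcomp Require Import all_classical all_reals all_analysis.
From mathcomp Require Import measurable_realfun.

Set Implicit Arguments.
Unset Strict Implicit.
Unset Printing Implicit Defensive.

Import Order.TTheory GRing.Theory Num.Theory.
Import numFieldNormedType.Exports.

Local Open Scope classical_set_scope.
Local Open Scope ring_scope.

Definition rV_display : measure_display.
Proof. exact: default_measure_display. Qed.

Section borel_rV.
Context {R : realType} (d : nat).

Definition borel_rV : set (set 'rV[R]_d) := <<s open >>.

Let borel_rV0 : borel_rV set0.
Proof. exact: sigma_algebra0. Qed.

Let borel_rVC A : borel_rV A -> borel_rV (~` A).
Proof. exact: sigma_algebraC. Qed.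

Let borel_rV_bigcup (F : (set 'rV[R]_d)^nat) : (forall i, borel_rV (F i)) ->
  borel_rV (\bigcup_i F i).
Proof. exact: sigma_algebra_bigcup. Qed.

HB.instance Definition _ := @isMeasurable.Build rV_display 'rV[R]_d
  borel_rV borel_rV0 borel_rVC borel_rV_bigcup.

End borel_rV.

Section borel_rV_theory.
Context {R : realType}.

Lemma open_measurable_rV d (U : set 'rV[R]_d) : open U -> measurable U.
Proof. exact: sub_sigma_algebra. Qed.

Lemma measurable_coord_rV d (i : 'I_d) :
  measurable_fun [set: 'rV[R]_d] (fun v : 'rV[R]_d => v ord0 i).
Proof.
apply: (measurability _ (RGenOpens.measurableE R)) => _ [_ [a [b ->]] <-].
rewrite setTI; apply: open_measurable_rV.
by apply: open_comp => [v _|]; [exact: coord_continuous|exact: interval_open].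
Qed.

Lemma measurable_fun_rV d0 (T : measurableType d0) d (f : T -> 'rV[R]_d) :
  (forall i, measurable_fun setT (fun x => f x ord0 i)) ->
  measurable_fun setT f.
Proof.
move=> mf; apply: (measurability (@open 'rV[R]_d)) => //.
move=> _ [U oU <-]; rewrite setTI.
pose b (p : 'rV[rat]_d * nat) : set 'rV[R]_d :=
  ball (map_mx ratr p.1 : 'rV[R]_d) p.2.+1%:R^-1.
pose B (p : 'rV[rat]_d * nat) := if `[< b p `<=` U >] then f @^-1` b p else set0.
have -> : f @^-1` U = \bigcup_p B p.
  apply/seteqP; split => [x Ufx|x [p _]]; last first.
    by rewrite /B; case: asboolP => // bU; exact: bU.
  have /nbhs_ballP[e /= e0 eU] : nbhs (f x) U by apply: open_nbhs_nbhs.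
  have e20 : 0 < e / 2 by rewrite divr_gt0.
  have [k _ /(_ k (leqnn k)) /= ke] := near_infty_natSinv_lt (PosNum e20).
  have kgt0 : 0 < k.+1%:R^-1 :> R by rewrite invr_gt0.
  have /choice[q qx] : forall i : 'I_d, exists q : rat,
      ball (f x ord0 i) k.+1%:R^-1 (ratr q : R).
    move=> i; have [|q] := @rat_in_itvoo R (f x ord0 i) (f x ord0 i + k.+1%:R^-1).
      by rewrite ltrDl.
    rewrite in_itv/= => /andP[q1 q2]; exists q.
    by rewrite /ball/= ltr_distlC q2 andbT (le_lt_trans _ q1)// gerBl ltW.
  have bx : b (\row_i q i, k) (f x).
    split=> // i j; rewrite !mxE (ord1 i); exact/ball_sym/qx.
  exists (\row_i q i, k) => //; rewrite /B; case: asboolP => // -[] y [_ by_].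
  apply: eU; split => // i j.
  apply: (@le_ball _ _ _ (k.+1%:R^-1 + k.+1%:R^-1)).
    by rewrite (splitr e) lerD// ltW.
  by apply: (ball_triangle _ (by_ i j)); apply/ball_sym; exact: bx.2.
apply: countable_bigcupT_measurable => // p.
rewrite /B; case: ifP => // _.
have -> : f @^-1` b p = \bigcap_(i in [set: 'I_d])
    ((fun x => f x ord0 i) @^-1` ball (ratr (p.1 ord0 i) : R) p.2.+1%:R^-1).
  apply/seteqP; split => [x [_ h] i _|x h]; first by have := h ord0 i; rewrite mxE.
  by split=> [|i j]; [rewrite invr_gt0|rewrite mxE (ord1 i); exact: h].
apply: fin_bigcap_measurable => // i _; rewrite -[X in measurable X]setTI.
by apply: mf => //; apply: open_measurable; exact: ball_open.
Qed.

End borel_rV_theory.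

(* Lebesgue measure on R^d, as the d-fold product of the Lebesgue measure of
   the real line; R^0 is a point of mass 1. *)
Section lebesgue_rV.
Context {R : realType}.

Definition cons_rV d (p : measurableTypeR R * 'rV[R]_d) : 'rV[R]_d.+1 :=
  row_mx (p.1)%:M p.2.

Lemma measurable_cons_rV d : measurable_fun setT (@cons_rV d).
Proof.
apply: measurable_fun_rV => i.
case: (@split_ordP 1 d i) => j ->.
  rewrite [X in measurable_fun _ X](_ : _ = fst)//.
  apply/funext => p; rewrite /cons_rV (row_mxEl _ _ ord0 j) (ord1 j).
  by rewrite mxE eqxx mulr1n.
rewrite [X in measurable_fun _ X](_ : _ = (fun v : 'rV[R]_d => v ord0 j) \o snd).
  by apply: measurableT_comp => //; exact: measurable_coord_rV.
by apply/funext => p; exact: row_mxEr.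
Qed.

HB.instance Definition _ d := isMeasurableFun.Build _ _ _ _ (@cons_rV d)
  (@measurable_cons_rV d).

Let uncons_rV d (v : 'rV[R]_d.+1) : measurableTypeR R * 'rV[R]_d :=
  (v ord0 ord0, \row_j v ord0 (lift ord0 j)).

Let cons_rVK d : cancel (@cons_rV d) (@uncons_rV d).
Proof.
move=> [x v]; rewrite /uncons_rV /cons_rV; congr pair.
  rewrite (_ : ord0 = lshift d (ord0 : 'I_1)); last exact/val_inj.
  by apply: etrans (row_mxEl _ _ _ _) _; rewrite mxE eqxx mulr1n.
apply/rowP => j; rewrite mxE (_ : lift ord0 j = rshift 1 j); last exact/val_inj.
exact: row_mxEr.
Qed.

Let measurable_uncons_rV d : measurable_fun setT (@uncons_rV d).
Proof.
apply: measurable_fun_pair; first exact: measurable_coord_rV.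
apply: measurable_fun_rV => j; under eq_fun do rewrite mxE.
exact: measurable_coord_rV.
Qed.

Section lebesgue_cons.
Context d (m : {sigma_finite_measure set 'rV[R]_d -> \bar R}).

Definition lebesgue_cons : set 'rV[R]_d.+1 -> \bar R :=
  pushforward ((@lebesgue_measure R) \x m)%E (@cons_rV d).

Let lebesgue_cons0 : lebesgue_cons set0 = 0%E.
Proof. exact: measure0. Qed.

Let lebesgue_cons_ge0 A : (0 <= lebesgue_cons A)%E.
Proof. exact: measure_ge0. Qed.

Let lebesgue_cons_sigma_additive : semi_sigma_additive lebesgue_cons.
Proof. exact: measure_semi_sigma_additive. Qed.

HB.instance Definition _ := isMeasure.Build _ _ _ lebesgue_cons
  lebesgue_cons0 lebesgue_cons_ge0 lebesgue_cons_sigma_additive.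

Let sigma_finite_lebesgue_cons : sigma_finite setT lebesgue_cons.
Proof.
have /sigma_finiteP[F [FT ndF Foo]] := sigma_finiteT (@lebesgue_measure R).
have /sigma_finiteP[G [GT ndG Goo]] := sigma_finiteT m.
exists (fun k => @uncons_rV d @^-1` (F k `*` G k)).
  apply/seteqP; split=> // v _.
  have [k _ Fk] : (\bigcup_k F k) (uncons_rV v).1 by rewrite -FT.
  have [l _ Gl] : (\bigcup_k G k) (uncons_rV v).2 by rewrite -GT.
  exists (maxn k l) => //; split.
    by apply: (subsetPset _ _ (ndF _ _ (leq_maxl k l))).
  by apply: (subsetPset _ _ (ndG _ _ (leq_maxr k l))).
move=> k; have [mF Fk] := Foo k; have [mG Gk] := Goo k; split.
  rewrite -[X in measurable X]setTI; apply: measurable_uncons_rV => //.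
  exact: measurableX.
rewrite /lebesgue_cons /pushforward -comp_preimage.
rewrite (_ : @uncons_rV d \o @cons_rV d = id); last first.
  by apply/funext => p /=; rewrite cons_rVK.
by rewrite preimage_id product_measure1E// lte_mul_pinfty// ge0_fin_numE.
Qed.

HB.instance Definition _ := Measure_isSigmaFinite.Build _ _ _ lebesgue_cons
  sigma_finite_lebesgue_cons.

End lebesgue_cons.

Fixpoint lebesgue_rV (d : nat) : {sigma_finite_measure set 'rV[R]_d -> \bar R} :=
  match d with
  | 0 => \d_ (0 : 'rV[R]_0)
  | d'.+1 => lebesgue_cons (lebesgue_rV d')
  end.

Lemma lebesgue_rVS d (A : set 'rV[R]_d.+1) :
  lebesgue_rV d.+1 A =
  (\int[@lebesgue_measure R]_x lebesgue_rV d [set v | A (row_mx x%:M v)])%E.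
Proof.
rewrite [LHS]/=/lebesgue_cons/pushforward/product_measure1.
by apply: eq_integral => x _ /=; congr (lebesgue_rV d _); rewrite xsectionE.
Qed.

End lebesgue_rV.

(* The norm `|x| that the library puts on 'rV[R]_d is the sup norm; the
   Euclidean norm |x| only enters through its square. *)
Definition sqnorm {R : realType} d (x : 'rV[R]_d) : R := \sum_i x ord0 i ^+ 2.

Section smooth.
Context {R : realType} (d : nat).
Implicit Types f : 'rV[R]_d -> R.

Definition partial (i : 'I_d) f : 'rV[R]_d -> R := 'D_(delta_mx ord0 i) f.

Definition grad f (x : 'rV[R]_d) : 'rV[R]_d := \row_i partial i f x.

Fixpoint class_C (k : nat) f : Prop :=
  continuous f /\
  if k is k'.+1 then
    forall i : 'I_d, (forall x, derivable f x (delta_mx ord0 i)) /\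
      class_C k' (partial i f)
  else True.

Definition smooth f : Prop := forall k, class_C k f.

End smooth.

Section measures.
Context {R : realType} (d : nat).
Local Notation leb := (@lebesgue_rV R d).
Local Open Scope ereal_scope.

Definition log_concave_with_potential (V : 'rV[R]_d -> R)
    (pi : probability 'rV[R]_d R) : Prop :=
  [/\ class_C 2 V, convex_function setT V &
    forall A, measurable A -> pi A = \int[leb]_(x in A) (expR (- V x))%:E].

Definition gaussian (h : R) (m : 'rV[R]_d) (A : set 'rV[R]_d) : \bar R :=
  \int[leb]_(y in A)
    ((Num.sqrt (2 * trigo.pi * h) ^- d * expR (- (sqnorm (y - m) / (2 * h))))%R)%:E.

Definition backward_weight (V : 'rV[R]_d -> R) (h : R) (y x : 'rV[R]_d) : R :=
  expR (- V x - sqnorm (x - y) / (2 * h)).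

Definition backward (V : 'rV[R]_d -> R) (h : R) (y : 'rV[R]_d)
    (A : set 'rV[R]_d) : \bar R :=
  (\int[leb]_(x in A) (backward_weight V h y x)%:E) /
  (\int[leb]_x (backward_weight V h y x)%:E).

(* 'V_mu[f] is +oo when f is not square-integrable. *)
Definition poincare_constant (mu : probability 'rV[R]_d R) : \bar R :=
  ereal_inf [set C%:E | C in [set C : R | (0 <= C)%R /\
    forall f : 'rV[R]_d -> R, smooth f ->
      'V_mu[f] <= C%:E * \int[mu]_x (sqnorm (grad f x))%:E]].

Definition normalized_poincare (h : R) (mu : probability 'rV[R]_d R) : \bar R :=
  1 + poincare_constant mu / h%:E.

End measures.

Definition conditional_law {R : realType} (disp disp' : measure_display)
    (Om : measurableType disp) (T : measurableType disp') (P : probability Om R)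
    (G : set (set Om)) (Z : Om -> T) (K : Om -> set T -> \bar R) : Prop :=
  forall E B, G E -> measurable B ->
    P (E `&` Z @^-1` B) = (\int[P]_(w in E) K w B)%E.

Section proximal_sampler.
Context {R : realType} (d : nat) (disp : measure_display)
  (Om : measurableType disp) (P : probability Om R)
  (X Y : nat -> {RV P >-> 'rV[R]_d}).

(* sigma(X_0, ..., X_(a-1), Y_0, ..., Y_(b-1)) *)
Definition history (a b : nat) : set (set Om) :=
  <<s [set X i @^-1` A | i in `I_a & A in measurable] `|`
      [set Y i @^-1` A | i in `I_b & A in measurable] >>.

Definition proximal_sampler (V : 'rV[R]_d -> R)
    (mu0 : probability 'rV[R]_d R) (h : R) : Prop :=
  [/\ forall A, measurable A -> distribution P (X 0) A = mu0 A,
      forall k, conditional_law P (history k.+1 k) (Y k)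
        (fun w => gaussian h (X k w)) &
      forall k, conditional_law P (history k.+1 k.+1) (X k.+1)
        (fun w => backward V h (Y k w))].

End proximal_sampler.

Definition tv_distance {R : realType} (disp : measure_display)
    (T : measurableType disp) (mu nu : probability T R) : \bar R :=
  ereal_sup [set `|mu A - nu A|%E | A in measurable].

(* A nonempty set of naturals attains its infimum, so this is a minimum; it is
   +oo if the precision eps is never reached. *)
Definition mixing_time {R : realType} (disp : measure_display)
    (T : measurableType disp) (mu : nat -> probability T R)
    (pi : probability T R) (eps : R) : \bar R :=
  ereal_inf [set (k%:R)%:E | k in
    [set k | (tv_distance (mu k) pi <= eps%:E)%E]].

(* Main.v *)
(* Write P for the Gaussian kernel of the forward step, Q for the kernel of the
   backward step and M = PQ.  The four function form of the Prekopa-Leindler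
   inequality, proved on the line by monotone transport and on R^d by induction,
   shows that for convex V the kernel Q contracts the quadratic transport cost
   (in its dual form) and gives Lipschitz functions a variance of order h.
   Hence:
   - M^n satisfies a dimension-free log-Harnack inequality with cost
     |x - x'|^2 / (2 h n);
   - the Poincare constant of mu_k, tested on Lipschitz functions, is at most
     C_P(mu_0) + O(h k), so mu_k concentrates around sets of mass bounded below;
   - M contracts the variance under pi by the factor 1 - 1 / (1 + C_P(pi) / h),
     since h |grad P f|^2 is at most the conditional variance.
   If TV(mu_k, pi) <= 1 - delta, then every set of pi-mass close to 1 has
   mu_k-mass at least of order delta, so a neighbourhood of it carries almost all
   the mass of mu_k. Taking for this set the points where the iterates of M are
   well mixed and spreading to the neighbourhood by log-Harnack gives
   t_mix(delta) <= t_mix(1 - delta) + O_delta(W + sqrt(W t_mix(1 - delta))),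
   with W = K + sqrt(K K0), K = 1 + C_P(pi) / h and K0 = 1 + C_P(mu_0) / h.
   When t_mix(eps0) / W tends to infinity the error term is negligible. *)

Require Import Defs.
From HB Require Import structures.
From mathcomp Require Import all_boot all_order all_algebra.
From mathcomp Require Import all_classical all_reals all_analysis.
From mathcomp Require Import measurable_realfun ring lra.

Set Implicit Arguments.
Unset Strict Implicit.
Unset Printing Implicit Defensive.

Import Order.TTheory GRing.Theory Num.Theory.
Import numFieldNormedType.Exports.

Local Open Scope classical_set_scope.
Local Open Scope ring_scope.

(** * One-dimensional transport and the four function inequality *)

(** The transport step may lose no constant: the contraction of Q is applied at every iteration, and
    only a factor exactly 1 keeps the log-Harnack cost at |x - x'|^2 / (2 h n). This is why the
    interpolation parameter is sent to 0 instead of being fixed. Working with dual functions instead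
    of couplings, a law enters only through its values on bounded measurable functions. The Poincare
    constant quantifies over smooth functions, while the argument produces indicators and Lipschitz
    functions. Every function tested therefore has the form P g, which is smooth for any bounded
    measurable g; this is also why the law of the chain is examined after at least one step. The
    window comes from one balance. Running m more steps gains m / K in the exponent by the spectral
    gap. The log-Harnack inequality charges a constant plus the squared radius of the neighbourhood,
    of order h (K0 + k), divided by h m. Equating m / K with 1 + (K0 + k) / m gives m of order K +
    sqrt(K (K0 + k)), at most a multiple of W + sqrt(W k). *)

Section cumulative.
Context {R : realType}.
Notation leb := (@lebesgue_measure R).
Implicit Types f : R -> R.

Definition cumul f (x : R) : R := \int[leb]_(t in `]-oo, x]) f t.

Lemma is_derive_lincomb (a b : R) f g (x df dg : R) :
  is_derive x 1 f df -> is_derive x 1 g dg ->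
  is_derive x 1 (fun x => a * f x + b * g x) (a * df + b * dg).
Proof.
move=> hf hg; have h := is_deriveD (is_deriveZ a hf) (is_deriveZ b hg).
exact: h.
Qed.

Lemma cumul_derive f (x : R) : continuous f ->
  leb.-integrable setT (EFin \o f) -> is_derive x 1 (cumul f) (f x).
Proof.
move=> cf fi.
have xx1 : x < x + 1 by rewrite ltrDl.
have fi1 : leb.-integrable `]-oo, x + 1] (EFin \o f) by exact: integrableS fi.
have [df e] := continuous_FTC1 xx1 fi1 (ltNyr x) (cf x).
by apply: DeriveDef; [exact: df|rewrite -derive1E].
Qed.

Lemma cumul_increasing f : continuous f -> (forall x, 0 < f x) ->
  leb.-integrable setT (EFin \o f) -> {homo cumul f : x y / x < y}.
Proof.
move=> cf f0 fi x y xy.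
have [||z _] := @MVT R (cumul f) f x y xy.
- by move=> z _; exact: cumul_derive.
- apply: continuous_subspaceT => z.
  have zd := cumul_derive z cf fi.
  by apply/differentiable_continuous/derivable1_diffP.
- by move=> e; rewrite -subr_gt0 e mulr_gt0// subr_gt0.
Qed.

Lemma cvg_Rintegral_set d (T : measurableType d)
    (mu : {measure set T -> \bar R}) (g : T -> R) (A : (set T)^nat) (B : set T) :
  mu.-integrable setT (EFin \o g) -> (forall n, measurable (A n)) ->
  measurable B -> (forall x, \forall n \near \oo, A n x <-> B x) ->
  (fun n => \int[mu]_(x in A n) g x) @ \oo --> \int[mu]_(x in B) g x.
Proof.
move=> gi mA mB AB.
rewrite (_ : (fun n => _) = fun n => fine (\int[mu]_x ((g \_ (A n)) x)%:E)); last first.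
  by apply/funext => n; rewrite Rintegral_mkcond.
have iS C : measurable C -> mu.-integrable setT (EFin \o (g \_ C)).
  by move=> mC; rewrite -restrict_EFin -integrable_mkcond//; exact: integrableS gi.
apply: fine_cvg; rewrite Rintegral_mkcond /Rintegral fineK; last exact: integrable_fin_num (iS _ mB).
apply: (@dominated_cvg _ _ _ mu setT measurableT
  (fun n x => ((g \_ (A n)) x)%:E) _ (fun x => `|(g x)%:E|%E)) => //.
- by move=> n; apply: measurable_int (iS _ (mA n)).
- move=> x _; apply: cvg_near_cst; near=> n.
  rewrite !patchE; suff -> : (x \in A n) = (x \in B) by [].
  have h : A n x <-> B x by near: n; exact: AB.
  by apply/idP/idP; rewrite !inE => /h.
- exact: integrable_abse.
- move=> n x _ /=; rewrite patchE; case: ifP => _ //=.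
  by rewrite normr0 lee_fin.
Unshelve. all: end_near. Qed.

Lemma cumul_cvgy f : leb.-integrable setT (EFin \o f) ->
  cumul f n%:R @[n --> \oo] --> \int[leb]_x f x.
Proof.
move=> fi; apply: cvg_Rintegral_set => // x.
near=> n; split=> // _ /=; rewrite in_itv/=; near: n; exact: nbhs_infty_ger.
Unshelve. all: end_near. Qed.

Lemma cumul_cvgNy f : leb.-integrable setT (EFin \o f) ->
  cumul f (- n%:R) @[n --> \oo] --> (0 : R).
Proof.
move=> fi; rewrite -[X in _ --> X](@Rintegral_set0 _ _ _ leb f).
apply: cvg_Rintegral_set => // x.
near=> n; split=> //=; rewrite in_itv/= leNgt.
suff -> : - n%:R < x by [].
rewrite ltrNl; near: n; exact: nbhs_infty_gtr.
Unshelve. all: end_near. Qed.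

Lemma cumul_ge0 f x : (forall x, 0 <= f x) -> 0 <= cumul f x.
Proof. by move=> f0; apply: Rintegral_ge0. Qed.

Lemma cumul_le f x : leb.-integrable setT (EFin \o f) -> (forall x, 0 <= f x) ->
  cumul f x <= \int[leb]_x f x.
Proof.
move=> fi f0; rewrite /cumul Rintegral_mkcond; apply: le_Rintegral => //.
- by rewrite -restrict_EFin -integrable_mkcond//; exact: integrableS fi.
- by move=> z _; rewrite patchE; case: ifP.
Qed.

Lemma cumul_lt f x : continuous f -> leb.-integrable setT (EFin \o f) ->
  (forall x, 0 < f x) -> 0 < cumul f x < \int[leb]_x f x.
Proof.
move=> cf fi f0; have f0' z : 0 <= f z by exact: ltW.
have inc := cumul_increasing cf f0 fi; apply/andP; split.
- apply: le_lt_trans (inc (x - 1) x _); first exact: cumul_ge0.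
  by rewrite ltrBlDr ltrDl.
- apply: lt_le_trans (inc x (x + 1) _) _; first by rewrite ltrDl.
  exact: cumul_le.
Qed.

Lemma cumul_surj f v : continuous f -> leb.-integrable setT (EFin \o f) ->
  (forall x, 0 < f x) -> 0 < v < \int[leb]_x f x -> exists x, cumul f x = v.
Proof.
move=> cf fi f0 /andP[v0 v1].
have [N Nv] : exists N : nat, cumul f (- N%:R) < v.
  have /cvgr_lt/(_ _ v0)[N _ /(_ N)] := cumul_cvgNy fi.
  by move=> h; exists N; apply: h => /=.
have [M Mv] : exists M : nat, v < cumul f M%:R.
  have /cvgr_gt/(_ _ v1)[N' _ /(_ N')] := cumul_cvgy fi.
  by move=> h; exists N'; apply: h => /=.
have NM : - N%:R <= M%:R :> R by rewrite (@le_trans _ _ 0)// lerNl oppr0.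
have [||c _ cv] := @IVT R (cumul f) (- N%:R) M%:R v NM.
- apply: continuous_subspaceT => z.
  have zd := cumul_derive z cf fi.
  by apply/differentiable_continuous/derivable1_diffP.
- by rewrite ge_min le_max (ltW Nv) (ltW Mv) orbT.
- by exists c.
Qed.

(* The increasing map transporting the law with density proportional to [f] to
   the one with density proportional to [g]. *)
Lemma monotone_transport f g :
  continuous f -> leb.-integrable setT (EFin \o f) -> (forall x, 0 < f x) ->
  continuous g -> leb.-integrable setT (EFin \o g) -> (forall x, 0 < g x) ->
  exists T : R -> R, forall x : R, is_derive x 1 T
    (f x * (\int[leb]_x g x) / (g (T x) * \int[leb]_x f x) : R).
Proof.
move=> cf fi f0 cg gi g0.
set If := \int[leb]_x f x; set Ig := \int[leb]_x g x.
have If0 : 0 < If by have /andP[+ +] := cumul_lt 0 cf fi f0; exact: lt_trans.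
have Ig0 : 0 < Ig by have /andP[+ +] := cumul_lt 0 cg gi g0; exact: lt_trans.
(* [G'] inverts [cumul g] on its range; the default value 0 elsewhere is never met, since [rng]
   keeps the argument strictly between 0 and [Ig]. *)
have /choice[G' G'P] : forall v, exists z, (0 < v < Ig) -> cumul g z = v.
  move=> v; have [v01|] := boolP (0 < v < Ig); last by exists 0.
  by have [z] := cumul_surj cg gi g0 v01; exists z.
have GK : cancel (cumul g) G'.
  move=> z; have := G'P _ (cumul_lt z cg gi g0).
  have inc := cumul_increasing cg g0 gi.
  case: (ltgtP (G' (cumul g z)) z) => // /inc + e; by rewrite e ltxx.
exists (fun x => G' (cumul f x * (Ig / If))) => x.
have rng : 0 < cumul f x * (Ig / If) < Ig.
  have /andP[a b] := cumul_lt x cf fi f0.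
  rewrite mulr_gt0 ?divr_gt0//= mulrCA gtr_pMr// ltr_pdivrMr//.
  by rewrite mul1r.
set z := G' _.
have zE : cumul g z = cumul f x * (Ig / If) by exact: G'P.
have d1 : is_derive (cumul g z) 1 G' (g z)^-1.
  apply: is_derive_inverse.
  - by near=> t; exact: GK.
  - near=> t; have zd := cumul_derive t cg gi.
    by apply/differentiable_continuous/derivable1_diffP.
  - exact: cumul_derive.
  - by rewrite gt_eqF.
have d2 := cumul_derive x cf fi.
rewrite zE in d1.
have d3 : is_derive x 1 (fun x => cumul f x * (Ig / If)) (f x * (Ig / If)).
  have -> : (fun x => cumul f x * (Ig / If)) = (Ig / If) *: cumul f.
    by apply/funext => t; rewrite /GRing.scale/= mulrC.
  have -> : f x * (Ig / If) = (Ig / If) *: f x by rewrite /GRing.scale/= mulrC.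
  exact: is_deriveZ.
have -> : f x * Ig / (g z * If) = (g z)^-1 * (f x * (Ig / If)).
  by rewrite invfM; ring.
exact: (@is_derive1_comp _ G' (fun x => cumul f x * (Ig / If))).
Unshelve. all: end_near. Qed.

(* The derivative of [cumul h (c x) / Ih + cumul k (d x) / Ik], where [c] and [d]
   interpolate between the identity and the transport map, is bounded below by
   the AM-GM inequality. *)
Lemma four_function_R (t : R) (f g h k : R -> R) : 0 <= t <= 1 ->
  continuous f -> leb.-integrable setT (EFin \o f) -> (forall x, 0 < f x) ->
  continuous g -> leb.-integrable setT (EFin \o g) -> (forall x, 0 < g x) ->
  continuous h -> leb.-integrable setT (EFin \o h) -> (forall x, 0 < h x) ->
  continuous k -> leb.-integrable setT (EFin \o k) -> (forall x, 0 < k x) ->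
  (forall x y, f x * g y <= h ((1 - t) * x + t * y) * k (t * x + (1 - t) * y)) ->
  (\int[leb]_x f x) * (\int[leb]_x g x) <=
  (\int[leb]_x h x) * (\int[leb]_x k x).
Proof.
move=> /andP[t0 t1] cf fi f0 cg gi g0 ch hi h0 ck ki k0 H.
have [T dT] := monotone_transport cf fi f0 cg gi g0.
move: dT; set If := \int[leb]_x f x; set Ig := \int[leb]_x g x => dT.
set Ih := \int[leb]_x h x; set Ik := \int[leb]_x k x.
have If0 : 0 < If by have /andP[+ +] := cumul_lt 0 cf fi f0; exact: lt_trans.
have Ig0 : 0 < Ig by have /andP[+ +] := cumul_lt 0 cg gi g0; exact: lt_trans.
have Ih0 : 0 < Ih by have /andP[+ +] := cumul_lt 0 ch hi h0; exact: lt_trans.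
have Ik0 : 0 < Ik by have /andP[+ +] := cumul_lt 0 ck ki k0; exact: lt_trans.
pose T' x := f x * Ig / (g (T x) * If).
have T'0 x : 0 < T' x by rewrite divr_gt0 ?mulr_gt0.
pose c (x : R) : R := (1 - t) * x + t * T x; pose d (x : R) : R := t * x + (1 - t) * T x.
have dc (x : R) : is_derive x 1 c ((1 - t) + t * T' x).
  by have := is_derive_lincomb (1 - t) t (is_derive_id x (1 : R)) (dT x); rewrite mulr1.
have dd (x : R) : is_derive x 1 d (t + (1 - t) * T' x).
  by have := is_derive_lincomb t (1 - t) (is_derive_id x (1 : R)) (dT x); rewrite mulr1.
(* AM-GM will bound the derivative of the sum below by [2 * s * f]. The sum grows by at most 2, so
   [s * If <= 1], whose square is the claim. *)
pose s := Num.sqrt (Ig / If / (Ih * Ik)).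
pose Phi x := 1 * (Ih^-1 * cumul h (c x) + Ik^-1 * cumul k (d x)) +
  (- (2 * s)) * cumul f x.
pose phi x := 1 * (Ih^-1 * (h (c x) * ((1 - t) + t * T' x)) +
   Ik^-1 * (k (d x) * (t + (1 - t) * T' x))) + (- (2 * s)) * f x.
have dPhi (x : R) : is_derive x 1 Phi (phi x).
  have d1 := is_derive1_comp (cumul_derive (c x) ch hi) (dc x).
  have d2 := is_derive1_comp (cumul_derive (d x) ck ki) (dd x).
  exact: (is_derive_lincomb 1 (- (2 * s)) (is_derive_lincomb Ih^-1 Ik^-1 d1 d2)
    (cumul_derive x cf fi)).
have phi0 x : 0 <= phi x.
  rewrite /phi mul1r mulNr subr_ge0.
  set a := (1 - t) + _; set b := t + (1 - t) * T' x.
  have T'x := T'0 x.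
  have a0 : 0 < a by rewrite /a; nra.
  have b0 : 0 < b by rewrite /b; nra.
  (* The difference of the two sides is exactly t (1 - t) (T' - 1)^2. *)
  have ab : T' x <= a * b.
    have : 0 <= t * (1 - t) * (T' x - 1) ^+ 2.
      by rewrite mulr_ge0 ?sqr_ge0// mulr_ge0// subr_ge0.
    by rewrite /a /b => hh; nra.
  have hc := h0 (c x); have kd := k0 (d x).
  set u := Ih^-1 * _; set v := Ik^-1 * _.
  have u0 : 0 < u by rewrite mulr_gt0 ?invr_gt0// mulr_gt0.
  have v0 : 0 < v by rewrite mulr_gt0 ?invr_gt0// mulr_gt0.
  suff : s * f x <= Num.sqrt (u * v).
    move=> /(ler_wpM2l (ler0n R 2)); rewrite mulrA => /le_trans; apply.
    have uv0 : 0 <= u + v by rewrite addr_ge0// ltW.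
    rewrite -[leRHS]ger0_norm// -sqrtr_sqr.
    rewrite -[X in X * _]ger0_norm// -sqrtr_sqr -sqrtrM ?sqr_ge0//.
    rewrite ler_sqrt ?sqr_ge0//; have := sqr_ge0 (u - v); nra.
  rewrite /s -[f x]ger0_norm ?(ltW (f0 x))// -sqrtr_sqr -sqrtrM; last first.
    by rewrite !divr_ge0 ?mulr_ge0 ?ltW.
  have uv0 : 0 <= u * v by rewrite mulr_ge0// ltW.
  rewrite ler_sqrt//.
  have -> : u * v = (a * b) * (h (c x) * k (d x)) / (Ih * Ik).
    by rewrite /u /v invfM; ring.
  rewrite mulrAC ler_pM2r ?invr_gt0 ?mulr_gt0//.
  apply: (@le_trans _ _ (T' x * (f x * g (T x)))).
    rewrite /T' le_eqVlt; apply/orP; left; apply/eqP; field.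
    by rewrite !gt_eqF.
  apply: ler_pM => //; first exact: ltW.
  by rewrite mulr_ge0 ?ltW.
have Phile (n : nat) : Phi (- n%:R) <= Phi n%:R.
  have nn : - n%:R <= n%:R :> R by rewrite (@le_trans _ _ 0)// lerNl oppr0.
  have cPhi : {within `[- n%:R, n%:R], continuous Phi}.
    apply: continuous_subspaceT => z; have zd := dPhi z.
    by apply/differentiable_continuous/derivable1_diffP.
  have [z _ e] := MVT_segment nn (fun z _ => dPhi z) cPhi.
  by rewrite -subr_ge0 e mulr_ge0// subr_ge0.
(* The normalised cumulative functions of [h] and [k] stay in [0, 1] wherever [c] and [d] send the
   endpoints, so only [cumul f] has to be followed to infinity. *)
have sle (n : nat) : s * (cumul f n%:R - cumul f (- n%:R)) <= 1.
  have := Phile n; rewrite /Phi !mul1r !mulNr.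
  have q1 : Ih^-1 * cumul h (c n%:R) <= 1.
    rewrite mulrC ler_pdivrMr// mul1r; apply: cumul_le => // z; exact: ltW.
  have q2 : Ik^-1 * cumul k (d n%:R) <= 1.
    rewrite mulrC ler_pdivrMr// mul1r; apply: cumul_le => // z; exact: ltW.
  have q3 : 0 <= Ih^-1 * cumul h (c (- n%:R)).
    rewrite mulr_ge0 ?invr_ge0 ?(ltW Ih0)//; apply: cumul_ge0 => // z; exact: ltW.
  have q4 : 0 <= Ik^-1 * cumul k (d (- n%:R)).
    rewrite mulr_ge0 ?invr_ge0 ?(ltW Ik0)//; apply: cumul_ge0 => // z; exact: ltW.
  lra.
have sIf : s * If <= 1.
  have cv : s * (cumul f n%:R - cumul f (- n%:R)) @[n --> \oo] --> s * (If - 0).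
    apply: cvgMr; apply: cvgB; [exact: cumul_cvgy|exact: cumul_cvgNy].
  rewrite -[If]subr0 -(cvg_lim (@Rhausdorff R) cv).
  apply: limr_le; first by apply/cvg_ex; exists (s * (If - 0)).
  by near=> n.
have s0 : 0 <= s by exact: sqrtr_ge0.
have : (s * If) ^+ 2 <= 1 by rewrite expr_le1// mulr_ge0// ltW.
rewrite exprMn sqr_sqrtr; last by rewrite !divr_ge0 ?mulr_ge0 ?ltW.
have -> : Ig / If / (Ih * Ik) * If ^+ 2 = If * Ig / (Ih * Ik).
  by field; rewrite !gt_eqF.
by rewrite ler_pdivrMr ?mulr_gt0// mul1r.
Unshelve. all: end_near. Qed.

End cumulative.

(** * Integration and Gaussian domination on row vectors *)

Section dominated.
Context {R : realType} dT {T : measurableType dT} (mu : {measure set T -> \bar R}).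

(** The domination holds only from some rank [N] on, whereas [dominated_cvg] wants it for every
    index; the sequence is shifted by [N]. *)
Lemma cvg_Rintegral_dominated (f : nat -> T -> R) (g G : T -> R) :
  (forall n, measurable_fun setT (f n)) ->
  (forall x, f n x @[n --> \oo] --> g x) ->
  mu.-integrable setT (EFin \o G) ->
  (\forall n \near \oo, forall x, `|f n x| <= G x) ->
  (fun n => \int[mu]_x f n x) @ \oo --> \int[mu]_x g x.
Proof.
move=> mf fg iG [N _ fG]; rewrite -(cvg_shiftn N).
have fgN x : f (n + N)%N x @[n --> \oo] --> g x by rewrite (cvg_shiftn N (f ^~ x)).
have mg : measurable_fun setT g.
  by apply: (measurable_fun_cvg (h := f)) => // x _; exact: fg.
have gG x : `|g x| <= G x.
  have h : `|f (n + N)%N x| @[n --> \oo] --> `|g x| by apply: cvg_norm; exact: fgN.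
  rewrite -(cvg_lim (@Rhausdorff R) h).
  apply: limr_le; first by apply/cvg_ex; eexists; exact: h.
  by near=> n; apply: fG; exact: leq_addl.
apply: fine_cvg; rewrite /Rintegral fineK; last first.
  apply: integrable_fin_num => //; apply: le_integrable iG => //.
    exact/measurable_EFinP.
  by move=> x _ /=; rewrite lee_fin (le_trans (gG x)) ?ler_norm.
apply: (@dominated_cvg _ _ _ mu setT measurableT
  (fun n x => (f (n + N)%N x)%:E) _ (fun x => (G x)%:E)) => //.
- by move=> n; exact/measurable_EFinP.
- by move=> x _; apply: cvg_EFin; [exact: nearW|exact: fgN].
- by move=> n x _ /=; rewrite lee_fin; apply: fG; exact: leq_addl.
Unshelve. all: end_near. Qed.

(** Dominated convergence speaks of sequences, so continuity of parameter integrals is tested along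
    them. A counterexample sequence is chosen from the balls of radius 1 / (n + 1). *)
Lemma sequential_continuous_at (V : normedModType R) (f : V -> R) (x : V) :
  (forall u : nat -> V, u n @[n --> \oo] --> x -> f (u n) @[n --> \oo] --> f x) ->
  {for x, continuous f}.
Proof.
move=> h; apply/cvgrPdist_lt => e e0; apply: contrapT => nf.
have /choice[u uP] : forall n : nat, exists y, `|x - y| < n.+1%:R^-1 /\ ~ `|f x - f y| < e.
  move=> n; apply: contrapT => /forallNP hn.
  have h1 : \forall y \near x, `|f x - f y| < e.
    have n0 : 0 < n.+1%:R^-1 :> R by rewrite invr_gt0.
    apply/nbhs_ballP; exists n.+1%:R^-1 => // y.
    rewrite -ball_normE /= => xy.
    by apply: contrapT => nxy; exact: (hn y).
  exact: nf h1.
have ux : u n @[n --> \oo] --> x.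
  apply/cvgrPdist_lt => d d0.
  have [k _ hk] := near_infty_natSinv_lt (PosNum d0).
  by exists k => // n /hk /= dn; apply: lt_trans dn; exact: (uP n).1.
have /cvgrPdist_lt/(_ e e0)[k _ /(_ k (leqnn k))] := h u ux.
exact: (uP k).2.
Qed.

Lemma continuous_Rintegral (V : normedModType R) (F : V -> T -> R) (x : V) (G : T -> R) :
  (forall v, measurable_fun setT (F v)) ->
  (forall y, {for x, continuous (F ^~ y)}) ->
  mu.-integrable setT (EFin \o G) ->
  (\forall v \near x, forall y, `|F v y| <= G y) ->
  {for x, continuous (fun v => \int[mu]_y F v y)}.
Proof.
move=> mF cF iG FG; apply: sequential_continuous_at => u ux.
apply: cvg_Rintegral_dominated iG _ => //.
- by move=> y; exact: (cvg_comp u (F ^~ y) ux (cF y)).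
- exact: (ux _ FG).
Qed.

End dominated.

(** * Gaussian integrals on R^d *)

Section rV_integration.
Context {R : realType}.
Notation leb := (@lebesgue_rV R).

Lemma continuous_measurable_rV d (f : 'rV[R]_d -> R) :
  continuous f -> measurable_fun setT f.
Proof.
move=> cf; apply: (measurability _ (RGenOpens.measurableE R)) => _ [_ [a [b ->]] <-].
rewrite setTI; apply: open_measurable_rV.
by apply: open_comp => [v _|]; [exact: cf|exact: interval_open].
Qed.

Lemma sqnorm_ge0 d (x : 'rV[R]_d) : 0 <= sqnorm x.
Proof. by apply: sumr_ge0 => i _; exact: sqr_ge0. Qed.

Lemma measurable_sqnorm d : measurable_fun setT (@sqnorm R d).
Proof.
apply: measurable_sum => i; apply: measurable_funX; exact: measurable_coord_rV.
Qed.

Lemma continuous_sqnorm d : continuous (@sqnorm R d).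
Proof.
suff h (s : seq 'I_d) : continuous (fun x : 'rV[R]_d => \sum_(i <- s) x ord0 i ^+ 2).
  exact: h.
elim: s => [|i s IH] x.
  have -> : (fun x : 'rV[R]_d => \sum_(i <- [::]) x ord0 i ^+ 2) = cst 0.
    by apply/funext => y; rewrite big_nil.
  exact: cst_continuous.
have -> : (fun x : 'rV[R]_d => \sum_(j <- i :: s) x ord0 j ^+ 2) =
    (fun x : 'rV[R]_d => x ord0 i ^+ 2) + (fun x => \sum_(j <- s) x ord0 j ^+ 2).
  by apply/funext => y; rewrite big_cons.
apply: continuousD; last exact: IH.
have c : {for x, continuous (fun x : 'rV[R]_d => x ord0 i)} by exact: coord_continuous.
exact: (continuous_comp c (@exprn_continuous R 2 _)).
Qed.

Lemma cons_rVl d (x : R) (v : 'rV[R]_d) (j : 'I_1) :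
  cons_rV (x, v) ord0 (lshift d j) = x.
Proof. by apply: etrans (row_mxEl _ _ _ _) _; rewrite (ord1 j) mxE eqxx mulr1n. Qed.

Lemma cons_rVr d (x : R) (v : 'rV[R]_d) (j : 'I_d) :
  cons_rV (x, v) ord0 (rshift 1 j) = v ord0 j.
Proof. exact: row_mxEr. Qed.

Lemma sqnorm_cons d (x : R) (v : 'rV[R]_d) :
  sqnorm (cons_rV (x, v)) = x ^+ 2 + sqnorm v.
Proof.
rewrite /sqnorm (@big_split_ord _ _ _ 1 d) big_ord1 cons_rVl; congr (_ + _).
by apply: eq_bigr => i _; rewrite cons_rVr.
Qed.

Lemma lincomb_rVE d (a b : R) (v w : 'rV[R]_d) j :
  (a *: v + b *: w) ord0 j = a * v ord0 j + b * w ord0 j.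
Proof. by rewrite !mxE. Qed.

Lemma cons_rV_lin d (a b x y : R) (v w : 'rV[R]_d) :
  cons_rV (a * x + b * y, a *: v + b *: w) =
  a *: cons_rV (x, v) + b *: cons_rV (y, w).
Proof.
apply/rowP => i; rewrite lincomb_rVE.
case: (@split_ordP 1 d i) => j ->; first by rewrite !cons_rVl.
by rewrite !cons_rVr lincomb_rVE.
Qed.

Lemma ge0_integral_rVS d (f : 'rV[R]_d.+1 -> \bar R) :
  measurable_fun setT f -> (forall x, 0 <= f x)%E ->
  (\int[leb d.+1]_x f x =
   \int[@lebesgue_measure R]_x \int[leb d]_v f (cons_rV (x, v)))%E.
Proof.
move=> mf f0.
rewrite [LHS](ge0_integral_pushforward (@measurable_cons_rV R d))//.
rewrite preimage_setT fubini_tonelli1//; last by move=> x /=.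
by apply: measurableT_comp => //; exact: measurable_cons_rV.
Qed.

(** The integrand is a multiple of the normal density with variance 1 / (2 a), whose total mass is
    1. *)
Lemma integral_gauss1 (a m : R) : 0 < a ->
  (\int[@lebesgue_measure R]_x (expR (- a * (x - m) ^+ 2))%:E = (Num.sqrt (pi / a))%:E)%E.
Proof.
move=> a0; pose s := Num.sqrt (1 / (2 * a)).
have s0 : s != 0 by rewrite sqrtr_eq0 -ltNge divr_gt0// mulr_gt0.
have s2 : s ^+ 2 *+ 2 = a^-1.
  rewrite sqr_sqrtr; last by rewrite divr_ge0// mulr_ge0// ltW.
  by rewrite -mulr_natr; field; rewrite gt_eqF.
have ps : normal_peak s = (Num.sqrt (pi / a))^-1.
  by rewrite /normal_peak -mulrnAl s2 mulrC.
have p0 : 0 < Num.sqrt (pi / a) :> R by rewrite sqrtr_gt0 divr_gt0// pi_gt0.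
have := integral_normal_pdf m s; rewrite normal_pdfE//.
under eq_integral => x _ do rewrite EFinM ps.
rewrite ge0_integralZl//; last 2 first.
- by apply/measurable_EFinP; exact: measurable_normal_fun.
- by move=> x _; rewrite lee_fin normal_fun_ge0.
move=> /(congr1 (fun z => (Num.sqrt (pi / a))%:E * z)%E).
rewrite muleA -EFinM mulfV ?gt_eqF// mul1e mule1 => <-.
apply: eq_integral => x _; rewrite /normal_fun s2 invrK.
by congr (expR _)%:E; ring.
Qed.

Lemma measurable_gauss d (a : R) :
  measurable_fun setT (fun x : 'rV[R]_d => expR (- a * sqnorm x)).
Proof.
apply: measurableT_comp => //; apply: measurable_funM => //.
exact: measurable_sqnorm.
Qed.

Lemma measurable_gauss_shift d (a : R) (m : 'rV[R]_d) :
  measurable_fun setT (fun x : 'rV[R]_d => expR (- a * sqnorm (x - m))).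
Proof.
apply: measurableT_comp => //; apply: measurable_funM => //.
rewrite /sqnorm; apply: measurable_sum => i; apply: measurable_funX.
under eq_fun do rewrite !mxE.
apply: measurable_funB => //; exact: measurable_coord_rV.
Qed.

Lemma cons_rV_surj d (x : 'rV[R]_d.+1) : exists p, x = cons_rV p.
Proof.
exists (x ord0 (lshift d (ord0 : 'I_1)), \row_j x ord0 (rshift 1 j)).
apply/rowP => i; case: (@split_ordP 1 d i) => j ->.
  by rewrite cons_rVl (ord1 j).
by rewrite cons_rVr mxE.
Qed.

Lemma integral_gauss_shift d (a : R) (m : 'rV[R]_d) : 0 < a ->
  (\int[leb d]_x (expR (- a * sqnorm (x - m)))%:E = ((Num.sqrt (pi / a)) ^+ d)%:E)%E.
Proof.
move=> a0; elim: d m => [|d IH] m.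
  rewrite integral_dirac//.
    by rewrite diracT mul1e /sqnorm big_ord0 mulr0 expR0 expr0.
  by apply/measurable_EFinP; exact: measurable_gauss_shift.
rewrite ge0_integral_rVS//; last first.
  by apply/measurable_EFinP; exact: measurable_gauss_shift.
have [[m1 m2] ->] := cons_rV_surj m.
have consB x v : cons_rV (x, v) - cons_rV (m1, m2) = cons_rV (x - m1, v - m2).
  have := cons_rV_lin 1 (-1) x m1 v m2.
  by rewrite !scale1r !scaleN1r mul1r mulN1r => ->.
under eq_integral => x _.
  under eq_integral => v _ do rewrite consB sqnorm_cons mulrDr expRD EFinM.
  rewrite ge0_integralZl//; last first.
    by apply/measurable_EFinP; exact: measurable_gauss_shift.
  rewrite IH.
  over.
rewrite ge0_integralZr//; last first.
  apply/measurable_EFinP; apply: measurableT_comp => //.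
  by apply: measurable_funM => //; apply: measurable_funX; exact: measurable_funB.
by rewrite integral_gauss1// -EFinM -exprS.
Qed.

Lemma integral_gauss d (a : R) : 0 < a ->
  (\int[leb d]_x (expR (- a * sqnorm x))%:E = ((Num.sqrt (pi / a)) ^+ d)%:E)%E.
Proof.
move=> a0; rewrite -(integral_gauss_shift (0 : 'rV[R]_d) a0).
by apply: eq_integral => x _; rewrite subr0.
Qed.

Definition gauss_dominated d (f : 'rV[R]_d -> R) :=
  exists C a : R, [/\ 0 <= C, 0 < a & forall x, `|f x| <= C * expR (- a * sqnorm x)].

Lemma integrable_gauss d (a : R) : 0 < a ->
  (leb d).-integrable setT (EFin \o (fun x : 'rV[R]_d => expR (- a * sqnorm x))).
Proof.
move=> a0; apply/integrableP; split.
  by apply/measurable_EFinP; exact: measurable_gauss.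
under eq_integral => x _ do rewrite /= ger0_norm ?expR_ge0//.
by rewrite integral_gauss// ltry.
Qed.

Lemma integrable_gaussM d (C a : R) : 0 < a ->
  (leb d).-integrable setT (EFin \o (fun x : 'rV[R]_d => C * expR (- a * sqnorm x))).
Proof.
move=> a0; have h := integrable_gauss d a0.
by have := integrableZl measurableT C h; apply: eq_integrable.
Qed.

Lemma gauss_dominated_integrable d (f : 'rV[R]_d -> R) :
  measurable_fun setT f -> gauss_dominated f ->
  (leb d).-integrable setT (EFin \o f).
Proof.
move=> mf [C [a [C0 a0 fC]]].
apply: (@le_integrable _ _ _ _ _ measurableT _
  (EFin \o (fun x => C * expR (- a * sqnorm x)))).
- exact/measurable_EFinP.
- move=> x _ /=; rewrite lee_fin (le_trans (fC x))//.
  by rewrite ler_norm.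
- exact: integrable_gaussM.
Qed.

End rV_integration.

(** * The four function inequality on R^d *)

Section four_function.
Context {R : realType}.
Notation leb1 := (@lebesgue_measure R).
Notation leb := (@lebesgue_rV R).

Lemma continuous_cons_rVl d (v : 'rV[R]_d) : continuous (fun x : R => cons_rV (x, v)).
Proof.
move=> x; apply/cvg_ballP => e e0; apply: filterS (nbhsx_ballx x e e0) => y xy.
split => // i j; rewrite (ord1 i); case: (@split_ordP 1 d j) => k ->.
  by rewrite !cons_rVl.
by rewrite !cons_rVr; exact: ballxx.
Qed.

Lemma continuous_cons_rVr d (x : R) : continuous (fun v : 'rV[R]_d => cons_rV (x, v)).
Proof.
move=> v; apply: (iffRL (@cvg_ballP _ _ _ (nbhs v) (nbhs_filter v) _ _)) => e e0.
rewrite near_simpl; apply: (@filterS _ _ (nbhs_filter v) _ _ _ (nbhsx_ballx v e e0)) => w vw.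
split => // i j; rewrite (ord1 i); case: (@split_ordP 1 d j) => k ->.
  by rewrite !cons_rVl; exact: ballxx.
by rewrite !cons_rVr; exact: vw.2.
Qed.

Lemma gauss_dominated_slice d (f : 'rV[R]_d.+1 -> R) x :
  gauss_dominated f -> gauss_dominated (fun v => f (cons_rV (x, v))).
Proof.
move=> [C [a [C0 a0 fC]]]; exists C, a; split => // v.
apply: le_trans (fC _) _; rewrite ler_wpM2l// ler_expR sqnorm_cons.
by rewrite ler_nM2l ?oppr_lt0// lerDr sqr_ge0.
Qed.

Lemma integral_rVS d (f : 'rV[R]_d.+1 -> R) : continuous f ->
  (forall x, 0 <= f x) -> gauss_dominated f ->
  \int[leb d.+1]_x f x = \int[leb1]_x \int[leb d]_v f (cons_rV (x, v)).
Proof.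
move=> cf f0 fd; rewrite {1}/Rintegral ge0_integral_rVS//; last first.
  by apply/measurable_EFinP; exact: continuous_measurable_rV.
congr fine; apply: eq_integral => x _; rewrite fineK//.
apply: integrable_fin_num => //; apply: gauss_dominated_integrable.
  apply: continuous_measurable_rV => v.
  exact: (continuous_comp (@continuous_cons_rVr _ x v) (cf _)).
exact: gauss_dominated_slice.
Qed.

(** Were the integral 0, [f] would vanish almost everywhere, and positivity would make the whole
    space a null set; the Gaussian integral shows that it is not. *)
Lemma Rintegral_gt0 d (f : 'rV[R]_d -> R) : measurable_fun setT f ->
  gauss_dominated f -> (forall x, 0 < f x) -> 0 < \int[leb d]_x f x.
Proof.
move=> mf fd f0; have fi := gauss_dominated_integrable mf fd.
rewrite lt_neqAle Rintegral_ge0 ?andbT; last by move=> x _; exact: ltW.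
apply/eqP => /esym f00.
have : (\int[leb d]_x `|(f x)%:E| = 0)%E.
  under eq_integral => x _ do rewrite /= gtr0_norm//.
  by rewrite -[LHS]fineK ?integrable_fin_num// -/(Rintegral _ _ _) f00.
move=> /(ae_eq_integral_abs _ measurableT) []; first exact/measurable_EFinP.
move=> N [mN N0 fN].
have NT : N = setT.
  apply/seteqP; split => // x _; apply: fN => /(_ I)/= [] /eqP.
  by rewrite gt_eqF.
have h := integral_gauss d (@ltr01 R).
have : (\int[leb d]_x `|(expR (- 1 * sqnorm x))%:E| = 0)%E.
  apply/(ae_eq_integral_abs _ measurableT).
    by apply/measurable_EFinP; exact: measurable_gauss.
  by exists N; rewrite NT; split => //; rewrite -NT.
under eq_integral => x _ do rewrite /= ger0_norm ?expR_ge0//.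
rewrite h => /eqP; rewrite eqe expf_eq0 => /andP[_].
by rewrite sqrtr_eq0 divr1 leNgt pi_gt0.
Qed.

(* Positivity and Gaussian domination are inherited by marginals, which lets the
   four function inequality be proved by induction on the dimension. *)
Definition gauss_density d (f : 'rV[R]_d -> R) :=
  [/\ continuous f, forall x, 0 < f x & gauss_dominated f].

Lemma gauss_density_integrable d (f : 'rV[R]_d -> R) : gauss_density f ->
  (leb d).-integrable setT (EFin \o f).
Proof.
by case=> cf _ fd; apply: gauss_dominated_integrable => //;
  exact: continuous_measurable_rV.
Qed.

Lemma gauss_density_slice d (f : 'rV[R]_d.+1 -> R) x :
  gauss_density f -> gauss_density (fun v => f (cons_rV (x, v))).
Proof.
case=> cf f0 fd; split => //; last exact: gauss_dominated_slice.
by move=> v; exact: (continuous_comp (@continuous_cons_rVr _ x v) (cf _)).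
Qed.

Section marginal.
Context d (f : 'rV[R]_d.+1 -> R) (fG : gauss_density f).

Definition marginal x := \int[leb d]_v f (cons_rV (x, v)).

Lemma marginal_gt0 x : 0 < marginal x.
Proof.
have [c f0 fd] := gauss_density_slice x fG.
by apply: Rintegral_gt0 => //; exact: continuous_measurable_rV.
Qed.

(** Dropping the square of the first coordinate from the exponent bounds all slices by one and the
    same Gaussian, so dominated convergence applies. *)
Lemma continuous_marginal : continuous marginal.
Proof.
have [cf f0 [C [a [C0 a0 fC]]]] := fG.
move=> x; apply: (@continuous_Rintegral _ _ _ (leb d) R^o (fun x v => f (cons_rV (x, v)))
  x _ _ _ (integrable_gaussM d C a0)).
- by move=> y; have [c _ _] := gauss_density_slice y fG; exact: continuous_measurable_rV.
- move=> v; exact: (continuous_comp (@continuous_cons_rVl _ v x) (cf _)).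
- apply/nbhs_ballP; exists 1 => [|y _ v]; first exact: ltr01.
   apply: le_trans (fC _) _.
  rewrite ler_wpM2l// ler_expR sqnorm_cons.
  by rewrite ler_nM2l ?oppr_lt0// lerDr sqr_ge0.
Qed.

Lemma slice_integralE x :
  (\int[leb d]_v (f (cons_rV (x, v)))%:E = (marginal x)%:E)%E.
Proof.
rewrite fineK//; apply: integrable_fin_num => //.
exact/gauss_density_integrable/gauss_density_slice.
Qed.

Lemma integrable_marginal : leb1.-integrable setT (EFin \o marginal).
Proof.
have [cf f0 fd] := fG; have fi := gauss_density_integrable fG.
have mf := continuous_measurable_rV cf.
apply/integrableP; split.
  by apply/measurable_EFinP; exact: continuous_measurable_fun continuous_marginal.
have /integrableP[_] := fi.
rewrite ge0_integral_rVS//; last by apply: measurableT_comp => //; exact/measurable_EFinP.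
congr (_ < _)%E; apply: eq_integral => x _.
rewrite /= gtr0_norm ?marginal_gt0// -slice_integralE.
by apply: eq_integral => v _; rewrite gtr0_norm.
Qed.

Lemma integral_marginal : \int[leb d.+1]_x f x = \int[leb1]_x marginal x.
Proof. by have [cf f0 fd] := fG; apply: integral_rVS => // x; exact: ltW. Qed.

End marginal.

Lemma four_function_rV d (t : R) (f g h k : 'rV[R]_d -> R) : 0 <= t <= 1 ->
  gauss_density f -> gauss_density g -> gauss_density h -> gauss_density k ->
  (forall x y, f x * g y <=
    h ((1 - t) *: x + t *: y) * k (t *: x + (1 - t) *: y)) ->
  (\int[leb d]_x f x) * (\int[leb d]_x g x) <=
  (\int[leb d]_x h x) * (\int[leb d]_x k x).
Proof.
move=> t01; elim: d f g h k => [|d IH] f g h k fG gG hG kG H.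
  have int0 (u : 'rV[R]_0 -> R) : gauss_density u -> \int[leb 0]_x u x = u 0.
    move=> [cu _ _]; rewrite /Rintegral integral_dirac//.
      by rewrite diracT mul1e.
    by apply/measurable_EFinP; exact: continuous_measurable_rV.
  by rewrite !int0//; have := H 0 0; rewrite !scaler0 addr0.
rewrite !integral_marginal//.
apply: (@four_function_R _ t) => //.
all: try exact: continuous_marginal. 
all: try exact: integrable_marginal.
all: try exact: marginal_gt0.
(* The slices at first coordinates [x], [y] and at their two interpolations satisfy the hypothesis
   in dimension [d]; the induction hypothesis turns it into the one-dimensional hypothesis on the
   marginals. *)
move=> x y; apply: IH; try exact: gauss_density_slice.
by move=> v w; rewrite !cons_rV_lin; exact: H.
Qed.

End four_function.

(** * Expectations of bounded measurable functions *)

Section bounded_measurable.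
Context {R : realType} d {T : measurableType d}.
Implicit Types f g : T -> R.

Definition bmeas f := measurable_fun setT f /\ exists M : R, forall x, `|f x| <= M.

Lemma bmeas_cst c : bmeas (fun=> c).
Proof. by split; [exact: measurable_cst|exists `|c|]. Qed.

Lemma bmeasD f g : bmeas f -> bmeas g -> bmeas (fun x => f x + g x).
Proof.
move=> [mf [M fM]] [mg [N gN]]; split; first exact: measurable_funD.
by exists (M + N) => x; rewrite (le_trans (ler_normD _ _))// lerD.
Qed.

Lemma bmeasM f g : bmeas f -> bmeas g -> bmeas (fun x => f x * g x).
Proof.
move=> [mf [M fM]] [mg [N gN]]; split; first exact: measurable_funM.
by exists (M * N) => x; rewrite normrM ler_pM.
Qed.

Lemma bmeasZ c f : bmeas f -> bmeas (fun x => c * f x).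
Proof. by move=> bf; apply: bmeasM => //; exact: bmeas_cst. Qed.

Lemma bmeasB f g : bmeas f -> bmeas g -> bmeas (fun x => f x - g x).
Proof.
move=> bf bg; have := bmeasD bf (bmeasZ (-1) bg).
by congr bmeas; apply/funext => x; rewrite mulN1r.
Qed.

Lemma bmeasX n f : bmeas f -> bmeas (fun x => f x ^+ n).
Proof.
move=> bf; elim: n => [|n IH].
  by under eq_fun do rewrite expr0; exact: bmeas_cst.
by under eq_fun do rewrite exprS; exact: bmeasM.
Qed.

Lemma bmeas_norm f : bmeas f -> bmeas (fun x => `|f x|).
Proof.
move=> [mf [M fM]]; split; first exact: measurableT_comp.
by exists M => x; rewrite normr_id.
Qed.

Lemma bmeas_indic (A : set T) : measurable A -> bmeas (\1_A).
Proof.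
move=> mA; split; first exact: measurable_indic.
by exists 1 => x; rewrite indicE; case: (_ \in _); rewrite ?normr1 ?normr0.
Qed.

Lemma bmeas_expR f : bmeas f -> bmeas (fun x => expR (f x)).
Proof.
move=> [mf [M fM]]; split; first exact: measurableT_comp.
exists (expR M) => x; rewrite ger0_norm ?expR_ge0// ler_expR.
exact: le_trans (ler_norm _) (fM x).
Qed.

Lemma bmeas_ln f c : 0 < c -> (forall x, c <= f x) -> bmeas f ->
  bmeas (fun x => ln (f x)).
Proof.
move=> c0 cf [mf [M fM]]; split; first exact: measurableT_comp.
have f0 x : 0 < f x by exact: lt_le_trans (cf x).
exists (`|ln c| + `|ln M|) => x.
have fM' : f x <= M by exact: le_trans (ler_norm _) (fM x).
have h1 : ln c <= ln (f x) by rewrite ler_ln ?posrE.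
have h2 : ln (f x) <= ln M by rewrite ler_ln ?posrE// (lt_le_trans (f0 x)).
have h3 := ler_norm (- ln c); rewrite normrN in h3.
have h4 := ler_norm (ln M); have h5 := normr_ge0 (ln c); have h6 := normr_ge0 (ln M).
by rewrite ler_norml; apply/andP; split; lra.
Qed.

(* Probability measures and Markov kernels enter the argument only through the
   expectations of bounded measurable functions. *)
Record expectation_like (L : (T -> R) -> R) : Prop := ExpectationLike {
  el_lin : forall a b f g, bmeas f -> bmeas g ->
    L (fun x => a * f x + b * g x) = a * L f + b * L g ;
  el_le : forall f g, bmeas f -> bmeas g -> (forall x, f x <= g x) -> L f <= L g ;
  el_one : L (fun=> 1) = 1 }.

Section theory.
Variables (L : (T -> R) -> R) (HL : expectation_like L).

Lemma el_cst c : L (fun=> c) = c.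
Proof.
have -> : (fun=> c) = (fun _ : T => c * 1 + 0 * 1).
  by apply/funext => x; rewrite mul0r addr0 mulr1.
by rewrite (el_lin HL); [rewrite el_one//; ring|exact: bmeas_cst|exact: bmeas_cst].
Qed.

Lemma elD f g : bmeas f -> bmeas g -> L (fun x => f x + g x) = L f + L g.
Proof.
move=> bf bg; have := el_lin HL 1 1 bf bg; rewrite !mul1r => <-; congr L.
by apply/funext => x; rewrite !mul1r.
Qed.

Lemma elZ c f : bmeas f -> L (fun x => c * f x) = c * L f.
Proof.
move=> bf; have := el_lin HL c 0 bf bf; rewrite mul0r addr0 => <-; congr L.
by apply/funext => x; rewrite mul0r addr0.
Qed.

Lemma elB f g : bmeas f -> bmeas g -> L (fun x => f x - g x) = L f - L g.
Proof.
move=> bf bg; have := el_lin HL 1 (-1) bf bg; rewrite !mul1r mulN1r => <-; congr L.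
by apply/funext => x; rewrite mul1r mulN1r.
Qed.

Lemma el_ge0 f : bmeas f -> (forall x, 0 <= f x) -> 0 <= L f.
Proof. by move=> bf f0; rewrite -(el_cst 0); apply: el_le => //; exact: bmeas_cst. Qed.

Lemma el_geC c f : bmeas f -> (forall x, c <= f x) -> c <= L f.
Proof. by move=> bf f0; rewrite -(el_cst c); apply: el_le => //; exact: bmeas_cst. Qed.

Lemma el_leC c f : bmeas f -> (forall x, f x <= c) -> L f <= c.
Proof. by move=> bf f0; rewrite -(el_cst c); apply: el_le => //; exact: bmeas_cst. Qed.

Lemma el_norm_le M f : bmeas f -> (forall x, `|f x| <= M) -> `|L f| <= M.
Proof.
move=> bf fM; rewrite ler_norml el_leC//= ?el_geC// => x.
  by have := fM x; rewrite ler_norml => /andP[].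
by have := fM x; rewrite ler_norml => /andP[].
Qed.

Lemma el_norm f : bmeas f -> `|L f| <= L (fun x => `|f x|).
Proof.
move=> bf; have bn := bmeas_norm bf; rewrite ler_norml; apply/andP; split.
  rewrite -mulN1r -elZ//; apply: el_le => //; first exact: bmeasZ.
  by move=> x; rewrite mulN1r lerNl -normrN ler_norm.
by apply: el_le => // x; exact: ler_norm.
Qed.

Definition variance_of f := L (fun x => f x ^+ 2) - L f ^+ 2.

Lemma variance_shift c f : bmeas f ->
  L (fun x => (f x - c) ^+ 2) = variance_of f + (L f - c) ^+ 2.
Proof.
move=> bf; have b2 := bmeasX 2 bf.
have -> : (fun x => (f x - c) ^+ 2) =
   (fun x => 1 * f x ^+ 2 + 1 * ((- (2 * c)) * f x + c ^+ 2 * 1)).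
  by apply/funext => x; ring.
rewrite el_lin//; last by apply: bmeasD; [exact: bmeasZ|exact: bmeas_cst].
by rewrite el_lin ?el_one//; [rewrite /variance_of; ring|exact: bmeas_cst].
Qed.

Lemma variance_of_ge0 f : bmeas f -> 0 <= variance_of f.
Proof.
move=> bf; have := variance_shift (L f) bf; rewrite subrr expr0n addr0 => <-.
apply: el_ge0; last by move=> x; exact: sqr_ge0.
by apply: bmeasX; apply: bmeasB => //; exact: bmeas_cst.
Qed.

Lemma el_sqr_le f : bmeas f -> L f ^+ 2 <= L (fun x => f x ^+ 2).
Proof. by move=> /variance_of_ge0; rewrite /variance_of subr_ge0. Qed.

(** Jensen's inequality, by integrating the tangent line of the exponential at [L f]. *)
Lemma el_expR_le f : bmeas f -> expR (L f) <= L (fun x => expR (f x)).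
Proof.
move=> bf.
have h x : expR (L f) * f x + expR (L f) * (1 - L f) <= expR (f x).
  have -> : expR (f x) = expR (L f) * expR (f x - L f) by rewrite -expRD addrC subrK.
  rewrite -mulrDr ler_pM2l ?expR_gt0//.
  by apply: le_trans (expR_ge1Dx _); rewrite le_eqVlt; apply/orP; left; apply/eqP; ring.
have bc := bmeas_cst (expR (L f) * (1 - L f)).
have := el_le HL (bmeasD (bmeasZ (expR (L f)) bf) bc) (bmeas_expR bf) h.
rewrite elD//; last exact: bmeasZ.
rewrite el_cst elZ//; apply: le_trans.
by rewrite le_eqVlt; apply/orP; left; apply/eqP; ring.
Qed.

Lemma ln_le_tangent (m z : R) : 0 < m -> 0 < z -> ln z <= ln m + (z / m - 1).
Proof.
move=> m0 z0; have zm : 0 < z / m by rewrite divr_gt0.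
have -> : z = m * (z / m) by field; rewrite gt_eqF.
rewrite lnM ?posrE// lerD2l (mulrC m) mulfK ?gt_eqF//.
have e1 : 1 + (z / m - 1) = z / m by rewrite addrC subrK.
rewrite -[in leLHS]e1; apply: le_ln1Dx.
by rewrite ltrBrDl subrr.
Qed.

(** Jensen's inequality again, with the tangent of the logarithm at [L f]; the lower bound [c] keeps
    [ln (f x)] bounded. *)
Lemma el_ln_le c f : 0 < c -> (forall x, c <= f x) -> bmeas f ->
  L (fun x => ln (f x)) <= ln (L f).
Proof.
move=> c0 cf bf; have m0 : 0 < L f by apply: lt_le_trans (el_geC bf cf).
have h x : ln (f x) <= (L f)^-1 * f x + (ln (L f) - 1).
  apply: le_trans (ln_le_tangent m0 (lt_le_trans c0 (cf x))) _.
  by rewrite le_eqVlt; apply/orP; left; apply/eqP; ring.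
have bc := bmeas_cst (ln (L f) - 1).
have := el_le HL (bmeas_ln c0 cf bf) (bmeasD (bmeasZ (L f)^-1 bf) bc) h.
rewrite elD//; last exact: bmeasZ.
rewrite el_cst elZ// mulVf ?gt_eqF// => /le_trans; apply.
by rewrite addrC subrK.
Qed.

End theory.

Lemma expectation_like_Rintegral (mu : probability T R) :
  expectation_like (fun f => \int[mu]_x f x).
Proof.
have bi f : bmeas f -> mu.-integrable setT (EFin \o f).
  move=> [mf [M fM]].
  apply: (@le_integrable _ _ _ mu _ measurableT _ (EFin \o (fun=> M))).
  - exact/measurable_EFinP.
  - by move=> x _ /=; rewrite lee_fin (le_trans (fM x))// ler_norm.
  - exact: (finite_measure_integrable_cst mu M measurableT).
have biZ c f : bmeas f -> mu.-integrable setT (EFin \o (fun x => c * f x)).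
  by move=> bf; apply: bi; exact: bmeasZ.
split.
- move=> a b f g bf bg; rewrite RintegralD//; try exact: biZ.
  by rewrite !RintegralZl//; exact: bi.
- by move=> f g bf bg fg; apply: le_Rintegral => //; exact: bi.
- by rewrite Rintegral_cst// [X in fine X]probability_setT /= mulr1.
Qed.

(* Both functionals are compared on the step functions
   [e * sum_(j < N) 1_{f >= (j + 1) e}], which approximate [f >= 0] within [e]. *)
Lemma expectation_like_eq (L1 L2 : (T -> R) -> R) :
  expectation_like L1 -> expectation_like L2 ->
  (forall A, measurable A -> L1 \1_A = L2 \1_A) ->
  forall f, bmeas f -> L1 f = L2 f.
Proof.
move: L1 L2; suff H (L1 L2 : (T -> R) -> R) : expectation_like L1 -> expectation_like L2 ->
    (forall A, measurable A -> L1 \1_A = L2 \1_A) ->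
    forall f, bmeas f -> (forall x, 0 <= f x) -> L1 f <= L2 f.
  move=> L1 L2; move=> H1 H2 H12 f bf; have [mf [M fM]] := bf.
  have bfM : bmeas (fun x => f x + M) by apply: bmeasD => //; exact: bmeas_cst.
  have fM0 x : 0 <= f x + M by have := fM x; rewrite ler_norml => /andP[]; lra.
  have := H _ _ H1 H2 H12 _ bfM fM0.
  have := H _ _ H2 H1 (fun A mA => esym (H12 A mA)) _ bfM fM0.
  rewrite !elD//; try exact: bmeas_cst.
  by rewrite !el_cst// !lerD2r => h1 h2; apply/eqP; rewrite eq_le h1 h2.
move=> H1 H2 H12 f bf f0; have [mf [M fM]] := bf.
apply/ler_addgt0Pr => e e0.
pose A j := [set x | j.+1%:R * e <= f x].
have mA j : measurable (A j).
  rewrite -[A j]setTI; apply: measurable_fun_le => //; exact: measurable_cst.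
pose s N x := \sum_(j < N) e * \1_(A j) x.
have bs N : bmeas (s N).
  elim: N => [|N IH].
    by rewrite /s; under eq_fun do rewrite big_ord0; exact: bmeas_cst.
  rewrite /s; under eq_fun do rewrite big_ord_recr /=.
  by apply: bmeasD => //; apply: bmeasZ; exact: bmeas_indic.
have Ls N : L1 (s N) = L2 (s N).
  elim: N => [|N IH].
    have -> : s 0%N = fun=> 0 by apply/funext => x; rewrite /s big_ord0.
    by rewrite !el_cst.
  have -> : s N.+1 = fun x => s N x + e * \1_(A N) x.
    by apply/funext => x; rewrite /s big_ord_recr.
  have bi := bmeas_indic (mA N); have bei := bmeasZ e bi.
  by rewrite !elD// !elZ// IH H12.
(* Either some level has overtaken [f x], and the sum is within [e] of it, or every indicator so far
   equals 1. In the second case the sum is [N e], which also dominates [f x] once [N e] reaches the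
   bound [M]. *)
have sP N x : [/\ s N x <= f x, s N x <= N%:R * e & f x <= s N x + e \/ s N x = N%:R * e].
  elim: N => [|N [h1 h2 h3]].
    by rewrite /s big_ord0 mul0r; split => //; right.
  rewrite /s big_ord_recr /= -/(s N x) indicE -natr1 mulrDl mul1r.
  have [|NA] := boolP (x \in A N).
    rewrite inE /A /= -natr1 mulrDl mul1r => NA; rewrite mulr1.
    split; [lra|lra|right; case: h3 => h3; lra].
  have {}NA : f x < N%:R * e + e.
    by move: NA; rewrite notin_setE /A /= -natr1 mulrDl mul1r => /negP; rewrite -ltNge.
  rewrite mulr0 addr0; split => //; [lra|left; case: h3 => h3; lra].
have [N NM] : exists N : nat, M <= N%:R * e.
  exists (Num.truncn (M / e)).+1; rewrite -ler_pdivrMr//.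
  exact/ltW/truncnS_gt.
have sN x : s N x <= f x <= s N x + e.
  have [h1 h2 h3] := sP N x; rewrite h1/=.
  have fM' : f x <= M by exact: le_trans (ler_norm _) (fM x).
  by case: h3 => h3; lra.
have be := bmeas_cst e.
apply: (@le_trans _ _ (L1 (fun x => s N x + e))).
  apply: el_le => //; first exact: bmeasD.
  by move=> x; have /andP[] := sN x.
rewrite elD// el_cst// Ls lerD2r; apply: el_le => //.
by move=> x; have /andP[] := sN x.
Qed.

End bounded_measurable.

(** * The backward kernel *)

Section sqnorm_theory.
Context {R : realType} {d : nat}.
Implicit Types x y : 'rV[R]_d.

Lemma coordB x y i : (x - y) ord0 i = x ord0 i - y ord0 i.
Proof. by rewrite !mxE. Qed.

Lemma sqnorm_le2 x y : sqnorm x <= 2 * sqnorm (x - y) + 2 * sqnorm y.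
Proof.
rewrite /sqnorm !mulr_sumr -big_split /=; apply: ler_sum => i _.
rewrite coordB; have := sqr_ge0 (x ord0 i - 2 * y ord0 i); nra.
Qed.

Lemma sqnormN x : sqnorm (- x) = sqnorm x.
Proof. by apply: eq_bigr => i _; rewrite mxE sqrrN. Qed.

Lemma sqnormBC x y : sqnorm (x - y) = sqnorm (y - x).
Proof. by rewrite -sqnormN opprB. Qed.

Lemma sqnorm0 : sqnorm (0 : 'rV[R]_d) = 0.
Proof. by apply: big1 => i _; rewrite mxE expr0n. Qed.

Lemma sqnormZ a x : sqnorm (a *: x) = a ^+ 2 * sqnorm x.
Proof. by rewrite /sqnorm mulr_sumr; apply: eq_bigr => i _; rewrite mxE exprMn. Qed.

Lemma coord_sqnorm x i : x ord0 i ^+ 2 <= sqnorm x.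
Proof.
rewrite /sqnorm (bigD1 i)//= lerDl; apply: sumr_ge0 => j _; exact: sqr_ge0.
Qed.

Lemma convex_functionE (V : 'rV[R]_d -> R) (t : R) x y : convex_function setT V ->
  0 <= t <= 1 -> V (t *: x + (1 - t) *: y) <= t * V x + (1 - t) * V y.
Proof.
move=> cV /andP[t0 t1].
have := cV (Itv01 t0 t1) x y; rewrite !inE => /(_ I I).
by rewrite convRE.
Qed.

Lemma convex_function0 : convex_function setT (fun _ : 'rV[R]_d => 0 : R).
Proof. by move=> t x y _ _; rewrite convRE !mulr0 addr0. Qed.

End sqnorm_theory.

(* The locks keep unification from unfolding the integrals. *)
Fact mass_key : unit. Proof. exact: tt. Qed.
Fact kern_key : unit. Proof. exact: tt. Qed.

Section kernel.
Context {R : realType} {d : nat} (V : 'rV[R]_d -> R) (h : R).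
Hypotheses (cV : continuous V) (cvxV : convex_function setT V) (h0 : 0 < h).
Notation leb := (@lebesgue_rV R d).
Implicit Types x y : 'rV[R]_d.
Local Notation wt := (backward_weight V h).

(* Convexity along the segment from [0] to [x], whose initial part lies in a
   neighbourhood of [0] where [V] is bounded. *)
Lemma convex_linear_minorant : exists L, forall x, - V x <= L * Num.sqrt (1 + sqnorm x).
Proof.
have c0 : V x @[x --> (0 : 'rV[R]_d)] --> V 0 by exact: cV.
move: c0 => /cvgrPdist_lt/(_ 1 ltr01)/nbhs_ballP[e /= e0 He].
pose B := `|V 0| + 1.
have VB u : ball (0 : 'rV[R]_d) e u -> - B <= V u.
  move=> /He; rewrite ltr_norml => /andP[_ h2].
  by have := ler_norm (- V 0); rewrite normrN /B; lra.
have B0 : 0 <= B by rewrite addr_ge0.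
pose s := Num.min e 1 / 2.
have s0 : 0 < s by rewrite divr_gt0// lt_min e0/=.
have se : s < e.
  by rewrite ltr_pdivrMr// (@le_lt_trans _ _ e) ?ge_min ?lexx// ltr_pMr// ltr1n.
have s1 : s <= 1.
  by rewrite ler_pdivrMr// mul1r (@le_trans _ _ 1) ?ge_min ?lexx ?orbT// ler1n.
exists (2 * B / s) => x; set r := Num.sqrt _.
have r1 : 1 <= r by rewrite -[leLHS]sqrtr1 ler_sqrt ?lerDl ?sqnorm_ge0// addr_ge0// sqnorm_ge0.
have r0 : 0 < r by exact: lt_le_trans r1.
have rx i : `|x ord0 i| <= r.
  rewrite -sqrtr_sqr ler_sqrt; last by rewrite addr_ge0// sqnorm_ge0.
  by rewrite (le_trans (coord_sqnorm x i))// lerDr.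
(* Each coordinate of [x] is at most [r] in absolute value, so [t *: x] lies in the sup-norm ball of
   radius [e] around 0. *)
pose t := s / r.
have t0 : 0 < t by rewrite divr_gt0.
have t1 : t <= 1 by rewrite ler_pdivrMr// mul1r (le_trans s1).
have := convex_functionE x 0 cvxV (t := t); rewrite (ltW t0) t1 => /(_ isT).
rewrite scaler0 addr0.
have : - B <= V (t *: x).
  apply: VB; split => // i j; rewrite (ord1 i) /ball /= !mxE sub0r normrN normrM.
  rewrite (gtr0_norm t0); apply: le_lt_trans se.
  by rewrite /t mulrAC ler_pdivrMr// ler_wpM2l// ltW.
have V0 : V 0 <= B by rewrite (le_trans (ler_norm _))// lerDl.
move=> h1 h2.
have h3 : - (t * V x) <= 2 * B by nra.
have -> : 2 * B / s * r = 2 * B / t.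
  have -> : t^-1 = r / s by rewrite /t invf_div.
  by rewrite mulrA mulrAC.
by rewrite ler_pdivlMr// mulrC mulrN.
Qed.

(** Young's inequality absorbs the linear minorant into an arbitrarily small quadratic, which a
    Gaussian factor of any step size then beats. *)
Lemma potential_lower_bound (a : R) : 0 < a ->
  exists B, forall x, - V x <= B + a * sqnorm x.
Proof.
move=> a0; have [L HL] := convex_linear_minorant.
exists (L ^+ 2 / (4 * a) + a) => x; apply: le_trans (HL x) _.
set r := Num.sqrt _.
have r2 : r ^+ 2 = 1 + sqnorm x by rewrite sqr_sqrtr// addr_ge0// sqnorm_ge0.
have -> : L ^+ 2 / (4 * a) + a + a * sqnorm x = L ^+ 2 / (4 * a) + a * r ^+ 2.
  by rewrite r2; ring.
have : 0 <= a * (r - L / (2 * a)) ^+ 2 by rewrite mulr_ge0 ?sqr_ge0 ?ltW.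
have -> : a * (r - L / (2 * a)) ^+ 2 = a * r ^+ 2 - L * r + L ^+ 2 / (4 * a).
  by field; rewrite gt_eqF.
lra.
Qed.

Lemma weight_gt0 y x : 0 < wt y x. Proof. exact: expR_gt0. Qed.

(** Since |x|^2 <= 2 |x - y|^2 + 2 |y|^2, the Gaussian factor decays at rate 1 / (4 h) in |x|^2. The
    potential consumes half of it, leaving 1 / (8 h). Uniformity over bounded [y] is what yields
    continuity in [y]. *)
Lemma weight_le (rho : R) : exists C : R, 0 <= C /\ forall y, sqnorm y <= rho ->
  forall x, wt y x <= C * expR (- (8 * h)^-1 * sqnorm x).
Proof.
have h8 : 0 < (8 * h)^-1 by rewrite invr_gt0 mulr_gt0.
have [B HB] := potential_lower_bound h8.
exists (expR (B + rho / (2 * h))); split; first exact: expR_ge0.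
move=> y yr x; rewrite -expRD ler_expR.
have h1 := HB x.
have h2 := sqnorm_le2 x y.
have h3 : (2 * h)^-1 * sqnorm x <= (2 * h)^-1 * (2 * sqnorm (x - y) + 2 * rho).
  rewrite ler_pM2l ?invr_gt0 ?mulr_gt0//; lra.
have e1 : (2 * h)^-1 = 4 * (8 * h)^-1 by field; rewrite gt_eqF.
rewrite e1 in h3 *; set k := (8 * h)^-1 in h1 h3 h8 *.
by nra.
Qed.

Lemma continuous_weight y : continuous (wt y).
Proof.
move=> x.
have c1 : {for x, continuous (fun x : 'rV[R]_d => x - y)}.
  by apply: continuousB; [exact: cvg_id|exact: cst_continuous].
have c2 := continuous_comp c1 (@continuous_sqnorm R d _).
have c3 : {for x, continuous (fun x => - V x - sqnorm (x - y) / (2 * h))}.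
  apply: continuousB; first by apply: continuousN; exact: cV.
  by apply: continuousM; [exact: c2|exact: cst_continuous].
exact: (continuous_comp c3 (@continuous_expR R _)).
Qed.

Lemma continuous_weightl x : continuous (fun y => wt y x).
Proof.
move=> y.
have c1 : {for y, continuous (fun y : 'rV[R]_d => x - y)}.
  by apply: continuousB; [exact: cst_continuous|exact: cvg_id].
have c2 := continuous_comp c1 (@continuous_sqnorm R d _).
have c3 : {for y, continuous (fun y => - V x - sqnorm (x - y) / (2 * h))}.
  apply: continuousB; first exact: cst_continuous.
  by apply: continuousM; [exact: c2|exact: cst_continuous].
exact: (continuous_comp c3 (@continuous_expR R _)).
Qed.

Lemma measurable_weight y : measurable_fun setT (wt y).
Proof. apply: continuous_measurable_rV; exact: continuous_weight. Qed.

Lemma gauss_density_weight y : gauss_density (wt y).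
Proof.
split; [exact: continuous_weight|exact: weight_gt0|].
have [C [C0 HC]] := weight_le (sqnorm y).
exists C, (8 * h)^-1; split => // [|x]; first by rewrite invr_gt0 mulr_gt0.
by rewrite gtr0_norm ?weight_gt0// HC.
Qed.

Lemma gauss_densityM (f g : 'rV[R]_d -> R) M : gauss_density f ->
  continuous g -> (forall x, 0 < g x <= M) -> gauss_density (fun x => g x * f x).
Proof.
move=> [cf f0 [C [a [C0 a0 fC]]]] cg gM; split.
- by move=> x; apply: continuousM; [exact: cg|exact: cf].
- by move=> x; have /andP[g0 _] := gM x; rewrite mulr_gt0.
- have M0 : 0 <= M by have /andP[g0 gM0] := gM 0; rewrite ltW// (lt_le_trans g0).
  exists (M * C), a; split => // [|x]; first exact: mulr_ge0.
  have /andP[g0 gM'] := gM x.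
  by rewrite normrM -mulrA ler_pM// gtr0_norm.
Qed.

Lemma integrable_weight f y : bmeas f -> leb.-integrable setT (EFin \o (fun x => f x * wt y x)).
Proof.
move=> [mf [M fM]].
have [_ _ [C [a [C0 a0 HC]]]] := gauss_density_weight y.
apply: gauss_dominated_integrable.
  by apply: measurable_funM => //; exact: measurable_weight.
exists (`|M| * C), a; split => // [|x]; first by rewrite mulr_ge0.
by rewrite normrM -mulrA ler_pM// (le_trans (fM x))// ler_norm.
Qed.

Definition mass : 'rV[R]_d -> R := locked_with mass_key (fun y => \int[leb]_x wt y x).

Lemma massE y : mass y = \int[leb]_x wt y x.
Proof. by rewrite /mass unlock. Qed.

Lemma mass_gt0 y : 0 < mass y.
Proof.
by rewrite massE; have [_ w0 dw] := gauss_density_weight y; apply: Rintegral_gt0 => //;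
  exact: measurable_weight.
Qed.

(** For [V = 0] this is the Gaussian kernel of the forward step, so what is proved for convex [V]
    covers both half-steps of the sampler. *)
Definition kern : ('rV[R]_d -> R) -> 'rV[R]_d -> R :=
  locked_with kern_key (fun f y => (\int[leb]_x (f x * wt y x)) / mass y).

Lemma kernE f y : kern f y = (\int[leb]_x (f x * wt y x)) / mass y.
Proof. by rewrite /kern unlock. Qed.

Lemma kern_mass f y : \int[leb]_x (f x * wt y x) = kern f y * mass y.
Proof. by rewrite kernE divfK// gt_eqF// mass_gt0. Qed.

Lemma kern_expectation y : expectation_like (kern ^~ y).
Proof.
have m0 := mass_gt0 y.
split.
- move=> a b f g bf bg; rewrite !kernE.
  under eq_Rintegral => x _ do rewrite mulrDl -!mulrA.
  have ia c u : bmeas u -> leb.-integrable setT (EFin \o (fun x => c * (u x * wt y x))).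
    move=> bu; have := integrable_weight y (bmeasZ c bu).
    by apply: eq_integrable => // x _; rewrite /= mulrA.
  rewrite RintegralD//; try exact: ia.
  rewrite !RintegralZl//; try exact: integrable_weight.
  by ring.
- move=> f g bf bg fg; rewrite !kernE ler_pM2r ?invr_gt0//.
  apply: le_Rintegral => //; try exact: integrable_weight.
  by move=> x _; rewrite ler_wpM2r// ltW// weight_gt0.
- rewrite kernE; under eq_Rintegral => x _ do rewrite mul1r.
  by rewrite -massE divff// gt_eqF.
Qed.

Lemma continuous_integral_weight f : bmeas f ->
  continuous (fun y => \int[leb]_x (f x * wt y x)).
Proof.
move=> [mf [M fM]] y.
have [C [C0 HC]] := weight_le (sqnorm y + 1).
have h8 : 0 < (8 * h)^-1 by rewrite invr_gt0 mulr_gt0.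
apply: (@continuous_Rintegral _ _ _ leb _ (fun y x => f x * wt y x) y _ _ _
  (integrable_gaussM d (`|M| * C) h8)).
- by move=> z; apply: measurable_funM => //; exact: measurable_weight.
- move=> x; apply: continuousM; [exact: cst_continuous|exact: continuous_weightl].
- have c0 : sqnorm z @[z --> y] --> sqnorm y by exact: continuous_sqnorm.
  move: c0 => /cvgr_lt/(_ (sqnorm y + 1)).
  rewrite ltrDl ltr01 => /(_ isT); apply: filterS => z zy x.
  rewrite normrM -mulrA ler_pM//; first by rewrite (le_trans (fM x))// ler_norm.
  by rewrite gtr0_norm ?weight_gt0// HC// ltW.
Qed.

Lemma continuous_kern f : bmeas f -> continuous (kern f).
Proof.
move=> bf y.
have cm : continuous mass.
  have -> : mass = (fun y => \int[leb]_x (1 * wt y x)).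
    by apply/funext => z; rewrite massE; apply: eq_Rintegral => x _; rewrite mul1r.
  by apply: continuous_integral_weight; exact: bmeas_cst.
have cV1 : {for y, continuous (fun y => (mass y)^-1)}.
  by apply: continuousV; [rewrite gt_eqF ?mass_gt0|exact: cm].
have cI : {for y, continuous (fun y => \int[leb]_x (f x * wt y x))}.
  exact: continuous_integral_weight.
have -> : kern f = (fun y => \int[leb]_x (f x * wt y x)) * (fun y => (mass y)^-1).
  by apply/funext => z; rewrite kernE.
exact: (continuousM cI cV1).
Qed.

Lemma bmeas_kern f : bmeas f -> bmeas (kern f).
Proof.
move=> bf; have [mf [M fM]] := bf; split.
  by apply: continuous_measurable_rV; exact: continuous_kern.
by exists M => y; apply: (el_norm_le (kern_expectation y)).
Qed.

End kernel.

(** * Transport inequalities for log-concave kernels *)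

Section exponential_bounds.
Context {R : realType}.
Implicit Types z : R.

(** Invert exp(- z) >= 1 - z, using (1 + z + 2 z^2) (1 - z) = 1 + z^2 (1 - 2 z) >= 1. *)
Lemma expR_le_quad z : `|z| <= 2^-1 -> expR z <= 1 + z + 2 * z ^+ 2.
Proof.
rewrite ler_norml => /andP[z1 z2].
have h1 := expR_ge1Dx (- z); rewrite expRN in h1.
have e0 := expR_gt0 z.
have h2 : expR z * (1 - z) <= 1.
  rewrite -[leRHS](mulfV (x := expR z)) ?gt_eqF//.
  by rewrite ler_pM2l.
have h3 : 0 <= z ^+ 2 * (1 - 2 * z) by rewrite mulr_ge0 ?sqr_ge0//; lra.
have h4 : 0 < 1 - z by lra.
rewrite -(ler_pM2r h4); apply: le_trans h2 _.
have -> : (1 + z + 2 * z ^+ 2) * (1 - z) = 1 + z ^+ 2 * (1 - 2 * z) by ring.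
by rewrite lerDl.
Qed.

(** With w = z / 2 >= 0, the excess over 2 is (exp w - exp(- w))^2, and exp w - exp(- w) >= w. *)
Lemma cosh_ge z : 2 + z ^+ 2 / 4 <= expR z + expR (- z).
Proof.
wlog z0 : z / 0 <= z.
  move=> H; have [/H//|/ltW z0] := leP 0 z.
  by have := H (- z); rewrite oppr_ge0 sqrrN opprK (addrC (expR (- z))); exact.
pose w := z / 2; have w0 : 0 <= w by rewrite divr_ge0.
have -> : z = w + w by rewrite /w; field.
rewrite opprD !expRD.
have h1 := expR_ge1Dx w; have e0 := expR_gt0 w.
rewrite expRN; set e := expR w in h1 e0 *.
have eV : e * e^-1 = 1 by rewrite mulfV ?gt_eqF.
have i0 : 0 < e^-1 by rewrite invr_gt0.
set i := e^-1 in eV i0 *.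
have h2 : w <= e - i by nra.
have -> : 2 + (w + w) ^+ 2 / 4 = 2 * (e * i) + w ^+ 2 by rewrite eV; field.
have : w ^+ 2 <= (e - i) ^+ 2 by rewrite ler_pXn2r ?nnegrE// (le_trans w0).
nra.
Qed.

End exponential_bounds.

Section transport.
Context {R : realType} {d : nat} (V : 'rV[R]_d -> R) (h : R).
Hypotheses (cV : continuous V) (cvxV : convex_function setT V) (h0 : 0 < h).
Notation leb := (@lebesgue_rV R d).
Implicit Types (x y : 'rV[R]_d) (A B F : 'rV[R]_d -> R).
Local Notation wt := (backward_weight V h).

Lemma gauss_density_expR A y k : continuous A -> bmeas A ->
  gauss_density (fun x => expR (A x + k) * wt y x).
Proof.
move=> cA [_ [M AM]]; apply: (@gauss_densityM _ _ _ _ (expR (M + k))).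
- exact: gauss_density_weight.
- move=> x; have c1 : {for x, continuous (fun x => A x + k)}.
    by apply: continuousD; [exact: cA|exact: cst_continuous].
  exact: (continuous_comp c1 (@continuous_expR R _)).
- move=> x; rewrite expR_gt0/= ler_expR lerD2r.
  exact: le_trans (ler_norm _) (AM x).
Qed.

(* The interpolation parameter [t] and the exponent [e = c t / h] tend to [0]
   together; the choice of their ratio makes the bound sharp. *)
Lemma kern_transport_exp (t c : R) A B y y' : 0 < t < 1 -> 0 < c ->
  continuous A -> bmeas A -> continuous B -> bmeas B ->
  (forall x x', A x <= B x' + sqnorm (x - x') / (2 * c)) ->
  kern V h (fun x => expR (c * t / h * A x)) y <=
  expR (t / (2 * h) * (sqnorm (y' - y) / (1 - t ^+ 2))) *
  kern V h (fun x => expR (c * t / h * B x)) y'.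
Proof.
move=> /andP[t0 t1] c0 cA bA cB bB AB.
set e := c * t / h; set k := t / (2 * h) * _.
have e0 : 0 < e by rewrite divr_gt0 ?mulr_gt0.
have t2 : 0 < 1 - t ^+ 2 by rewrite subr_gt0 expr_lt1 ?ltW.
have cE (D : 'rV[R]_d -> R) : continuous D -> continuous (fun x => e * D x).
  move=> cD x; have c1 : {for x, continuous (fun=> e)} by exact: cst_continuous.
  have c2 : {for x, continuous D} by exact: cD.
  exact: (continuousM c1 c2).
have G1 := gauss_density_expR y 0 (cE _ cA) (bmeasZ e bA).
have G2 := gauss_density_expR y' k (cE _ cB) (bmeasZ e bB).
have G3 := gauss_density_weight cV cvxV h0.
have t01 : 0 <= t <= 1 by rewrite !ltW.
(* The four functions are exp(e A) [wt y], [wt y'], [wt y] and exp(e B + k) [wt y'], so that the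
   masses at [y] and [y'] cancel from the conclusion. *)
have main x x' : expR (e * A x + 0) * wt y x * wt y' x' <=
    wt y ((1 - t) *: x + t *: x') *
    (expR (e * B (t *: x + (1 - t) *: x') + k) * wt y' (t *: x + (1 - t) *: x')).
  set m1 := (1 - t) *: x + _; set m2 := t *: x + _.
  rewrite /backward_weight -!expRD ler_expR addr0.
  have v1 : V m1 <= (1 - t) * V x + t * V x'.
    have := convex_functionE (t := 1 - t) x x' cvxV.
    by rewrite subKr; apply; lra.
  have v2 : V m2 <= t * V x + (1 - t) * V x' by exact: convex_functionE.
  have a1 : e * A x <= e * B m2 + t / (2 * h) * sqnorm (x - m2).
    apply: le_trans (ler_wpM2l (ltW e0) (AB x m2)) _.
    rewrite mulrDr lerD2l le_eqVlt; apply/orP; left; apply/eqP.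
    by rewrite /e; field; rewrite !gt_eqF.
  (* In each coordinate the gap is a perfect square times t / (1 - t^2); completing that square is
     what produces the factor 1 / (1 - t^2) in [k]. *)
  have q : t * sqnorm (x - m2) + sqnorm (m1 - y) + sqnorm (m2 - y') <=
      sqnorm (x - y) + sqnorm (x' - y') + t * (sqnorm (y' - y) / (1 - t ^+ 2)).
    rewrite /sqnorm mulr_suml !mulr_sumr -!big_split/=; apply: ler_sum => i _.
    rewrite !coordB !lincomb_rVE.
    set p := x ord0 i; set p' := x' ord0 i; set q := y ord0 i; set q' := y' ord0 i.
    rewrite -subr_ge0.
    have -> : (p - q) ^+ 2 + (p' - q') ^+ 2 + t * ((q' - q) ^+ 2 / (1 - t ^+ 2)) -
        (t * (p - (t * p + (1 - t) * p')) ^+ 2 + ((1 - t) * p + t * p' - q) ^+ 2 +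
         (t * p + (1 - t) * p' - q') ^+ 2) =
        t / (1 - t ^+ 2) * ((1 - t ^+ 2) * (p' - p) - (q' - q)) ^+ 2.
      by field; rewrite gt_eqF.
    by rewrite mulr_ge0 ?sqr_ge0// divr_ge0 ?ltW.
  have i0 : 0 < (2 * h)^-1 by rewrite invr_gt0 mulr_gt0.
  have := ler_wpM2l (ltW i0) q; rewrite /k; set i := (2 * h)^-1 in i0 a1 *.
  nra.
have m1 := mass_gt0 cV cvxV h0 y; have m2 := mass_gt0 cV cvxV h0 y'.
have := four_function_rV t01 G1 (G3 y') (G3 y) G2 main.
have -> : \int[leb]_x (expR (e * A x + 0) * wt y x) =
    kern V h (fun x => expR (e * A x)) y * mass V h y.
  by rewrite -(kern_mass cV cvxV h0); apply: eq_Rintegral => x _; rewrite addr0.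
have -> : \int[leb]_x (expR (e * B x + k) * wt y' x) =
    expR k * (kern V h (fun x => expR (e * B x)) y' * mass V h y').
  rewrite -(kern_mass cV cvxV h0) -RintegralZl//; last first.
    by apply: integrable_weight => //; apply: bmeas_expR; exact: bmeasZ.
  by apply: eq_Rintegral => x _; rewrite expRD mulrA (mulrC (expR k)).
rewrite -!massE.
move: (kern V h _ y) (kern V h _ y') (mass V h y) (mass V h y') m1 m2 => ka kb ma mb m1 m2 H.
have mm : 0 < ma * mb by rewrite mulr_gt0.
rewrite -(ler_pM2r mm) mulrA; apply: le_trans H _.
by rewrite le_eqVlt; apply/orP; left; apply/eqP; ring.
Qed.

(** Kantorovich-dual form of the fact that the kernel does not increase the quadratic transport
    cost. In [kern_transport_exp], Jensen's inequality bounds the left side below and a second order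
    expansion bounds the right side above. After division by the exponent c t / h the errors are of
    order t. *)
Lemma kern_transport (c : R) A B y y' : 0 < c ->
  continuous A -> bmeas A -> continuous B -> bmeas B ->
  (forall x x', A x <= B x' + sqnorm (x - x') / (2 * c)) ->
  kern V h A y <= kern V h B y' + sqnorm (y - y') / (2 * c).
Proof.
move=> c0 cA bA cB bB AB; have [mB [N BN]] := bB.
have N0 : 0 <= N by exact: le_trans (BN 0).
set D := sqnorm (y - y') / (2 * c).
have D0 : 0 <= D by rewrite divr_ge0 ?sqnorm_ge0// mulr_ge0 ?ltW.
have EX z := kern_expectation cV cvxV h0 z.
have step (t : R) : 0 < t <= 2^-1 -> c * t / h * N <= 2^-1 ->
    kern V h A y <= kern V h B y' + D + t * (2 * D + 2 * (c / h * N ^+ 2)).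
  move=> /andP[t0 t1] tN.
  have t01 : 0 < t < 1 by rewrite t0/= (le_lt_trans t1)// invf_lt1// ltr1n.
  have := kern_transport_exp y y' t01 c0 cA bA cB bB AB.
  set e := c * t / h in tN *; set k := t / (2 * h) * _.
  have e0 : 0 < e by rewrite divr_gt0 ?mulr_gt0.
  have l1 := el_expR_le (EX y) (bmeasZ e bA).
  have E0 := elZ (EX y) e bA; cbv beta in E0, l1; rewrite E0 in l1.
  have l2 : kern V h (fun x => expR (e * B x)) y' <=
      expR (e * kern V h B y' + 2 * (e * N) ^+ 2).
    apply: le_trans (expR_ge1Dx _).
    have b1 := bmeasZ e bB.
    have : kern V h (fun x => expR (e * B x)) y' <=
       kern V h (fun x => (1 + 2 * (e * N) ^+ 2) + e * B x) y'.
      apply: (el_le (EX y')); first exact: bmeas_expR.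
        by apply: bmeasD => //; exact: bmeas_cst.
      move=> x; have eB : `|e * B x| <= e * N by rewrite normrM gtr0_norm// ler_pM2l.
      apply: le_trans (expR_le_quad (le_trans eB tN)) _.
      have : (e * B x) ^+ 2 <= (e * N) ^+ 2.
        by rewrite -real_normK ?num_real// ler_pXn2r ?nnegrE// mulr_ge0// ltW.
      by lra.
    set c1 := 1 + 2 * _.
    have E1 : kern V h (fun x => c1 + e * B x) y' = c1 + e * kern V h B y'.
      have E2 := elD (EX y') (bmeas_cst c1) b1; have E3 := el_cst (EX y') c1.
      have E4 := elZ (EX y') e bB; cbv beta in E2, E3, E4.
      by rewrite E2 E3 E4.
    by rewrite E1 /c1; lra.
  move=> l3.
  have : expR (e * kern V h A y) <= expR (k + (e * kern V h B y' + 2 * (e * N) ^+ 2)).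
    apply: le_trans l1 _; apply: le_trans l3 _.
    by rewrite [leRHS]expRD ler_pM2l ?expR_gt0.
  rewrite ler_expR => l4.
  have t2 : 0 < 1 - t ^+ 2 by rewrite subr_gt0 expr_lt1 ?ltW//; case/andP: t01.
  have kD : k = e * (D / (1 - t ^+ 2)).
    by rewrite /k /e /D sqnormBC; field; rewrite !gt_eqF.
  have : D / (1 - t ^+ 2) <= D + t * (2 * D).
    rewrite ler_pdivrMr//.
    have -> : (D + t * (2 * D)) * (1 - t ^+ 2) = D + D * (t * (2 - t - 2 * t ^+ 2)) by ring.
    rewrite lerDl mulr_ge0// mulr_ge0 ?ltW//; nra.
  move=> l5.
  rewrite -(ler_pM2l e0); apply: le_trans l4 _; rewrite kD.
  have -> : 2 * (e * N) ^+ 2 = e * (t * (2 * (c / h * N ^+ 2))).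
    by rewrite /e; field; rewrite gt_eqF.
  by rewrite -!mulrDr ler_pM2l//; lra.
apply/ler_addgt0Pr => eps eps0.
pose Q := 2 * D + 2 * (c / h * N ^+ 2) + 1.
have ch0 : 0 < c / h by rewrite divr_gt0.
have q1 : 0 <= c / h * N ^+ 2 by rewrite mulr_ge0 ?sqr_ge0// ltW.
have Q1 : 1 <= Q by rewrite /Q; lra.
have Q0 : 0 < Q by exact: lt_le_trans Q1.
have z0 : 0 < (c / h * N + 1) * 2 by rewrite mulr_gt0// ltr_wpDl// mulr_ge0// ltW.
(* The three bounds serve, in order, to control 1 / (1 - t^2), to allow the quadratic bound on the
   exponential, and to make the error at most [eps]. *)
pose t := Num.min 2^-1 (Num.min ((c / h * N + 1) * 2)^-1 (eps / Q)).
have tpos : 0 < t by rewrite !lt_min invr_gt0 ltr0n invr_gt0 z0 divr_gt0.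
have t1 : t <= 2^-1 by rewrite ge_min lexx.
have t2 : t <= ((c / h * N + 1) * 2)^-1 by rewrite !ge_min lexx orbT.
have t3 : t <= eps / Q by rewrite !ge_min lexx !orbT.
have := step t; rewrite tpos t1 => /(_ isT).
have -> : c * t / h * N = t * (c / h * N) by ring.
have -> : t * (c / h * N) <= 2^-1.
  have := ler_wpM2r (ltW z0) t2; rewrite mulVf ?gt_eqF//; lra.
move=> /(_ isT) /le_trans; apply; rewrite lerD2l.
have : t * Q <= eps by rewrite -ler_pdivlMr.
rewrite /Q; nra.
Qed.

(** 1-Lipschitz for the Euclidean distance, squared so that only [sqnorm] appears. *)
Definition lip1 F := forall x x', (F x - F x') ^+ 2 <= sqnorm (x - x').

Lemma lip1_continuous F : lip1 F -> continuous F.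
Proof.
move=> lF x.
apply: (iffRL (@cvgrPdist_lt _ _ _ (nbhs x) (nbhs_filter x) _ _)) => e e0; rewrite near_simpl.
have c1 : {for x, continuous (fun y => x - y)}.
  by apply: continuousB; [exact: cst_continuous|exact: cvg_id].
have c2 := continuous_comp c1 (@continuous_sqnorm R d _).
have e2 : 0 < e ^+ 2 by rewrite exprn_gt0.
have c3 : sqnorm (x - y) @[y --> x] --> (0 : R).
  by rewrite -(@sqnorm0 R d) -[X in _ --> sqnorm X](subrr x); exact: c2.
move: c3 => /cvgr_lt/(_ _ e2); apply: filterS => y xy.
rewrite -(@ltr_pXn2r _ 2)// ?nnegrE ?ltW//.
by rewrite real_normK ?num_real// (le_lt_trans (lF x y)).
Qed.

(** A 1-Lipschitz function satisfies F x <= F x' + c / 2 + |x - x'|^2 / (2 c) for every c > 0.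
    [kern_transport] carries this family through the kernel, and taking c equal to the difference of
    the two values recovers the Lipschitz bound. *)
Lemma kern_lip1 F : bmeas F -> lip1 F -> lip1 (kern V h F).
Proof.
move=> bF lF; have cF := lip1_continuous lF.
have key (c : R) y y' : 0 < c ->
    kern V h F y <= kern V h F y' + c / 2 + sqnorm (y - y') / (2 * c).
  move=> c0.
  have cB : continuous (fun x => F x + c / 2).
    move=> x; have c1 : {for x, continuous F} by exact: cF.
    have c2 : {for x, continuous (fun _ : 'rV[R]_d => c / 2)} by exact: cst_continuous.
    exact: (continuousD c1 c2).
  have bc : bmeas (fun _ : 'rV[R]_d => c / 2) by exact: bmeas_cst.
  have := @kern_transport c F (fun x => F x + c / 2) y y' c0 cF bF cB (bmeasD bF bc).
  have EX := kern_expectation cV cvxV h0 y'.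
  have E1 := elD EX bF bc; have E2 := el_cst EX (c / 2); cbv beta in E1, E2.
  rewrite E1 E2; apply => x x'.
  rewrite -addrA -lerBlDl.
  have c2 : 0 < 2 * c by rewrite mulr_gt0.
  rewrite -(ler_pM2r c2) [leRHS]mulrDl divfK ?gt_eqF//.
  have := lF x x'; have := sqr_ge0 (F x - F x' - c); lra.
move=> y y'.
wlog yy : y y' / kern V h F y' <= kern V h F y.
  move=> H; have [|/ltW yy] := leP (kern V h F y') (kern V h F y); first exact: H.
  by rewrite -sqrrN opprB sqnormBC; exact: H.
have D0 : 0 <= sqnorm (y - y') by exact: sqnorm_ge0.
have {key} key (c : R) : 0 < c ->
    2 * c * (kern V h F y - kern V h F y') <= c ^+ 2 + sqnorm (y - y').
  move=> c0; have c2 : 0 < 2 * c by rewrite mulr_gt0.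
  have := key c y y' c0; rewrite -(ler_pM2l c2).
  have -> : 2 * c * (kern V h F y' + c / 2 + sqnorm (y - y') / (2 * c)) =
    2 * c * kern V h F y' + c ^+ 2 + sqnorm (y - y') by field; rewrite gt_eqF.
  by rewrite mulrBr; lra.
move: key yy; move: (kern V h F y) (kern V h F y') => a b key ab.
have [->|ab'] := eqVneq a b; first by rewrite subrr expr0n.
have ab0 : 0 < a - b by rewrite subr_gt0 lt_neqAle eq_sym ab' ab.
by have := key _ ab0; nra.
Qed.

(* The midpoint case of the four function inequality, applied to [exp(l F)] and
   [exp(- l F)], bounds the symmetrised Laplace transform. *)
Lemma kern_laplace_lip1 (l : R) F y : bmeas F -> lip1 F ->
  kern V h (fun x => expR (l * F x)) y * kern V h (fun x => expR (- l * F x)) y <=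
  expR (l ^+ 2 * h).
Proof.
move=> bF lF; have cF := lip1_continuous lF.
have cE (e : R) : continuous (fun x => e * F x).
  move=> x; have c1 : {for x, continuous (fun=> e)} by exact: cst_continuous.
  have c2 : {for x, continuous F} by exact: cF.
  exact: (continuousM c1 c2).
pose k := l ^+ 2 * h.
have G1 := gauss_density_expR y 0 (cE l) (bmeasZ l bF).
have G2 := gauss_density_expR y 0 (cE (- l)) (bmeasZ (- l) bF).
have c0 : continuous (fun _ : 'rV[R]_d => 0 : R) by move=> x; exact: cst_continuous.
have G3 := gauss_density_weight cV cvxV h0 y.
have G4 := gauss_density_expR y k c0 (bmeas_cst 0).
have t01 : 0 <= (2^-1 : R) <= 1 by rewrite invr_ge0 ler0n/= invf_le1// ler1n.
have h1 : 1 - 2^-1 = 2^-1 :> R by field.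
have main x x' : expR (l * F x + 0) * wt y x * (expR (- l * F x' + 0) * wt y x') <=
    wt y ((1 - 2^-1) *: x + 2^-1 *: x') *
    (expR (0 + k) * wt y (2^-1 *: x + (1 - 2^-1) *: x')).
  rewrite h1; set m := 2^-1 *: x + _.
  rewrite /backward_weight -!expRD ler_expR.
  have v : V m <= 2^-1 * V x + 2^-1 * V x'.
    by have := convex_functionE x x' cvxV t01; rewrite h1.
  (* Parallelogram identity: compared with the midpoint, the two weights leave a surplus |x - x'|^2
     / (4 h), which pays for [l * (F x - F x')] up to [k]. *)
  have q : sqnorm (x - y) + sqnorm (x' - y) =
      2 * sqnorm (m - y) + sqnorm (x - x') / 2.
    rewrite /sqnorm mulr_suml !mulr_sumr -!big_split/=; apply: eq_bigr => i _.
    by rewrite !coordB lincomb_rVE; field.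
  have h4 : 0 < 4 * h by rewrite mulr_gt0.
  have a1 : l * (F x - F x') <= k + sqnorm (x - x') / (4 * h).
    have := lF x x'; set D := F x - F x'; set s := sqnorm (x - x') => Ds.
    rewrite -(ler_pM2r h4) [leRHS]mulrDl divfK ?gt_eqF// /k.
    have := sqr_ge0 (D - 2 * h * l); nra.
  have i0 : (2 * h)^-1 * 2 = h^-1 by field; rewrite gt_eqF.
  have -> : sqnorm (x - y) / (2 * h) = (2 * sqnorm (m - y) + sqnorm (x - x') / 2 - sqnorm (x' - y)) / (2 * h).
    by rewrite -q addrK.
  have -> : (2 * sqnorm (m - y) + sqnorm (x - x') / 2 - sqnorm (x' - y)) / (2 * h) =
     2 * (sqnorm (m - y) / (2 * h)) + sqnorm (x - x') / (4 * h) - sqnorm (x' - y) / (2 * h).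
    by field; rewrite gt_eqF.
  lra.
have := four_function_rV t01 G1 G2 G3 G4 main.
have m1 := mass_gt0 cV cvxV h0 y.
have E e : \int[leb]_x (expR (e * F x + 0) * wt y x) =
    kern V h (fun x => expR (e * F x)) y * mass V h y.
  by rewrite -(kern_mass cV cvxV h0); apply: eq_Rintegral => x _; rewrite addr0.
rewrite (E l) (E (- l)) -(massE V h y).
have -> : \int[leb]_x (expR (0 + k) * wt y x) = expR k * mass V h y.
  rewrite (massE V h y) -RintegralZl//; last exact: gauss_density_integrable.
  by apply: eq_Rintegral => x _; rewrite add0r.
move: (kern V h _ y) (kern V h _ y) (mass V h y) m1 => ka kb ma m1 H.
have mm : 0 < ma * ma by rewrite mulr_gt0.
rewrite -(ler_pM2r mm); apply: le_trans (le_trans _ H) _.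
  by rewrite le_eqVlt; apply/orP; left; apply/eqP; ring.
by rewrite le_eqVlt; apply/orP; left; apply/eqP; rewrite /k; ring.
Qed.

(** For two independent copies, [kern_laplace_lip1] bounds the mean of exp(l (F x - F x')). Its
    symmetrisation dominates 2 + l^2 (F x - F x')^2 / 4, whose mean is 2 + l^2 Var / 2. With l^2 = 1
    / (2 h) the right side is 2 exp(1 / 2) <= 4, hence 8 h. The independent copies are two
    successive applications of the functional. *)
Lemma kern_variance_lip1 F y : bmeas F -> lip1 F ->
  variance_of (kern V h ^~ y) F <= 8 * h.
Proof.
move=> bF lF; have EX := kern_expectation cV cvxV h0 y.
set L := kern V h ^~ y in EX *.
pose l := Num.sqrt (2 * h)^-1.
have l2 : l ^+ 2 = (2 * h)^-1 by rewrite sqr_sqrtr// invr_ge0 mulr_ge0// ltW.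
have := kern_laplace_lip1 l y bF lF; rewrite l2 -/(L _) -/(L (fun x => expR (- l * F x))).
have -> : (2 * h)^-1 * h = 2^-1 :> R by field; rewrite gt_eqF.
have b1 := bmeas_expR (bmeasZ l bF); have b2 := bmeas_expR (bmeasZ (- l) bF).
set a := L (fun x => expR (l * F x)); set b := L (fun x => expR (- l * F x)) => ab.
have e2 : expR 2^-1 <= 2 :> R.
  have := @expR_le_quad R 2^-1; rewrite ger0_norm ?invr_ge0// lexx => /(_ isT); lra.
have step x' : 2 + l ^+ 2 / 4 * (variance_of L F + (F x' - L F) ^+ 2) <=
    expR (- l * F x') * a + expR (l * F x') * b.
  have bs : bmeas (fun x => (F x - F x') ^+ 2).
    by apply: bmeasX; apply: bmeasB => //; exact: bmeas_cst.
  have := el_le EX (bmeasD (bmeas_cst 2) (bmeasZ (l ^+ 2 / 4) bs))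
    (bmeasD (bmeasZ (expR (- l * F x')) b1) (bmeasZ (expR (l * F x')) b2)).
  rewrite (elD EX (bmeas_cst 2) (bmeasZ (l ^+ 2 / 4) bs)) (el_cst EX) (elZ EX _ bs).
  rewrite (variance_shift EX _ bF) (elD EX) ?(elZ EX)//; try exact: bmeasZ.
  rewrite -[(L F - _) ^+ 2]sqrrN opprB; apply => x.
  rewrite -!expRD; have := cosh_ge (l * (F x - F x')).
  have -> : - l * F x' + l * F x = l * (F x - F x') by ring.
  have -> : l * F x' + - l * F x = - (l * (F x - F x')) by ring.
  by rewrite exprMn; lra.
have bs : bmeas (fun x => (F x - L F) ^+ 2).
  by apply: bmeasX; apply: bmeasB => //; exact: bmeas_cst.
have bl : bmeas (fun x' => (2 + l ^+ 2 / 4 * variance_of L F) + l ^+ 2 / 4 * (F x' - L F) ^+ 2).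
  by apply: bmeasD; [exact: bmeas_cst|exact: bmeasZ].
have br : bmeas (fun x' => a * expR (- l * F x') + b * expR (l * F x')).
  by apply: bmeasD; exact: bmeasZ.
have := el_le EX bl br.
rewrite (elD EX (bmeas_cst _) (bmeasZ _ bs)) (el_cst EX) (elZ EX _ bs).
rewrite (variance_shift EX _ bF) subrr expr0n addr0.
rewrite (elD EX (bmeasZ a b2) (bmeasZ b b1)) (elZ EX _ b1) (elZ EX _ b2) -/a -/b.
move=> H; have {}H : (2 + l ^+ 2 / 4 * variance_of L F) + l ^+ 2 / 4 * variance_of L F <=
    a * b + b * a.
  apply: H => x'; have := step x'; lra.
move: H; rewrite l2; have -> : (2 * h)^-1 / 4 = (8 * h)^-1 by field; rewrite gt_eqF.
have h8 : 0 < 8 * h by rewrite mulr_gt0.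
move=> H; have : (8 * h)^-1 * variance_of L F <= 1 by lra.
by rewrite mulrC ler_pdivrMr// mul1r.
Qed.

End transport.

(** * Gaussian smoothing *)

Section dot_product.
Context {R : realType} {d : nat}.
Implicit Types u v x y : 'rV[R]_d.

Definition dot u v : R := \sum_i u ord0 i * v ord0 i.

Lemma sqnorm_sub_scale u v (t : R) :
  sqnorm (u - t *: v) = sqnorm u + (- (2 * dot u v)) * t + sqnorm v * t ^+ 2.
Proof.
rewrite /sqnorm /dot mulr_sumr -sumrN !mulr_suml -!big_split/=.
by apply: eq_bigr => i _; rewrite !mxE; ring.
Qed.

Lemma dot_sub_scale u v (t : R) : dot (u - t *: v) v = dot u v - t * sqnorm v.
Proof.
rewrite /sqnorm /dot mulr_sumr -sumrN -!big_split/=.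
by apply: eq_bigr => i _; rewrite !mxE; ring.
Qed.

Lemma dot_le u v : `|dot u v| <= sqnorm u + sqnorm v.
Proof.
rewrite /dot /sqnorm -big_split/=; apply: le_trans (ler_norm_sum _ _ _) _.
apply: ler_sum => i _; rewrite normrM.
rewrite -[X in _ <= X + _]real_normK ?num_real//.
rewrite -[X in _ <= _ + X]real_normK ?num_real//.
have := sqr_ge0 (`|u ord0 i| - `|v ord0 i|).
have := normr_ge0 (u ord0 i); have := normr_ge0 (v ord0 i); nra.
Qed.

Lemma dot_delta u i : dot u (delta_mx ord0 i) = u ord0 i.
Proof.
rewrite /dot (bigD1 i)//= big1 ?addr0; last first.
  by move=> j ji; rewrite mxE eqxx/= (negbTE ji) mulr0.
by rewrite mxE !eqxx mulr1.
Qed.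

Lemma dotBl u v w : dot (u - v) w = dot u w - dot v w.
Proof.
by rewrite /dot -sumrN -big_split/=; apply: eq_bigr => i _; rewrite !mxE; ring.
Qed.

Lemma dot_sqnorm v : dot v v = sqnorm v.
Proof. by apply: eq_bigr => i _; rewrite expr2. Qed.

Lemma is_derive_line (f : 'rV[R]_d -> R) x v (df : R) :
  is_derive (0 : R) 1 (fun t => f (t *: v + x)) df -> is_derive x v f df.
Proof.
have e : (fun t : R => t^-1 *: (((fun t => f (t *: v + x)) \o shift (0 : R)) (t *: (1 : R)) -
     f (0 *: v + x))) =
   (fun t : R => t^-1 *: ((f \o shift x) (t *: v) - f x)).
  by apply/funext => t; rewrite /= addr0 scale0r add0r -[t *: (1 : R)]/(t * 1) mulr1.
case => df1 df2; split.
  by move: df1; rewrite /derivable e.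
by move: df2; rewrite /derive e.
Qed.

Lemma is_derive_quad (a b c t : R) :
  is_derive t 1 (fun t => a + b * t + c * t ^+ 2) (b + 2 * c * t).
Proof.
have h1 := is_derive_lincomb 1 b (is_derive_cst a t 1) (is_derive_id t 1).
have h2 := is_deriveX 2 (is_derive_id t (1 : R)).
have h3 := is_derive_lincomb 1 c h1 h2.
have -> : (fun t => a + b * t + c * t ^+ 2) = (fun s : R => 1 * (1 * cst a s + b * id s) + c * (id ^+ 2) s).
  by apply/funext => s; rewrite !mul1r.
have -> : b + 2 * c * t = 1 * (1 * 0 + b * 1) + c * ((2%:R * id t ^+ 1) *: 1).
  by rewrite /GRing.scale/=; ring.
exact: h3.
Qed.

End dot_product.

(** * Gaussian convolutions and their derivatives *)

Section gauss_smoothing.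
Context {R : realType} {d : nat} (h : R) (h0 : 0 < h).
Notation leb := (@lebesgue_rV R d).
Implicit Types (x y v : 'rV[R]_d) (G : 'rV[R]_d -> R).
Local Notation V0 := (fun _ : 'rV[R]_d => 0 : R).
Local Notation wt := (backward_weight V0 h).

Lemma gweightE x y : wt x y = expR (- (2 * h)^-1 * sqnorm (y - x)).
Proof. by rewrite /backward_weight oppr0 sub0r mulrC mulNr. Qed.

Lemma gmass x : mass V0 h x = Num.sqrt (2 * pi * h) ^+ d.
Proof.
rewrite massE /Rintegral; under eq_integral => y _ do rewrite gweightE.
rewrite integral_gauss_shift ?invr_gt0 ?mulr_gt0//=.
by congr (Num.sqrt _ ^+ _); rewrite invrK; ring.
Qed.

(* Closed under multiplication by coordinates, so that derivatives of Gaussian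
   convolutions stay in the same class. *)
Definition subgauss G := measurable_fun setT G /\ forall b : R, 0 < b ->
  exists C : R, 0 <= C /\ forall y, `|G y| <= C * expR (b * sqnorm y).

Lemma bmeas_subgauss G : bmeas G -> subgauss G.
Proof.
move=> [mG [M GM]]; split => // b b0; exists `|M|; split => // y.
rewrite (le_trans (GM y))// (le_trans (ler_norm M))// ler_peMr//.
by rewrite -expR0 ler_expR mulr_ge0 ?sqnorm_ge0// ltW.
Qed.

Lemma subgaussM G H : subgauss G -> subgauss H -> subgauss (fun y => G y * H y).
Proof.
move=> [mG gG] [mH gH]; split; first exact: measurable_funM.
move=> b b0; have b2 : 0 < b / 2 by rewrite divr_gt0.
have [C [C0 HC]] := gG _ b2; have [D [D0 HD]] := gH _ b2.
exists (C * D); split; first exact: mulr_ge0.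
move=> y; rewrite normrM; have -> : expR (b * sqnorm y) = expR (b / 2 * sqnorm y) * expR (b / 2 * sqnorm y).
  by rewrite -expRD; congr expR; field.
by rewrite mulrACA ler_pM.
Qed.

Lemma sqr_subgauss_le (z b : R) : 0 < b -> 0 <= z -> z <= b^-1 * expR (b * z).
Proof.
move=> b0 z0; rewrite ler_pdivlMl//; apply: le_trans (expR_ge1Dx _).
by rewrite lerDr.
Qed.

Lemma subgauss_dot v : subgauss (fun y => dot y v).
Proof.
split.
  rewrite /dot; apply: measurable_sum => i; apply: measurable_funM => //.
  exact: measurable_coord_rV.
move=> b b0; exists (b^-1 + sqnorm v); split.
  by rewrite addr_ge0 ?sqnorm_ge0// invr_ge0 ltW.
move=> y; apply: le_trans (dot_le _ _) _; rewrite mulrDl lerD//.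
  by apply: sqr_subgauss_le => //; exact: sqnorm_ge0.
rewrite ler_peMr ?sqnorm_ge0// -expR0 ler_expR mulr_ge0 ?sqnorm_ge0//; exact: ltW.
Qed.

Lemma subgauss_coord i : subgauss (fun y => y ord0 i).
Proof.
have := subgauss_dot (delta_mx ord0 i); congr subgauss.
by apply/funext => y; rewrite dot_delta.
Qed.

(** The second bound dominates the derivative of the integrand, whose linear factor is at most |y -
    x|^2 + |v|^2. With k = 1 / (32 h) the weight has exponent 16 k: one k pays for the growth of
    [G], one for the quadratic factor, and 4 k = 1 / (8 h) survives the recentring from [x] to 0. *)
Lemma subgauss_dominated G (rho : R) : subgauss G -> exists C : R, 0 <= C /\
  forall x, sqnorm x <= rho -> forall y,
    `|G y * wt x y| <= C * expR (- (8 * h)^-1 * sqnorm y) /\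
    `|G y * dot (y - x) (y - x) * wt x y| <= C * expR (- (8 * h)^-1 * sqnorm y).
Proof.
move=> [_ gG].
have [k [k0 hk h8]] : exists k : R, [/\ 0 < k, (2 * h)^-1 = 16 * k & (8 * h)^-1 = 4 * k].
  exists ((8 * h)^-1 / 4); split; first by rewrite divr_gt0// invr_gt0 mulr_gt0.
    by field; rewrite gt_eqF.
  by field; rewrite gt_eqF.
have [C [C0 HC]] := gG _ k0.
pose A := expR (10 * k * rho).
exists (C * A * (1 + k^-1)); split.
  by rewrite !mulr_ge0 ?expR_ge0// addr_ge0// invr_ge0 ltW.
have k1 : 1 <= 1 + k^-1 by rewrite lerDl invr_ge0 ltW.
have k2 : k^-1 <= 1 + k^-1 by rewrite lerDr.
move=> x xr y.
have s1 := sqnorm_le2 y x.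
have key : `|G y| * expR (k * sqnorm (y - x)) * wt x y <=
    C * A * expR (- (8 * h)^-1 * sqnorm y).
  rewrite gweightE -mulrA -expRD hk h8.
  apply: (@le_trans _ _ (C * expR (k * sqnorm y) * expR (k * sqnorm (y - x) + - (16 * k) * sqnorm (y - x)))).
    by rewrite ler_wpM2r ?expR_ge0.
  rewrite -!mulrA ler_wpM2l// -!expRD ler_expR.
  have := ler_wpM2l (ltW k0) s1; have := ler_wpM2l (ltW k0) xr.
  have : 0 <= k * sqnorm (y - x) by rewrite mulr_ge0 ?sqnorm_ge0// ltW.
  lra.
have w0 : 0 <= wt x y by exact: expR_ge0.
split.
  rewrite normrM (ger0_norm w0).
  apply: (@le_trans _ _ (`|G y| * expR (k * sqnorm (y - x)) * wt x y)).
    rewrite ler_wpM2r// ler_peMr// -expR0 ler_expR mulr_ge0 ?sqnorm_ge0//; exact: ltW.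
  apply: le_trans key _; rewrite ler_wpM2r ?expR_ge0// ler_peMr// mulr_ge0 ?expR_ge0//.
rewrite !normrM (ger0_norm w0) dot_sqnorm (ger0_norm (sqnorm_ge0 _)).
apply: (@le_trans _ _ (k^-1 * (`|G y| * expR (k * sqnorm (y - x)) * wt x y))).
  rewrite mulrA ler_wpM2r// mulrCA ler_wpM2l//.
  by apply: sqr_subgauss_le => //; exact: sqnorm_ge0.
apply: le_trans (ler_wpM2l _ key) _; first by rewrite invr_ge0 ltW.
rewrite mulrA ler_wpM2r ?expR_ge0// mulrC ler_wpM2l// mulr_ge0 ?expR_ge0//.
Qed.

Lemma measurable_gweight x : measurable_fun setT (wt x).
Proof.
have -> : wt x = (fun y => expR (- (2 * h)^-1 * sqnorm (y - x))).
  by apply/funext => y; exact: gweightE.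
exact: measurable_gauss_shift.
Qed.

Lemma subgauss_integrable G x : subgauss G ->
  leb.-integrable setT (EFin \o (fun y => G y * wt x y)).
Proof.
move=> gG; apply: gauss_dominated_integrable.
  by apply: measurable_funM; [exact: gG.1|exact: measurable_gweight].
have [C [C0 HC]] := subgauss_dominated (sqnorm x) gG.
exists C, (8 * h)^-1; split => //; first by rewrite invr_gt0 mulr_gt0.
by move=> y; have [] := HC x (lexx _) y.
Qed.

Definition gconv G x := \int[leb]_y (G y * wt x y).

Lemma continuous_gconv G : subgauss G -> continuous (gconv G).
Proof.
move=> gG x.
have [C [C0 HC]] := subgauss_dominated (sqnorm x + 1) gG.
have h8 : 0 < (8 * h)^-1 by rewrite invr_gt0 mulr_gt0.
have cV0 : continuous V0 by move=> z; exact: cst_continuous.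
apply: (@continuous_Rintegral _ _ _ leb _ (fun x y => G y * wt x y) x _ _ _
  (integrable_gaussM d C h8)).
- by move=> z; apply: measurable_funM; [exact: gG.1|exact: measurable_gweight].
- move=> y; have c1 : {for x, continuous (fun _ : 'rV[R]_d => G y)} by exact: cst_continuous.
  have c2 : {for x, continuous (fun z => wt z y)} by exact: continuous_weightl.
  exact: (continuousM c1 c2).
- have c0 : sqnorm z @[z --> x] --> sqnorm x by exact: continuous_sqnorm.
  move: c0 => /cvgr_lt/(_ (sqnorm x + 1)).
  rewrite ltrDl ltr01 => /(_ isT); apply: filterS => z zy y.
  by have [] := HC z (ltW zy) y.
Qed.

Lemma is_derive_gweight x v y (t : R) : is_derive t 1 (fun t => wt (t *: v + x) y)
  (dot (y - (t *: v + x)) v / h * wt (t *: v + x) y).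
Proof.
pose a := - (2 * h)^-1.
have E s : wt (s *: v + x) y = expR (a * sqnorm (y - x) +
    (a * (- (2 * dot (y - x) v))) * s + a * sqnorm v * s ^+ 2).
  rewrite gweightE; congr expR; rewrite -/a.
  have -> : y - (s *: v + x) = (y - x) - s *: v by rewrite opprD addrA addrAC.
  by rewrite sqnorm_sub_scale; ring.
have -> : (fun t => wt (t *: v + x) y) = expR \o (fun s => a * sqnorm (y - x) +
    (a * (- (2 * dot (y - x) v))) * s + a * sqnorm v * s ^+ 2).
  by apply/funext => s; exact: E.
have := is_derive1_comp (is_derive_expR _)
  (is_derive_quad (a * sqnorm (y - x)) (a * (- (2 * dot (y - x) v))) (a * sqnorm v) t).
rewrite -E; congr is_derive; rewrite [RHS]mulrC; congr (_ * _).
have -> : y - (t *: v + x) = (y - x) - t *: v by rewrite opprD addrA addrAC.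
rewrite dot_sub_scale /a; field; by rewrite gt_eqF.
Qed.

Lemma is_derive_gconv G x v : subgauss G ->
  is_derive x v (gconv G) (\int[leb]_y (G y * (dot (y - x) v / h) * wt x y)).
Proof.
move=> gG; apply: is_derive_line.
pose f (t : R) y := G y * wt (t *: v + x) y.
have df (t : R) y : is_derive t 1 (f ^~ y) (G y * (dot (y - (t *: v + x)) v / h * wt (t *: v + x) y)).
  have := is_derive_lincomb 0 (G y) (is_derive_id t (1 : R)) (is_derive_gweight x v y t).
  rewrite mul0r add0r; congr is_derive.
  by apply/funext => s; rewrite mul0r add0r.
(* For |t| < 1 the points t v + x stay in this ball, so one dominating function serves them all. *)
pose rho := 2 * (sqnorm v + sqnorm x).
have rhoP (t : R) : -1 < t < 1 -> sqnorm (t *: v + x) <= rho.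
  move=> /andP[t1 t2].
  have := sqnorm_le2 (t *: v + x) x; rewrite addrK sqnormZ /rho.
  have : t ^+ 2 * sqnorm v <= sqnorm v.
    rewrite -[leRHS]mul1r ler_wpM2r ?sqnorm_ge0//; nra.
  lra.
have [C [C0 HC]] := subgauss_dominated rho gG.
have h8 : 0 < (8 * h)^-1 by rewrite invr_gt0 mulr_gt0.
pose K := h^-1 * (1 + sqnorm v) * C.
have K0 : 0 <= h^-1 by rewrite invr_ge0 ltW.
have v0 := sqnorm_ge0 v.
have intf (t : R) : leb.-integrable setT (EFin \o f t) by exact: subgauss_integrable.
pose B y := K * expR (- (8 * h)^-1 * sqnorm y).
have dfE (t : R) y : partial1of2 f t y = G y * (dot (y - (t *: v + x)) v / h * wt (t *: v + x) y).
  by rewrite /partial1of2 derive1E; have [_ ->] := df t y.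
have main : is_derive (0 : R) 1 (fun t => \int[leb]_y f t y) (\int[leb]_y (partial1of2 f 0 y)).
  have B0 y : 0 <= B y by rewrite mulr_ge0 ?expR_ge0// !mulr_ge0// addr_ge0.
  have iB : leb.-integrable setT (EFin \o B) by exact: integrable_gaussM.
  have B1 (t : R) y : `]-1, 1[%classic t -> setT y -> `|partial1of2 f t y| <= B y.
    rewrite /= in_itv/= => /rhoP tr _; rewrite dfE.
    have [b1 b2] := HC _ tr y; set z := t *: v + x in tr b1 b2 *.
    have w0 : 0 <= wt z y by exact: expR_ge0.
    rewrite !normrM (ger0_norm w0) (ger0_norm K0) -/z.
    rewrite !normrM (ger0_norm w0) in b1; rewrite !normrM (ger0_norm w0) in b2.
    rewrite dot_sqnorm (ger0_norm (sqnorm_ge0 _)) in b2.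
    have b3 := dot_le (y - z) v.
    have gw : 0 <= `|G y| * wt z y by rewrite mulr_ge0.
    have := ler_wpM2r gw b3; rewrite /B /K; set E := expR _ in b1 b2 *.
    move=> b4.
    have -> : `|G y| * (`|dot (y - z) v| * h^-1 * wt z y) =
      h^-1 * (`|dot (y - z) v| * (`|G y| * wt z y)) by ring.
    have -> : h^-1 * (1 + sqnorm v) * C * E = h^-1 * ((1 + sqnorm v) * (C * E)) by ring.
    apply: ler_wpM2l => //.
    have b5 := ler_wpM2l v0 b1.
    lra.
  have I0 : `]-1, 1[%classic (0 : R) by rewrite /= in_itv/= ltr01 ltrN10.
  have D t y : `]-1, 1[%classic t -> setT y -> derivable (f ^~ y) t 1.
    by move=> _ _; have [] := df t y.
  split.
    exact: (@derivable_under_integral _ _ _ leb f setT measurableT 0 (-1) 1 I0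
      (fun t _ => intf t) D B B0 iB B1).
  rewrite -derive1E.
  exact: (@differentiation_under_integral _ _ _ leb f setT measurableT 0 (-1) 1 I0
      (fun t _ => intf t) D B B0 iB B1).
move: main; congr is_derive.
by apply: eq_Rintegral => y _; rewrite dfE scale0r add0r mulrA.
Qed.

End gauss_smoothing.

Section smooth_closure.
Context {R : realType} {d : nat}.
Implicit Types f g : 'rV[R]_d -> R.

Lemma class_C_continuous k f : class_C k f -> continuous f.
Proof. by case: k => [|k] []. Qed.

Lemma class_C_pred k f : class_C k.+1 f -> class_C k f.
Proof.
elim: k f => [|k IH] f [cf H]; split => // i.
by have [df /IH] := H i.
Qed.

Lemma class_C_cst k (c : R) : class_C k (fun _ : 'rV[R]_d => c).
Proof.
elim: k c => [|k IH] c; (split; first by move=> x; exact: cst_continuous) => //.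
move=> i; split; first by move=> x; exact: derivable_cst.
have -> : partial i (fun _ : 'rV[R]_d => c) = (fun=> 0).
  by apply/funext => x; exact: derive_cst.
exact: IH.
Qed.

Lemma class_CD k f g : class_C k f -> class_C k g -> class_C k (fun x => f x + g x).
Proof.
have cD f' g' : continuous f' -> continuous g' -> continuous (fun x : 'rV[R]_d => f' x + g' x).
  move=> cf cg x; have c1 : {for x, continuous f'} by exact: cf.
  have c2 : {for x, continuous g'} by exact: cg.
  exact: (continuousD c1 c2).
elim: k f g => [|k IH] f g [cf Hf] [cg Hg]; (split; first exact: cD) => //.
move=> i; have [df Cf] := Hf i; have [dg Cg] := Hg i.
have e : (fun x => f x + g x) = f + g by [].
rewrite e; split; first by move=> x; apply: derivableD.
have -> : partial i (f + g) = (fun x => partial i f x + partial i g x).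
  by apply/funext => x; exact: deriveD.
exact: IH.
Qed.

Lemma class_CM k f g : class_C k f -> class_C k g -> class_C k (fun x => f x * g x).
Proof.
have cM f' g' : continuous f' -> continuous g' -> continuous (fun x : 'rV[R]_d => f' x * g' x).
  move=> cf cg x; have c1 : {for x, continuous f'} by exact: cf.
  have c2 : {for x, continuous g'} by exact: cg.
  exact: (continuousM c1 c2).
elim: k f g => [|k IH] f g Cf Cg.
  by split => //; apply: cM; [exact: class_C_continuous Cf|exact: class_C_continuous Cg].
have Cf' := class_C_pred Cf; have Cg' := class_C_pred Cg.
case: Cf => cf Hf; case: Cg => cg Hg; split; first exact: cM.
move=> i; have [df Cf] := Hf i; have [dg Cg] := Hg i.
have e : (fun x => f x * g x) = f * g by [].
rewrite e; split; first by move=> x; apply: derivableM.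
have -> : partial i (f * g) = (fun x => f x * partial i g x + g x * partial i f x).
  by apply/funext => x; exact: deriveM.
by apply: class_CD; apply: IH.
Qed.

Lemma is_derive_dot (c : R) (x v w : 'rV[R]_d) :
  is_derive x v (fun y => c * dot y w) (c * dot v w).
Proof.
apply: is_derive_line.
have := is_derive_quad (c * dot x w) (c * dot v w) 0 0.
rewrite mulr0 addr0; congr is_derive.
apply/funext => t; rewrite mul0r addr0 /dot !mulr_sumr mulr_suml -big_split/=.
by apply: eq_bigr => i _; rewrite !mxE; ring.
Qed.

Lemma class_C_coord k (i : 'I_d) : class_C k (fun x : 'rV[R]_d => x ord0 i).
Proof.
have c : continuous (fun x : 'rV[R]_d => x ord0 i) by move=> x; exact: coord_continuous.
case: k => [|k]; split => // j.
have e : (fun x : 'rV[R]_d => x ord0 i) = (fun x => 1 * dot x (delta_mx ord0 i)).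
  by apply/funext => x; rewrite mul1r dot_delta.
have D x : is_derive x (delta_mx ord0 j) (fun x : 'rV[R]_d => x ord0 i)
    (1 * dot (delta_mx ord0 j) (delta_mx ord0 i)) by rewrite e; exact: is_derive_dot.
split; first by move=> x; have [] := D x.
have -> : partial j (fun x : 'rV[R]_d => x ord0 i) =
    fun=> 1 * dot (delta_mx ord0 j) (delta_mx ord0 i).
  by apply/funext => x; have [_] := D x.
exact: class_C_cst.
Qed.

Lemma dot_sum_delta (u v : 'rV[R]_d) : dot u v = \sum_i v ord0 i * dot u (delta_mx ord0 i).
Proof. by apply: eq_bigr => i _; rewrite dot_delta mulrC. Qed.

End smooth_closure.

Lemma Rintegral_sumZ (R : realType) dT (T : measurableType dT)
    (mu : {measure set T -> \bar R}) (I : Type) (s : seq I) (c : I -> R) (F : I -> T -> R) :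
  (forall i, mu.-integrable setT (EFin \o F i)) ->
  \int[mu]_x (\sum_(i <- s) c i * F i x) = \sum_(i <- s) c i * \int[mu]_x F i x.
Proof.
move=> iF.
have iZ i : mu.-integrable setT (EFin \o (fun x => c i * F i x)).
  by have := integrableZl measurableT (c i) (iF i); apply: eq_integrable.
suff [_] : mu.-integrable setT (EFin \o (fun x => \sum_(i <- s) c i * F i x)) /\
  \int[mu]_x (\sum_(i <- s) c i * F i x) = \sum_(i <- s) c i * \int[mu]_x F i x by [].
elim: s => [|i s [IH1 IH2]].
  have -> : (fun x => \sum_(i <- [::]) c i * F i x) = (fun=> 0).
    by apply/funext => x; rewrite big_nil.
  split; first exact: integrable0.
  by rewrite big_nil Rintegral_cst//= mul0r.
have -> : (fun x => \sum_(j <- i :: s) c j * F j x) = (fun x => c i * F i x + \sum_(j <- s) c j * F j x).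
  by apply/funext => x; rewrite big_cons.
split.
  by have := integrableD measurableT (iZ i) IH1; apply: eq_integrable.
by rewrite RintegralD// RintegralZl// IH2 big_cons.
Qed.

(** * The Gaussian kernel: moments, gradient bounds, log-Harnack inequality *)

Section gaussian_kernel.
Context {R : realType} {d : nat} (h : R) (h0 : 0 < h).
Notation leb := (@lebesgue_rV R d).
Implicit Types (x y v : 'rV[R]_d) (f G : 'rV[R]_d -> R).
Local Notation V0 := (fun _ : 'rV[R]_d => 0 : R).
Local Notation wt := (backward_weight V0 h).
Local Notation N := (Num.sqrt (2 * pi * h) ^+ d).

Lemma subgaussD G H : @subgauss R d G -> subgauss H -> subgauss (fun y => G y + H y).
Proof.
move=> [mG gG] [mH gH]; split; first exact: measurable_funD.
move=> b b0; have [C [C0 HC]] := gG _ b0; have [D [D0 HD]] := gH _ b0.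
exists (C + D); split; first exact: addr_ge0.
by move=> y; rewrite (le_trans (ler_normD _ _))// mulrDl lerD.
Qed.

Lemma subgauss_cst (c : R) : subgauss (fun _ : 'rV[R]_d => c).
Proof. by apply: bmeas_subgauss; exact: bmeas_cst. Qed.

Lemma subgauss_dotB x v (c : R) : subgauss (fun y : 'rV[R]_d => dot (y - x) v * c).
Proof.
apply: subgaussM; last exact: subgauss_cst.
have := subgaussD (subgauss_dot v) (subgauss_cst (- dot x v)).
by congr subgauss; apply/funext => y; rewrite dotBl.
Qed.

Lemma dot_grad_gconv G x v : subgauss G ->
  'D_v (gconv h G) x = dot (grad (gconv h G) x) v.
Proof.
move=> gG; have [_ ->] := is_derive_gconv h0 x v gG.
have i1 i : leb.-integrable setT
    (EFin \o (fun y => G y * (dot (y - x) (delta_mx ord0 i) / h) * wt x y)).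
  by apply: subgauss_integrable => //; apply: subgaussM => //; exact: subgauss_dotB.
transitivity (\int[leb]_y (\sum_i v ord0 i *
    (G y * (dot (y - x) (delta_mx ord0 i) / h) * wt x y))).
  apply: eq_Rintegral => y _; rewrite dot_sum_delta mulr_suml mulr_sumr mulr_suml.
  by apply: eq_bigr => i _; ring.
rewrite Rintegral_sumZ//; apply: eq_bigr => i _; rewrite mulrC; congr (_ * _).
by rewrite mxE /partial; have [_ ->] := is_derive_gconv h0 x (delta_mx ord0 i) gG.
Qed.

Lemma class_C_gconv k G : subgauss G -> class_C k (gconv h G).
Proof.
elim: k G => [|k IH] G gG; split => //; try exact: continuous_gconv.
move=> i; split; first by move=> x; have [] := is_derive_gconv h0 x (delta_mx ord0 i) gG.
have gi : subgauss (fun y => G y * y ord0 i) by apply: subgaussM => //; exact: subgauss_coord.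
have -> : partial i (gconv h G) = (fun x => h^-1 * gconv h (fun y => G y * y ord0 i) x +
    (- h^-1 * x ord0 i) * gconv h G x).
  apply/funext => x; rewrite /partial.
  have [_ ->] := is_derive_gconv h0 x (delta_mx ord0 i) gG.
  rewrite /gconv -!RintegralZl//; try exact: subgauss_integrable.
  have iZ c H : subgauss H -> leb.-integrable setT (EFin \o (fun y => c * (H y * wt x y))).
    move=> gH; have := integrableZl measurableT c (subgauss_integrable h0 x gH).
    by apply: eq_integrable.
  rewrite -RintegralD//; try exact: iZ.
  by apply: eq_Rintegral => y _; rewrite dot_delta coordB; ring.
apply: class_CD; apply: class_CM; try exact: IH; first exact: class_C_cst.
by apply: class_CM; [exact: class_C_cst|exact: class_C_coord].
Qed.

Lemma kern0E f x : kern V0 h f x = N^-1 * gconv h f x.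
Proof. by rewrite kernE gmass// mulrC. Qed.

Lemma gauss_const_gt0 : 0 < N.
Proof. by rewrite exprn_gt0// sqrtr_gt0 !mulr_gt0// pi_gt0. Qed.

Lemma smooth_kern0 f : bmeas f -> smooth (kern V0 h f).
Proof.
move=> bf k; have -> : kern V0 h f = (fun x => N^-1 * gconv h f x).
  by apply/funext => x; exact: kern0E.
by apply: class_CM; [exact: class_C_cst|apply: class_C_gconv; exact: bmeas_subgauss].
Qed.

Lemma is_derive_kern0 f x v : bmeas f ->
  is_derive x v (kern V0 h f) (dot (grad (kern V0 h f) x) v).
Proof.
move=> bf; have gf := bmeas_subgauss bf.
have e : kern V0 h f = N^-1 *: gconv h f.
  by apply/funext => z; exact: kern0E.
have D w : is_derive x w (kern V0 h f) (N^-1 *: 'D_w (gconv h f) x).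
  rewrite e; apply: is_deriveZ; have [d1 d2] := is_derive_gconv h0 x w gf.
  by split.
have := D v; congr is_derive; rewrite dot_grad_gconv//.
rewrite /dot /GRing.scale/= mulr_sumr; apply: eq_bigr => i _.
rewrite !mxE mulrA; congr (_ * _).
by have [_] := D (delta_mx ord0 i); rewrite /partial => ->.
Qed.

Lemma gauss_int1 x : \int[leb]_y wt x y = N.
Proof. by rewrite -massE gmass. Qed.

Lemma gconv1 x : gconv h (fun=> 1) x = N.
Proof. by rewrite /gconv -(gauss_int1 x); apply: eq_Rintegral => y _; rewrite mul1r. Qed.

(** Differentiate the convolution of the constant 1, which is constant. *)
Lemma gauss_first_moment x v : \int[leb]_y (dot (y - x) v * wt x y) = 0.
Proof.
have [_ D] := is_derive_gconv h0 x v (subgauss_cst 1).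
have e : gconv h (fun _ : 'rV[R]_d => 1 : R) = cst (N : R) by apply/funext => z; exact: gconv1.
rewrite e derive_cst in D.
have : h * \int[leb]_y (1 * (dot (y - x) v / h) * wt x y) = 0 by rewrite -D mulr0.
rewrite -RintegralZl//; last first.
  apply: subgauss_integrable => //; apply: subgaussM; first exact: subgauss_cst.
  exact: subgauss_dotB.
move=> E; rewrite -[RHS]E; apply: eq_Rintegral => y _; by field; rewrite gt_eqF.
Qed.

(** Differentiate along [v] the convolution of the linear form <., v>, which is [N] times that
    form. *)
Lemma gauss_second_moment x v :
  \int[leb]_y (dot (y - x) v ^+ 2 * wt x y) = h * N * sqnorm v.
Proof.
have gd := @subgauss_dot R d v.
have i1 : leb.-integrable setT (EFin \o (fun y => dot (y - x) v * 1 * wt x y)).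
  by apply: subgauss_integrable => //; exact: subgauss_dotB.
have e : gconv h (fun y => dot y v) = (fun x => N * dot x v).
  apply/funext => z.
  transitivity (\int[leb]_y (dot (y - z) v * 1 * wt z y + dot z v * wt z y)).
    by apply: eq_Rintegral => y _; rewrite dotBl; ring.
  rewrite RintegralD//.
  - under eq_Rintegral => y _ do rewrite mulr1.
    rewrite gauss_first_moment add0r RintegralZl// ?gauss_int1 1?mulrC//.
    have := subgauss_integrable h0 z (subgauss_cst 1).
    by apply: eq_integrable => // y _; rewrite /= mul1r.
  - by apply: subgauss_integrable => //; exact: subgauss_dotB.
  - by apply: subgauss_integrable => //; exact: subgauss_cst.
have [_ D] := is_derive_gconv h0 x v gd.
have [_ D2] := is_derive_dot N x v v.
rewrite e D2 dot_sqnorm in D.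
rewrite -mulrA D.
rewrite -RintegralZl//; last first.
  by apply: subgauss_integrable => //; apply: subgaussM => //; exact: subgauss_dotB.
have -> : \int[leb]_y (dot (y - x) v ^+ 2 * wt x y) =
    \int[leb]_y (dot (y - x) v ^+ 2 * wt x y) + dot x v * \int[leb]_y (dot (y - x) v * wt x y).
  by rewrite gauss_first_moment mulr0 addr0.
rewrite -RintegralZl//; last first.
  by move: i1; apply: eq_integrable => // y _; rewrite /= mulr1.
rewrite -RintegralD//.
- apply: eq_Rintegral => y _; rewrite dotBl; by field; rewrite gt_eqF.
- have := subgauss_integrable h0 x (subgaussM (subgauss_dotB x v 1) (subgauss_dotB x v 1)).
  by apply: eq_integrable => // y _; rewrite /= !mulr1 expr2.
- have := subgauss_integrable h0 x (subgaussM (subgauss_cst (dot x v)) (subgauss_dotB x v 1)).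
  by apply: eq_integrable => // y _; rewrite /= mulr1 mulrA.
Qed.

Lemma continuous_V0 : continuous V0.
Proof. by move=> x; exact: cst_continuous. Qed.

Lemma kern0_expectation x : expectation_like (kern V0 h ^~ x).
Proof. exact: kern_expectation continuous_V0 (@convex_function0 R d) h0 x. Qed.

Lemma kern0_int f x : \int[leb]_y (f y * wt x y) = N * kern V0 h f x.
Proof. by rewrite kern0E mulrA divff ?mul1r// gt_eqF// gauss_const_gt0. Qed.

(* Expand [0 <= int (f - P f - <y - x, grad P f>)^2]. *)
Lemma kern0_grad_variance f x : bmeas f ->
  h * sqnorm (grad (kern V0 h f) x) <= variance_of (kern V0 h ^~ x) f.
Proof.
move=> bf; set v := grad _ x; set m := kern V0 h f x.
have gf := bmeas_subgauss bf; have N0 := gauss_const_gt0.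
(* Gaussian integration by parts: h times the derivative of the convolution along [v] is the
   correlation of [f] with <y - x, v>. As [v] is the gradient itself, that derivative is [N]
   |v|^2. *)
have D : \int[leb]_y (f y * dot (y - x) v * wt x y) = h * N * sqnorm v.
  have [_ D1] := is_derive_gconv h0 x v gf.
  have [_ D2] := is_derive_kern0 x v bf.
  rewrite -/v dot_sqnorm in D2.
  have e : gconv h f = N *: kern V0 h f.
    by apply/funext => z; rewrite /gconv kern0_int.
  have [d3 _] := is_derive_kern0 x v bf.
  rewrite e deriveZ// D2 in D1.
  rewrite -mulrA -[N * _]/(N *: _) D1 -RintegralZl//; last first.
    by apply: subgauss_integrable => //; apply: subgaussM => //; exact: subgauss_dotB.
  by apply: eq_Rintegral => y _; field; rewrite gt_eqF.
have ge0 : 0 <= \int[leb]_y ((f y - m - dot (y - x) v) ^+ 2 * wt x y).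
  by apply: Rintegral_ge0 => y _; rewrite mulr_ge0 ?sqr_ge0// expR_ge0.
pose c i : R := nth 0 [:: 1; - (2 * m); m ^+ 2; -2; 2 * m; 1] i.
pose F i y : R := nth 0 [:: f y ^+ 2 * wt x y; f y * wt x y; 1 * wt x y;
  f y * dot (y - x) v * wt x y; dot (y - x) v * wt x y; dot (y - x) v ^+ 2 * wt x y] i.
have sd : subgauss (fun y => dot (y - x) v).
  have := subgauss_dotB x v 1; congr subgauss.
  by apply/funext => y; rewrite mulr1.
have iF i : leb.-integrable setT (EFin \o F i).
  have S G : subgauss G -> leb.-integrable setT (EFin \o (fun y => G y * wt x y)).
    exact: subgauss_integrable.
  case: i => [|[|[|[|[|[|i]]]]]]; rewrite /F /=.
  - by apply: (S (fun y => f y ^+ 2)); apply: bmeas_subgauss; exact: bmeasX.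
  - exact: S.
  - exact: (S (fun=> 1) (subgauss_cst 1)).
  - exact: (S _ (subgaussM gf sd)).
  - exact: S.
  - exact: (S _ (subgaussM sd sd)).
  - by under eq_fun do rewrite nth_nil; exact: integrable0.
have := Rintegral_sumZ (iota 0 6) c iF.
have -> : (fun y => \sum_(i <- iota 0 6) c i * F i y) =
    (fun y => (f y - m - dot (y - x) v) ^+ 2 * wt x y).
  by apply/funext => y; rewrite /= !big_cons big_nil /c /F /=; ring.
move=> E; rewrite E in ge0; move: ge0; rewrite /= !big_cons big_nil /c /F /=.
rewrite D gauss_first_moment gauss_second_moment.
have -> : \int[leb]_y (f y ^+ 2 * wt x y) = N * kern V0 h (fun y => f y ^+ 2) x.
  exact: (kern0_int (fun y => f y ^+ 2)).
have -> : \int[leb]_y (1 * wt x y) = N by exact: gconv1.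
rewrite kern0_int -/m /variance_of -/m => H.
rewrite -(ler_pM2l N0); lra.
Qed.

(* Integrate [ln z <= ln m + z / m - 1] with [z = f w_x' / w_x] against [w_x]. *)
Lemma kern0_log_harnack f c x x' : 0 < c -> (forall y, c <= f y) -> bmeas f ->
  kern V0 h (fun y => ln (f y)) x <= ln (kern V0 h f x') + sqnorm (x - x') / (2 * h).
Proof.
move=> c0 cf bf; have bl := bmeas_ln c0 cf bf.
have N0 := gauss_const_gt0.
set m := kern V0 h f x'.
have m0 : 0 < m by apply: lt_le_trans c0 _; exact: (el_geC (kern0_expectation x') bf cf).
pose v := x' - x.
pose a y := (2 * dot (y - x) v - sqnorm v) / (2 * h).
have aE y : wt x' y = expR (a y) * wt x y.
  rewrite !gweightE -expRD; congr expR.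
  have -> : y - x' = (y - x) - 1 *: v by rewrite scale1r /v opprB addrA subrK.
  by rewrite sqnorm_sub_scale /a; field; rewrite gt_eqF.
have pw y : ln (f y) * wt x y + (h^-1 * (dot (y - x) v * wt x y) +
     (- (sqnorm v / (2 * h) + (ln m - 1))) * (1 * wt x y)) <= m^-1 * (f y * wt x' y).
  have w0 : 0 < wt x y by exact: weight_gt0.
  have f0 : 0 < f y by exact: lt_le_trans (cf y).
  have z0 : 0 < f y * expR (a y) by rewrite mulr_gt0 ?expR_gt0.
  have := ln_le_tangent m0 z0; rewrite lnM ?posrE ?expR_gt0// expRK => H.
  have := ler_wpM2r (ltW w0) H; rewrite aE.
  have -> : m^-1 * (f y * (expR (a y) * wt x y)) = f y * expR (a y) / m * wt x y.
    by ring.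
  set e := expR (a y).
  have -> : a y = h^-1 * dot (y - x) v - sqnorm v / (2 * h).
    by rewrite /a; field; rewrite gt_eqF.
  by lra.
have S z G : subgauss G -> leb.-integrable setT (EFin \o (fun y => G y * wt z y)).
  exact: subgauss_integrable.
have iZ z k G : subgauss G -> leb.-integrable setT (EFin \o (fun y => k * (G y * wt z y))).
  move=> gG; have := integrableZl measurableT k (S z G gG).
  by apply: eq_integrable.
have sd : subgauss (fun y => dot (y - x) v).
  have := subgauss_dotB x v 1; congr subgauss.
  by apply/funext => y; rewrite mulr1.
have s1 := subgauss_cst 1.
have i2 : leb.-integrable setT (EFin \o (fun y => h^-1 * (dot (y - x) v * wt x y) +
     (- (sqnorm v / (2 * h) + (ln m - 1))) * (1 * wt x y))).
  have := integrableD measurableT (iZ x h^-1 _ sd) (iZ x (- (sqnorm v / (2 * h) + (ln m - 1))) _ s1).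
  by apply: eq_integrable.
have i1 := S x _ (bmeas_subgauss bl).
have i3 : leb.-integrable setT (EFin \o (fun y => ln (f y) * wt x y + (h^-1 * (dot (y - x) v * wt x y) +
     (- (sqnorm v / (2 * h) + (ln m - 1))) * (1 * wt x y)))).
  by have := integrableD measurableT i1 i2; apply: eq_integrable.
have gf := bmeas_subgauss bf.
have := le_Rintegral measurableT i3 (iZ x' m^-1 _ gf) (fun y _ => pw y).
rewrite RintegralD// RintegralD//; try exact: (iZ _ _ _ sd); try exact: (iZ _ _ _ s1).
rewrite !RintegralZl//; try exact: (S _ _ sd); try exact: (S _ _ s1); try exact: (S _ _ gf).
2: by have := S x _ s1; apply: eq_integrable => // y _; rewrite /= mul1r.
(* The linear part of the log-ratio of the two weights has zero mean; only - |v|^2 / (2 h)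
   survives. *)
rewrite gauss_int1 mul1r gauss_first_moment (kern0_int f x') (kern0_int (fun y => ln (f y)) x) -/m.
rewrite (sqnormBC x x') -/v mulr0 add0r.
have -> : m^-1 * (N * m) = N by field; rewrite gt_eqF.
move=> H; rewrite -(ler_pM2l N0); lra.
Qed.

(** Along its own gradient v the function has derivative |v|^2, while the Lipschitz bound limits the
    square of the difference quotients by |v|^2; hence |v|^4 <= |v|^2. *)
Lemma kern0_grad_lip1 f x : bmeas f -> lip1 f -> sqnorm (grad (kern V0 h f) x) <= 1.
Proof.
move=> bf lf; set v := grad _ x.
have lP : lip1 (kern V0 h f).
  exact: kern_lip1 continuous_V0 (@convex_function0 R d) h0 _ bf lf.
have [D1 D2] := is_derive_kern0 x v bf; rewrite -/v dot_sqnorm in D2.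
have : sqnorm v ^+ 2 <= sqnorm v.
  have cv : (fun t : R => (t^-1 *: ((kern V0 h f \o shift x) (t *: v) - kern V0 h f x)) ^+ 2) @ 0^' --> sqnorm v ^+ 2.
    rewrite -D2; apply: (cvg_comp _ (fun z : R => z ^+ 2) D1).
    exact: exprn_continuous.
  rewrite -(cvg_lim (@Rhausdorff R) cv); apply: limr_le.
    by apply/cvg_ex; eexists; exact: cv.
  near=> t; have t0 : t != 0 by near: t; exact: nbhs_dnbhs_neq.
  rewrite /GRing.scale/= exprMn.
  have := lP (t *: v + x) x; rewrite addrK sqnormZ => H.
  by rewrite exprVn ler_pdivrMl ?exprn_even_gt0.
have := sqnorm_ge0 v; nra.
Unshelve. all: end_near. Qed.

End gaussian_kernel.

(** * Iterates of the chain *)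

Section chain.
Context {R : realType} {d : nat} (V : 'rV[R]_d -> R) (h : R).
Hypotheses (cV : continuous V) (cvxV : convex_function setT V) (h0 : 0 < h).
Implicit Types (x y v : 'rV[R]_d) (f g : 'rV[R]_d -> R).
Local Notation V0 := (fun _ : 'rV[R]_d => 0 : R).
Local Notation P := (kern V0 h).
Local Notation Q := (kern V h).
Let cV0 := @continuous_V0 R d.
Let cvxV0 := @convex_function0 R d.

Definition proximal_step f := P (Q f).
Local Notation M := proximal_step.

Lemma bmeas_step f : bmeas f -> bmeas (M f).
Proof.
by move=> bf; apply: bmeas_kern cV0 cvxV0 h0 _ _; exact: bmeas_kern.
Qed.

Lemma bmeas_iter n f : bmeas f -> bmeas (iter n M f).
Proof. by move=> bf; elim: n => //= n IH; exact: bmeas_step. Qed.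

Lemma expectation_like_comp (L : ('rV[R]_d -> R) -> R) (K : ('rV[R]_d -> R) -> 'rV[R]_d -> R) :
  expectation_like L -> (forall x, expectation_like (K ^~ x)) ->
  (forall f, bmeas f -> bmeas (K f)) -> expectation_like (fun f => L (K f)).
Proof.
move=> HL HK bK; split.
- move=> a b f g bf bg; rewrite -(el_lin HL); try exact: bK.
  by congr L; apply/funext => x; exact: (el_lin (HK x)).
- move=> f g bf bg fg; apply: (el_le HL); try exact: bK.
  by move=> x; exact: (el_le (HK x)).
- rewrite -[RHS](el_one HL); congr L.
  by apply/funext => x; exact: (el_one (HK x)).
Qed.

Lemma kern_el y : expectation_like (Q ^~ y).
Proof. exact: kern_expectation. Qed.

Lemma kern0_el y : expectation_like (P ^~ y).
Proof. exact: kern0_expectation. Qed.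

Lemma step_el x : expectation_like (M ^~ x).
Proof.
by apply: (expectation_like_comp (kern0_el x) kern_el) => f; exact: bmeas_kern.
Qed.

Lemma iter_el n (L : ('rV[R]_d -> R) -> R) :
  expectation_like L -> expectation_like (fun f => L (iter n M f)).
Proof.
move=> HL; elim: n => [//|n IH].
have e : (fun f => L (iter n.+1 M f)) = (fun f => L (iter n M (M f))).
  by apply/funext => f; rewrite iterSr.
rewrite e; exact: (expectation_like_comp IH step_el bmeas_step).
Qed.

Lemma point_el x : expectation_like (fun f : 'rV[R]_d -> R => f x).
Proof. by split => // f g _ _; exact. Qed.

Lemma continuous_iter n f : bmeas f -> continuous (iter n.+1 M f).
Proof.
move=> bf; rewrite iterS; apply: continuous_kern cV0 cvxV0 h0 _ _.
by apply: bmeas_kern => //; exact: bmeas_iter.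
Qed.

(* The induction passes through the dual form of the contraction of [Q] and [P],
   and splits the displacement [x - x'] in proportions [n + 1 : 1]. *)
Lemma log_harnack n f c : 0 < c -> (forall y, c <= f y) -> bmeas f ->
  forall x x', iter n.+1 M (fun y => ln (f y)) x <=
  ln (iter n.+1 M f x') + sqnorm (x - x') / (2 * (h * n.+1%:R)).
Proof.
move=> c0 cf bf; have bl := bmeas_ln c0 cf bf.
have fc m y : c <= iter m M f y by exact: (el_geC (iter_el m (point_el y)) bf cf).
have Qc m y : c <= Q (iter m M f) y.
  by apply: (el_geC (kern_el y)); [exact: bmeas_iter|exact: fc].
have bQ m : bmeas (Q (iter m M f)) by apply: bmeas_kern => //; exact: bmeas_iter.
have last m z x' : P (Q (fun y => ln (iter m M f y))) z <=
    ln (iter m.+1 M f x') + sqnorm (z - x') / (2 * h).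
  apply: le_trans (kern0_log_harnack h0 z x' c0 (Qc m) (bQ m)).
  apply: (el_le (kern0_el z)).
  - apply: bmeas_kern => //; apply: (bmeas_ln c0) => //; exact: bmeas_iter.
  - by apply: (bmeas_ln c0).
  - by move=> y; apply: (el_ln_le (kern_el y) c0) => //; exact: bmeas_iter.
elim: n => [|n IH] x x'.
  by rewrite mulr1; exact: (last 0%N).
pose s : R := n.+1%:R; have s0 : 0 < s by rewrite ltr0n.
have hs : 0 < h * s by rewrite mulr_gt0.
pose A := iter n.+1 M (fun y => ln (f y)).
pose B := fun y => ln (iter n.+1 M f y).
have bA : bmeas A by exact: bmeas_iter.
have cA : continuous A by exact: continuous_iter.
have bB : bmeas B by apply: (bmeas_ln c0) => //; exact: bmeas_iter.
have cB : continuous B.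
  move=> y; have c1 : {for y, continuous (iter n.+1 M f)} by exact: continuous_iter.
  apply: (continuous_comp c1); apply: continuous_ln.
  exact: lt_le_trans c0 (fc _ _).
have AB1 y y' := kern_transport cV cvxV h0 y y' hs cA bA cB bB IH.
have bQA : bmeas (Q A) by exact: bmeas_kern.
have bQB : bmeas (Q B) by exact: bmeas_kern.
have cQA : continuous (Q A) by exact: continuous_kern.
have cQB : continuous (Q B) by exact: continuous_kern.
(* The minimiser of r^2 / s + (1 - r)^2, with minimum 1 / (s + 1): the cost of [n + 1] steps
   combined with that of one more. *)
pose r : R := s / (s + 1).
pose z := x - r *: (x - x').
have s1 : 0 < s + 1 by rewrite addr_gt0.
have h1 := kern_transport cV0 cvxV0 h0 x z hs cQA bQA cQB bQB AB1.
have h2 := last n.+1 z x'.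
have e1 : x - z = r *: (x - x') by rewrite /z opprB addrC subrK.
have e2 : z - x' = (1 - r) *: (x - x') by rewrite /z scalerBl scale1r addrAC.
rewrite e1 sqnormZ in h1; rewrite e2 sqnormZ in h2.
rewrite [iter n.+2 M _]iterS; apply: le_trans h1 _.
rewrite -/B in h2.
apply: le_trans (lerD h2 (lexx _)) _.
rewrite -addrA lerD2l le_eqVlt; apply/orP; left; apply/eqP.
rewrite /r -[n.+2%:R]natr1 -/s; field.
by rewrite !gt_eqF.
Qed.

(** Total variance: each half-step adds a conditional variance of at most 8 h to a Lipschitz
    function and returns a Lipschitz function, so a full step costs 16 h. *)
Lemma iter_variance_lip1 (L : ('rV[R]_d -> R) -> R) k f : expectation_like L ->
  bmeas f -> lip1 f ->
  variance_of (fun f => L (iter k M f)) f <=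
  variance_of L (iter k M f) + 16 * h * k%:R.
Proof.
move=> HL; elim: k f => [|k IH] f bf lf; first by rewrite mulr0 addr0.
have bQ := bmeas_kern cV cvxV h0 bf; have lQ := kern_lip1 cV cvxV h0 bf lf.
have bM := bmeas_step bf.
have lM : lip1 (M f) by exact: kern_lip1 cV0 cvxV0 h0 _ bQ lQ.
have := IH _ bM lM.
have b2 := bmeasX 2 bf; have bM2 := bmeasX 2 bM; have bQ2 := bmeasX 2 bQ.
have pt x : M (fun y => f y ^+ 2) x <= M f x ^+ 2 + 16 * h.
  have v1 := kern_variance_lip1 cV0 cvxV0 h0 x bQ lQ.
  rewrite /variance_of in v1.
  have bc : bmeas (fun y => Q f y ^+ 2 + 8 * h).
    by apply: bmeasD => //; exact: bmeas_cst.
  have v2 : M (fun y => f y ^+ 2) x <= P (fun y => Q f y ^+ 2 + 8 * h) x.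
    apply: (el_le (kern0_el x)) => //; first exact: bmeas_kern.
    move=> y; have := kern_variance_lip1 cV cvxV h0 y bf lf.
    by rewrite /variance_of lerBlDl.
  have bc8 : bmeas (fun _ : 'rV[R]_d => 8 * h) by exact: bmeas_cst.
  have E1 := elD (kern0_el x) bQ2 bc8; have E2 := el_cst (kern0_el x) (8 * h).
  cbv beta in E1, E2; rewrite E1 E2 in v2.
  by rewrite /proximal_step in v2 *; lra.
have HLk := iter_el k HL.
have bc16 : bmeas (fun _ : 'rV[R]_d => 16 * h) by exact: bmeas_cst.
have := el_le HLk (bmeas_step b2) (bmeasD bM2 bc16) pt.
have E1 := elD HLk bM2 bc16; have E2 := el_cst HLk (16 * h).
cbv beta in E1, E2; rewrite E1 E2 /variance_of -!iterSr -natr1 => H1 H2.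
lra.
Qed.

(** * Decay of the variance under the target *)

Section contraction.
Variables (Pi : ('rV[R]_d -> R) -> R) (C : R).
Hypotheses (HPi : expectation_like Pi) (C0 : 0 <= C).
Hypothesis PiM : forall f, bmeas f -> Pi (M f) = Pi f.
(** Stated on smoothed functions only, where it follows from the Poincare constant for every bounded
    measurable [g]. *)
Hypothesis poincare : forall g, bmeas g ->
  variance_of Pi (P g) <= C * Pi (fun x => sqnorm (grad (P g) x)).

Lemma bmeas_sqnorm_grad g : bmeas g -> bmeas (fun x => sqnorm (grad (P g) x)).
Proof.
move=> bg; split.
  apply: measurable_sum => i; apply: measurable_funX.
  apply: continuous_measurable_rV.
  have [_ /(_ i) [_ [+ _]]] := smooth_kern0 h0 bg 1.
  rewrite (_ : partial i _ = fun x => grad (P g) x ord0 i)//.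
  by apply/funext => x; rewrite mxE.
have [mg [K gK]] := bg.
exists (h^-1 * K ^+ 2) => x; rewrite ger0_norm ?sqnorm_ge0// ler_pdivlMl//.
apply: le_trans (kern0_grad_variance h0 x bg) _.
rewrite /variance_of; have b2 := bmeasX 2 bg.
have := @el_leC _ _ _ _ (kern0_el x) (K ^+ 2) _ b2.
have g2 y : g y ^+ 2 <= K ^+ 2.
  rewrite -real_normK ?num_real// ler_pXn2r ?nnegrE//.
  exact: le_trans (gK y).
move=> /(_ g2); have := sqr_ge0 (P g x); lra.
Qed.

(** With a the mean of |grad P Q f|^2, the gradient bound and Jensen's inequality for Q give h a <=
    Var f - Var (M f), by invariance; the Poincare inequality gives Var (M f) <= C a. Eliminating a
    yields the contraction. *)
Lemma step_variance f : bmeas f ->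
  (h + C) * variance_of Pi (M f) <= C * variance_of Pi f.
Proof.
move=> bf; have bQ := bmeas_kern cV cvxV h0 bf.
have bP := bmeas_kern cV0 cvxV0 h0 bQ; have bP2 := bmeasX 2 bP.
have bQ2 := bmeasX 2 bQ; have b2 := bmeasX 2 bf.
have bPQ2 := bmeas_kern cV0 cvxV0 h0 bQ2.
have h1 := poincare bQ.
have bg := bmeas_sqnorm_grad bQ.
have h2 : h * Pi (fun x => sqnorm (grad (P (Q f)) x)) <=
    Pi (P (fun y => Q f y ^+ 2)) - Pi (fun x => P (Q f) x ^+ 2).
  rewrite -(elZ HPi)// -(elB HPi)//; apply: (el_le HPi).
  - exact: bmeasZ.
  - exact: bmeasB.
  - by move=> x; exact: kern0_grad_variance.
have h3 : Pi (P (fun y => Q f y ^+ 2)) <= Pi (fun y => f y ^+ 2).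
  rewrite -(PiM b2); apply: (el_le HPi) => //; first exact: bmeas_step.
  move=> x; apply: (el_le (kern0_el x)) => //; first exact: bmeas_kern.
  by move=> y; exact: (el_sqr_le (kern_el y)).
have h4 := PiM bf.
rewrite /variance_of /proximal_step in h1 h4 *; rewrite h4 in h1 *.
move: h1 h2 h3; set a := Pi (fun x => sqnorm _); set b := Pi (fun x => P (Q f) x ^+ 2).
set c := Pi (P _); set e := Pi (fun y => _); set p := Pi f.
move=> h1 h2 h3.
have := ler_wpM2l (ltW h0) h1; have := ler_wpM2l C0 h2; have := ler_wpM2l C0 h3.
nra.
Qed.

Lemma iter_variance m f : bmeas f ->
  variance_of Pi (iter m M f) <= expR (- (m%:R / (1 + C / h))) * variance_of Pi f.
Proof.
move=> bf; have hC : 0 < h + C by rewrite ltr_wpDr.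
elim: m => [|m IH]; first by rewrite mul0r oppr0 expR0 mul1r.
have bm := bmeas_iter m bf; have := step_variance bm; rewrite -iterS.
set a := variance_of Pi (iter m.+1 M f); set b := variance_of Pi (iter m M f) in IH *.
move=> H; have b0 : 0 <= b by exact: variance_of_ge0.
have e1 : (1 + C / h)^-1 = h / (h + C).
  by field; rewrite !gt_eqF//= mulr1.
rewrite -natr1 mulrDl opprD expRD mul1r e1 in IH *.
have : a <= expR (- (h / (h + C))) * b.
  apply: (@le_trans _ _ (C / (h + C) * b)).
    by rewrite mulrAC ler_pdivlMr// mulrC.
  rewrite ler_wpM2r//; apply: le_trans (expR_ge1Dx _).
  by rewrite le_eqVlt; apply/orP; left; apply/eqP; field; rewrite gt_eqF.
move=> /le_trans; apply.
rewrite -mulrA [leRHS]mulrCA ler_wpM2l ?expR_ge0//.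
Qed.

End contraction.

End chain.

(** * Concentration from variance bounds *)

Section euclidean_distance.
Context {R : realType} {d : nat}.
Implicit Types x y z u v : 'rV[R]_d.

Definition enorm x : R := Num.sqrt (sqnorm x).

Lemma enorm_ge0 x : 0 <= enorm x. Proof. exact: sqrtr_ge0. Qed.

Lemma enorm_sqr x : enorm x ^+ 2 = sqnorm x.
Proof. by rewrite sqr_sqrtr ?sqnorm_ge0. Qed.

Lemma dot_sqr_le u v : dot u v ^+ 2 <= sqnorm u * sqnorm v.
Proof.
have [v0|v0] := eqVneq (sqnorm v) 0.
  have vi i : v ord0 i = 0.
    apply/eqP; rewrite -sqrf_eq0 eq_le sqr_ge0 andbT -v0; exact: coord_sqnorm.
  rewrite v0 mulr0 /dot big1 ?expr0n// => i _; by rewrite vi mulr0.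
have vp : 0 < sqnorm v by rewrite lt_neqAle eq_sym v0 sqnorm_ge0.
have := sqnorm_ge0 (u - (dot u v / sqnorm v) *: v).
rewrite sqnorm_sub_scale => H.
have : 0 <= sqnorm v * (sqnorm u + - (2 * dot u v) * (dot u v / sqnorm v) +
    sqnorm v * (dot u v / sqnorm v) ^+ 2) by rewrite mulr_ge0// ltW.
have -> : sqnorm v * (sqnorm u + - (2 * dot u v) * (dot u v / sqnorm v) +
    sqnorm v * (dot u v / sqnorm v) ^+ 2) = sqnorm u * sqnorm v - dot u v ^+ 2.
  by field.
by rewrite subr_ge0.
Qed.

Lemma enormBD x y z : enorm (x - z) <= enorm (x - y) + enorm (y - z).
Proof.
set u := x - y; set w := y - z.
have -> : x - z = u - (-1) *: w by rewrite scaleN1r opprK /u /w addrA subrK.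
have n0 := enorm_ge0 u; have n1 := enorm_ge0 w.
rewrite -(@ler_pXn2r _ 2)// ?nnegrE ?enorm_ge0 ?addr_ge0//.
rewrite enorm_sqr sqnorm_sub_scale sqrrD !enorm_sqr.
have : dot u w <= enorm u * enorm w.
  have [|/ltW dneg] := leP 0 (dot u w); last first.
    by apply: (le_trans dneg); rewrite mulr_ge0.
  move=> d0; rewrite -(@ler_pXn2r _ 2)// ?nnegrE ?mulr_ge0//.
  by rewrite exprMn !enorm_sqr dot_sqr_le.
lra.
Qed.

Lemma enormBC x y : enorm (x - y) = enorm (y - x).
Proof. by rewrite /enorm sqnormBC. Qed.

Variables (S : set 'rV[R]_d) (z0 : 'rV[R]_d) (Sz0 : S z0) (rho : R) (rho0 : 0 <= rho).

(** The cap [rho] makes the Euclidean distance to [S] bounded, hence an admissible test function. *)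
Definition truncated_dist x : R := inf [set Num.min rho (enorm (x - z)) | z in S].

Lemma truncated_dist_le x z : S z -> truncated_dist x <= Num.min rho (enorm (x - z)).
Proof.
move=> Sz; apply: ge_inf; last by exists z.
by exists 0 => _ [y _ <-]; rewrite le_min rho0 enorm_ge0.
Qed.

Lemma truncated_dist_ge x c : (forall z, S z -> c <= Num.min rho (enorm (x - z))) ->
  c <= truncated_dist x.
Proof.
move=> H; apply: lb_le_inf; first by exists (Num.min rho (enorm (x - z0))); exists z0.
by move=> _ [z Sz <-]; exact: H.
Qed.

Lemma truncated_dist_ge0 x : 0 <= truncated_dist x.
Proof. by apply: truncated_dist_ge => z _; rewrite le_min rho0 enorm_ge0. Qed.

Lemma truncated_dist_ub x : truncated_dist x <= rho.
Proof. by apply: le_trans (truncated_dist_le x Sz0) _; rewrite ge_min lexx. Qed.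

Lemma truncated_dist_mem x : S x -> truncated_dist x = 0.
Proof.
move=> Sx; apply/eqP; rewrite eq_le truncated_dist_ge0 andbT.
apply: le_trans (truncated_dist_le x Sx) _.
by rewrite ge_min subrr /enorm sqnorm0 sqrtr0 lexx orbT.
Qed.

Lemma truncated_dist_lt x : truncated_dist x < rho ->
  exists2 z, S z & sqnorm (x - z) <= rho ^+ 2.
Proof.
move=> H; apply: contrapT => nz.
suff : rho <= truncated_dist x by rewrite leNgt H.
apply: truncated_dist_ge => z Sz; rewrite le_min lexx/=.
rewrite leNgt; apply/negP => lt; apply: nz; exists z => //.
rewrite -enorm_sqr ler_pXn2r ?nnegrE ?enorm_ge0//; exact: ltW.
Qed.

Lemma truncated_dist_lip1 : lip1 truncated_dist.
Proof.
have key x y : truncated_dist x <= truncated_dist y + enorm (x - y).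
  rewrite -lerBlDr; apply: truncated_dist_ge => z Sz.
  rewrite lerBlDr; apply: le_trans (truncated_dist_le x Sz) _.
  have tri := enormBD x y z; have e0 := enorm_ge0 (x - y).
  rewrite /Num.min; case: ifP => h1; case: ifP => h2; lra.
move=> x y; rewrite -enorm_sqr -real_normK ?num_real// ler_pXn2r ?nnegrE ?enorm_ge0//.
have k1 := key x y; have k2 := key y x; rewrite (enormBC y x) in k2.
by rewrite ler_norml; apply/andP; split; lra.
Qed.

Lemma bmeas_truncated_dist : bmeas truncated_dist.
Proof.
split; first exact: continuous_measurable_rV (lip1_continuous truncated_dist_lip1).
by exists rho => x; rewrite ger0_norm ?truncated_dist_ge0// truncated_dist_ub.
Qed.

End euclidean_distance.

Section level_sets.
Context {R : realType} {d : measure_display} {T : measurableType d}.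

Lemma measurable_ge_set (f : T -> R) c : measurable_fun setT f -> measurable [set x | c <= f x].
Proof.
move=> mf; rewrite -[X in measurable X]setTI; exact: measurable_fun_le.
Qed.

Lemma measurable_le_set (f : T -> R) c : measurable_fun setT f -> measurable [set x | f x <= c].
Proof.
move=> mf; rewrite -[X in measurable X]setTI; exact: measurable_fun_le.
Qed.

Lemma measurable_lt_set (f : T -> R) c : measurable_fun setT f -> measurable [set x | c < f x].
Proof.
move=> mf; have -> : [set x | c < f x] = ~` [set x | f x <= c].
  by apply/seteqP; split => x /=; rewrite ltNge => /negP.
by apply: measurableC; exact: measurable_le_set.
Qed.

Lemma indic_in (A : set T) x : A x -> \1_A x = 1 :> R.
Proof. by move=> Ax; rewrite indicE mem_set. Qed.

Lemma indic_notin (A : set T) x : ~ A x -> \1_A x = 0 :> R.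
Proof. by move=> Ax; rewrite indicE memNset. Qed.

Lemma indic_bounds (A : set T) x : 0 <= (\1_A x : R) <= 1.
Proof. by rewrite indicE; case: (_ \in _); rewrite ?lexx ler01. Qed.

Lemma el_indicC (L : (T -> R) -> R) (A : set T) : expectation_like L -> measurable A ->
  L \1_(~` A) = 1 - L \1_A.
Proof.
move=> HL mA; have bA := @bmeas_indic R _ _ A mA.
rewrite -(el_one HL) -(elB HL)//; last exact: bmeas_cst.
congr L; apply/funext => x; have [Ax|Ax] := pselect (A x).
  by rewrite (indic_in Ax) indic_notin ?subrr//; exact.
by rewrite (indic_notin Ax) indic_in ?subr0.
Qed.

End level_sets.

Section concentration.
Context {R : realType} {d : nat} (L : ('rV[R]_d -> R) -> R) (HL : expectation_like L).

(** The truncated distance is 0 on [S] and [rho] off [E]. With a and b the masses of [S] and of the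
    complement of [E], its variance is at least m^2 a + (rho - m)^2 b, so a b rho^2 <= (a + b) v <=
    2 v. As a >= delta / 4, the choice rho^2 = 32 v / delta^2 gives b <= delta / 4. *)
Lemma variance_concentration (v delta : R) (S : set 'rV[R]_d) :
  0 < v -> 0 < delta <= 1 -> measurable S -> delta / 4 <= L \1_S ->
  (forall f, bmeas f -> lip1 f -> variance_of L f <= v) ->
  exists E, [/\ measurable E, 1 - delta / 4 <= L \1_E &
    forall x, E x -> exists2 x', S x' & sqnorm (x - x') <= 32 * v / delta ^+ 2].
Proof.
move=> v0 /andP[d0 d1] mS SL Hv.
have [z0 Sz0] : exists z, S z.
  apply: contrapT => /forallNP nS.
  have e : \1_S = (fun=> 0) :> ('rV[R]_d -> R).
    by apply/funext => x; rewrite indic_notin.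
  by move: SL; rewrite e (el_cst HL); lra.
have q0 : 0 < 32 * v / delta ^+ 2 by rewrite divr_gt0 ?mulr_gt0// exprn_gt0.
set q := 32 * v / delta ^+ 2 in q0 *.
pose rho := Num.sqrt q.
have rho0 : 0 < rho by rewrite sqrtr_gt0.
have rho2 : rho ^+ 2 = q by rewrite sqr_sqrtr// ltW.
pose f := truncated_dist S rho.
have bf : bmeas f := bmeas_truncated_dist Sz0 (ltW rho0).
have lf : lip1 f := truncated_dist_lip1 Sz0 (ltW rho0).
pose E := [set x | f x < rho].
have mE : measurable E.
  have -> : E = ~` [set x | rho <= f x].
    by apply/seteqP; split => x; rewrite /E /= ltNge => /negP.
  by apply: measurableC; apply: measurable_ge_set; exact: bf.1.
exists E; split => // [|x]; last first.
  move=> Ex; have [z Sz xz] := truncated_dist_lt Sz0 (ltW rho0) Ex.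
  by exists z => //; rewrite -rho2.
pose m := L f; pose a := L \1_S; pose b := L \1_(~` E).
have bS := @bmeas_indic R _ _ S mS; have bE := @bmeas_indic R _ _ _ (measurableC mE).
have h1 : m ^+ 2 * a + (rho - m) ^+ 2 * b <= variance_of L f.
  have := variance_shift HL m bf; rewrite subrr expr0n addr0 => <-.
  rewrite -(elZ HL)// -(elZ HL)// -(elD HL); try exact: bmeasZ.
  apply: (el_le HL).
  - by apply: bmeasD; exact: bmeasZ.
  - by apply: bmeasX; apply: bmeasB => //; exact: bmeas_cst.
  move=> x; have [Ex|Ex] := pselect (E x); last first.
    have fx : f x = rho.
      apply/eqP; rewrite eq_le (truncated_dist_ub Sz0 (ltW rho0))/=.
      by rewrite leNgt; apply/negP.
    have nS : ~ S x.
      by move=> Sx; move: fx; rewrite /f (truncated_dist_mem Sz0 (ltW rho0) Sx) => e; rewrite -e ltxx in rho0.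
    by rewrite (indic_notin nS) (indic_in (A := ~` E))// fx mulr0 add0r mulr1.
  rewrite (indic_notin (A := ~` E)) ?mulr0 ?addr0; last by move=> /(_ Ex).
  have [Sx|Sx] := pselect (S x).
    by rewrite (indic_in Sx) mulr1 /f (truncated_dist_mem Sz0 (ltW rho0) Sx) sub0r sqrrN.
  by rewrite (indic_notin Sx) mulr0 sqr_ge0.
have h2 := Hv f bf lf.
have a1 : a <= 1.
  by apply: (el_leC HL bS) => x; have /andP[] := @indic_bounds R _ _ S x.
have b1 : b <= 1.
  by apply: (el_leC HL bE) => x; have /andP[] := @indic_bounds R _ _ (~` E) x.
have b0 : 0 <= b.
  by apply: (el_ge0 HL bE) => x; have /andP[] := @indic_bounds R _ _ (~` E) x.
have a0 : 0 <= a by apply: le_trans SL; rewrite divr_ge0// ltW.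
have h3 : a * b * q <= 2 * v.
  have h4 : a * b * rho ^+ 2 <= (m ^+ 2 * a + (rho - m) ^+ 2 * b) * (a + b).
    rewrite -subr_ge0.
    have -> : (m ^+ 2 * a + (rho - m) ^+ 2 * b) * (a + b) - a * b * rho ^+ 2 =
      (a * m - b * (rho - m)) ^+ 2 by ring.
    exact: sqr_ge0.
  rewrite -rho2; apply: le_trans h4 _; rewrite mulrC.
  have h5 : m ^+ 2 * a + (rho - m) ^+ 2 * b <= v by exact: le_trans h1 h2.
  apply: (@le_trans _ _ ((a + b) * v)); first by rewrite ler_wpM2l// addr_ge0.
  by apply: ler_wpM2r; [exact: ltW|lra].
have : b <= delta / 4.
  have h6 : delta / 4 * b * q <= 2 * v.
    by apply: le_trans h3; apply: ler_wpM2r; [exact: ltW|exact: ler_wpM2r].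
  have e : q = 32 * v / delta ^+ 2 by [].
  have : b * (8 * v / delta) <= 2 * v.
    apply: le_trans h6; rewrite le_eqVlt; apply/orP; left; apply/eqP.
    by rewrite e; field; rewrite gt_eqF.
  rewrite -ler_pdivlMr ?divr_gt0 ?mulr_gt0// => /le_trans; apply.
  by rewrite le_eqVlt; apply/orP; left; apply/eqP; field; rewrite !gt_eqF.
by rewrite /b (el_indicC HL mE); lra.
Qed.

End concentration.

(** * The mixing window *)

Section mixing.
Context {R : realType} {d : nat} (V : 'rV[R]_d -> R) (h : R).
Hypotheses (cV : continuous V) (cvxV : convex_function setT V) (h0 : 0 < h).
Implicit Types (x y v : 'rV[R]_d) (f g : 'rV[R]_d -> R).
Local Notation V0 := (fun _ : 'rV[R]_d => 0 : R).
Local Notation P := (kern V0 h).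
Local Notation M := (proximal_step V h).
Variables (Pi : ('rV[R]_d -> R) -> R) (C : R).
Hypotheses (HPi : expectation_like Pi) (C0 : 0 <= C).
Hypothesis PiM : forall f, bmeas f -> Pi (M f) = Pi f.
Hypothesis poincare : forall g, bmeas g ->
  variance_of Pi (P g) <= C * Pi (fun x => sqnorm (grad (P g) x)).

Lemma Pi_iter n f : bmeas f -> Pi (iter n M f) = Pi f.
Proof.
move=> bf; elim: n => //= n IH; rewrite PiM//.
exact: bmeas_iter.
Qed.

(* [D] is where [M^m 1_A] is not yet close to its [Pi]-mean; it is [Pi]-small by
   the spectral gap, so [M^m 1_D] is tiny on a set [S] of large [Pi]-measure, and the
   log-Harnack inequality carries the smallness from [S] to nearby points. *)
Lemma mixing_from_neighbourhoods (L : ('rV[R]_d -> R) -> R) (delta q : R) m :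
  expectation_like L -> 0 < delta <= 1 -> 0 <= q ->
  (forall S, measurable S -> 1 - delta / 4 <= Pi \1_S ->
    exists E, [/\ measurable E, 1 - delta / 4 <= L \1_E &
      forall x, E x -> exists2 x', S x' & sqnorm (x - x') <= q]) ->
  4 / delta * (1 + q / (2 * (h * m.+1%:R))) + ln (64 / delta ^+ 3) <= m.+1%:R / (1 + C / h) ->
  forall A, measurable A -> `|L (iter (m.+1 + m.+1) M \1_A) - Pi \1_A| <= delta.
Proof.
move=> HL /andP[d0 d1] q0 nbh cond A mA.
have bA := @bmeas_indic R _ _ A mA.
pose g := iter m.+1 M \1_A; pose p := Pi \1_A.
have bg : bmeas g by exact: bmeas_iter.
have g01 x : 0 <= g x <= 1.
  have HE := iter_el cV cvxV h0 m.+1 (point_el x).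
  apply/andP; split; [apply: (el_geC HE bA)|apply: (el_leC HE bA)] => y;
    by have /andP[] := @indic_bounds R _ _ A y.
have p01 : 0 <= p <= 1.
  apply/andP; split; [apply: (el_geC HPi bA)|apply: (el_leC HPi bA)] => y;
    by have /andP[] := @indic_bounds R _ _ A y.
have Pig : Pi g = p by exact: Pi_iter.
pose u := m.+1%:R / (1 + C / h).
have varg : variance_of Pi g <= expR (- u).
  apply: le_trans (iter_variance cV cvxV h0 HPi C0 PiM poincare m.+1 bA) _.
  rewrite -[leRHS]mulr1 ler_wpM2l ?expR_ge0//.
  rewrite /variance_of; have b2 := bmeasX 2 bA.
  have : Pi (fun x => \1_A x ^+ 2) <= 1.
    apply: (el_leC HPi b2) => x; have /andP[a1 a2] := @indic_bounds R _ _ A x.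
    by rewrite expr_le1.
  by have := sqr_ge0 (Pi \1_A); lra.
have bgp : bmeas (fun x => g x - p) by apply: bmeasB => //; exact: bmeas_cst.
have bn := bmeas_norm bgp.
pose D := [set x | delta / 4 < `|g x - p|].
have mD : measurable D by apply: measurable_lt_set; exact: bn.1.
have bD := @bmeas_indic R _ _ D mD.
have PiD : Pi \1_D <= 16 / delta ^+ 2 * expR (- u).
  have b2 := bmeasX 2 bgp.
  apply: (@le_trans _ _ (Pi (fun x => 16 / delta ^+ 2 * (g x - p) ^+ 2))).
    apply: (el_le HPi) => //; first exact: bmeasZ.
    move=> x; have [Dx|Dx] := pselect (D x); last first.
      by rewrite indic_notin// mulr_ge0 ?sqr_ge0// divr_ge0// sqr_ge0.
    rewrite indic_in// -(real_normK (num_real (g x - p))).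
    have -> : 16 / delta ^+ 2 * `|g x - p| ^+ 2 = (`|g x - p| / (delta / 4)) ^+ 2.
      by field; rewrite gt_eqF.
    rewrite -[leLHS](expr1n _ 2) ler_pXn2r ?nnegrE ?divr_ge0//; last by rewrite ltW.
    by rewrite ler_pdivlMr ?divr_gt0// mul1r ltW.
  rewrite (elZ HPi)// ler_wpM2l ?divr_ge0 ?sqr_ge0//.
  by have := variance_shift HPi p bg; rewrite Pig subrr expr0n addr0 => ->.
pose phi := iter m.+1 M \1_D.
have bphi : bmeas phi by exact: bmeas_iter.
have phi0 x : 0 <= phi x.
  have HE := iter_el cV cvxV h0 m.+1 (point_el x).
  by apply: (el_geC HE bD) => y; have /andP[] := @indic_bounds R _ _ D y.
(* The Markov threshold: 4 / delta times the bound on the [Pi]-mass of [D], so that [phi] exceeds it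
   only on [Pi]-mass delta / 4. *)
pose eta := 64 / delta ^+ 3 * expR (- u).
have eta0 : 0 < eta by rewrite mulr_gt0 ?expR_gt0// divr_gt0// exprn_gt0.
pose S := [set x | phi x <= eta].
have mS : measurable S by apply: measurable_le_set; exact: bphi.1.
have PiS : 1 - delta / 4 <= Pi \1_S.
  have bSC := @bmeas_indic R _ _ _ (measurableC mS).
  have : Pi \1_(~` S) <= eta^-1 * Pi phi.
    rewrite -(elZ HPi)//; apply: (el_le HPi) => //; first exact: bmeasZ.
    move=> x; have [Sx|Sx] := pselect (S x).
      rewrite (indic_notin (A := ~` S)); last by move=> /(_ Sx).
      by rewrite mulr_ge0// invr_ge0 ltW.
    rewrite indic_in// ler_pdivlMl// mulr1 ltW// ltNge; exact/negP.
  rewrite Pi_iter// (el_indicC HPi mS).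
  have : eta^-1 * Pi \1_D <= delta / 4.
    rewrite ler_pdivrMl//; apply: le_trans PiD _.
    rewrite le_eqVlt; apply/orP; left; apply/eqP.
    by rewrite /eta; field; rewrite gt_eqF.
  lra.
have [E [mE LE EP]] := nbh S mS PiS.
have bE := @bmeas_indic R _ _ E mE; have bEC := @bmeas_indic R _ _ _ (measurableC mE).
have phiE x : E x -> phi x <= delta / 4.
  move=> /EP [x' Sx' xx'].
  (* For f = 1 + K 1_D the logarithm is ln(1 + K) 1_D, while the iterate of f at [x'] is at most 2
     because [phi x' <= eta]. The log-Harnack inequality then bounds ln(1 + K) [phi x] by 1 plus the
     cost, and ln K grows linearly in [u]. *)
  pose K := eta^-1; have K0 : 0 < K by rewrite invr_gt0.
  pose f y := 1 + K * \1_D y.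
  have bf : bmeas f by apply: bmeasD; [exact: bmeas_cst|exact: bmeasZ].
  have f1 y : 1 <= f y.
    have /andP[D0 _] := @indic_bounds R _ _ D y.
    by rewrite lerDl mulr_ge0// ltW.
  have := log_harnack cV cvxV h0 m ltr01 f1 bf x x'.
  have HE z := iter_el cV cvxV h0 m.+1 (point_el z).
  have -> : (fun y => ln (f y)) = (fun y => ln (1 + K) * \1_D y).
    apply/funext => y; rewrite /f; have [Dy|Dy] := pselect (D y).
      by rewrite indic_in// !mulr1.
    by rewrite indic_notin// !mulr0 addr0 ln1.
  have E1 := elZ (HE x) (ln (1 + K)) bD; cbv beta in E1; rewrite E1 -/(phi x).
  have E2 := elD (HE x') (bmeas_cst 1) (bmeasZ K bD).
  have E3 := el_cst (HE x') 1; have E4 := elZ (HE x') K bD; cbv beta in E2, E3, E4.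
  rewrite /f E2 E3 E4 -/(phi x').
  have l1 : ln (1 + K * phi x') <= 1.
    have Kp : 0 <= K * phi x' by rewrite mulr_ge0// ltW.
    have Kp1 : K * phi x' <= 1 by rewrite /K ler_pdivrMl// mulr1.
    by apply: le_trans (le_ln1Dx _) Kp1; lra.
  have hm : 0 < 2 * (h * m.+1%:R) by rewrite !mulr_gt0// ltr0n.
  have l2 : sqnorm (x - x') / (2 * (h * m.+1%:R)) <= q / (2 * (h * m.+1%:R)).
    by rewrite ler_pM2r// invr_gt0.
  have qh : 0 <= q / (2 * (h * m.+1%:R)) by rewrite divr_ge0// ltW.
  have l3 : 4 / delta * (1 + q / (2 * (h * m.+1%:R))) <= ln (1 + K).
    have : u - ln (64 / delta ^+ 3) <= ln (1 + K).
      have -> : u - ln (64 / delta ^+ 3) = ln K.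
        have c0 : 0 < 64 / delta ^+ 3 by rewrite divr_gt0// exprn_gt0.
        rewrite /K lnV ?posrE// /eta.
        rewrite [in RHS](@lnM _ (64 / delta ^+ 3)) ?posrE ?expR_gt0// expRK.
        by rewrite opprD opprK addrC.
      by rewrite ler_ln ?posrE ?lerDr// addr_gt0.
    apply: le_trans; rewrite lerBrDr; exact: cond.
  move=> H.
  have {}H : ln (1 + K) * phi x <= 1 + q / (2 * (h * m.+1%:R)).
    exact: le_trans H (lerD l1 l2).
  set r := 1 + q / (2 * (h * m.+1%:R)) in l3 H *.
  have r0 : 0 < r by rewrite /r ltr_pwDl.
  have d4 : 0 < 4 / delta by rewrite divr_gt0.
  have : 4 / delta * r * phi x <= r.
    by apply: le_trans H; apply: ler_wpM2r.
  have -> : 4 / delta * r * phi x = r * (4 / delta * phi x) by ring.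
  rewrite ger_pMr// => H2.
  have := ler_wpM2l (ltW d0) H2.
  have -> : delta * (4 / delta * phi x) = 4 * phi x by field; rewrite gt_eqF.
  by lra.
have HLm := iter_el cV cvxV h0 m.+1 HL.
have e : L (iter (m.+1 + m.+1) M \1_A) - Pi \1_A = L (iter m.+1 M (fun x => g x - p)).
  have E1 := elB HLm bg (bmeas_cst p); have E2 := el_cst HLm p; cbv beta in E1, E2.
  by rewrite E1 E2 /g -iterD.
rewrite e.
have h1 := el_norm HLm bgp; cbv beta in h1; apply: (le_trans h1).
have bc : bmeas (fun _ : 'rV[R]_d => delta / 4) by exact: bmeas_cst.
have h2 : L (iter m.+1 M (fun x => `|g x - p|)) <= delta / 4 + L phi.
  have E1 := elD HLm bc bD; have E2 := el_cst HLm (delta / 4); cbv beta in E1, E2.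
  rewrite -{1}E2 -E1; apply: (el_le HLm) => //; first exact: bmeasD.
  move=> x; have [Dx|Dx] := pselect (D x).
    rewrite indic_in//; have /andP[a1 a2] := g01 x; have /andP[a3 a4] := p01.
    have dd : 0 < delta / 4 by rewrite divr_gt0.
    by rewrite ler_norml; apply/andP; split; lra.
  by rewrite indic_notin// addr0 leNgt; apply/negP.
have h3 : L phi <= delta / 4 + L \1_(~` E).
  rewrite -[X in X + _](el_cst HL) -(elD HL)//; apply: (el_le HL) => //; first exact: bmeasD.
  move=> x; have [Ex|Ex] := pselect (E x).
    rewrite (indic_notin (A := ~` E)); last by move=> /(_ Ex).
    by rewrite addr0 phiE.
  rewrite indic_in//.
  have HE := iter_el cV cvxV h0 m.+1 (point_el x).
  have : phi x <= 1.
    by apply: (el_leC HE bD) => y; have /andP[] := @indic_bounds R _ _ D y.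
  have dd : 0 < delta / 4 by rewrite divr_gt0.
  by lra.
have h4 := el_indicC HL mE.
lra.
Qed.

Variables (L0 : ('rV[R]_d -> R) -> R) (HL0 : expectation_like L0).

(** The law is taken at time k + 1, so that the Lipschitz test functions reach [L0] in the form P g,
    with g Lipschitz, even when k = 0. The Poincare inequality of the initial law then bounds their
    initial variance by [C']. *)
Lemma mixing_window (C' delta : R) (k m : nat) :
  0 <= C' -> 0 < delta <= 1 ->
  (forall g, bmeas g ->
    variance_of L0 (P g) <= C' * L0 (fun x => sqnorm (grad (P g) x))) ->
  (forall A, measurable A -> `|L0 (iter k M \1_A) - Pi \1_A| <= 1 - delta) ->
  (4 / delta + 64 / delta ^+ 3) +
    64 / delta ^+ 3 * ((C' / h + 16 * k.+1%:R) / m.+1%:R) <= m.+1%:R / (1 + C / h) ->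
  forall A, measurable A -> `|L0 (iter (k.+1 + (m.+1 + m.+1)) M \1_A) - Pi \1_A| <= delta.
Proof.
move=> C'0 d01 poin0 tvk cond A mA; have /andP[d0 d1] := d01.
pose L f := L0 (iter k.+1 M f).
have HL : expectation_like L by exact: iter_el.
have HLk := iter_el cV cvxV h0 k HL0.
pose v := C' + 16 * h * k.+1%:R.
have k0 : 0 < k.+1%:R :> R by rewrite ltr0n.
have m0 : 0 < m.+1%:R :> R by rewrite ltr0n.
have v0 : 0 < v by rewrite ltr_wpDl// !mulr_gt0.
have varL f : bmeas f -> lip1 f -> variance_of L f <= v.
  move=> bf lf; apply: le_trans (iter_variance_lip1 cV cvxV h0 k.+1 HL0 bf lf) _.
  rewrite /v lerD2r iterS.
  have bi := bmeas_iter cV cvxV h0 k bf.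
  have li : lip1 (kern V h (iter k M f)).
    apply: kern_lip1 => //; elim: (k) => //= j IH.
    have bj := bmeas_iter cV cvxV h0 j bf.
    apply: kern_lip1 => //; [exact: continuous_V0|exact: convex_function0|exact: bmeas_kern|].
    exact: kern_lip1.
  have bQ := bmeas_kern cV cvxV h0 bi.
  apply: le_trans (poin0 _ bQ) _; rewrite -[leRHS]mulr1 ler_wpM2l//.
  have bsg := bmeas_sqnorm_grad h0 bQ.
  by apply: (el_leC HL0 bsg) => x; exact: kern0_grad_lip1.
have nbh S : measurable S -> 1 - delta / 4 <= Pi \1_S -> exists E, [/\ measurable E,
    1 - delta / 4 <= L \1_E &
    forall x, E x -> exists2 x', S x' & sqnorm (x - x') <= 32 * v / delta ^+ 2].
  move=> mS PS; apply: (variance_concentration HL v0 d01 mS _ varL).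
  have bS := @bmeas_indic R _ _ S mS; have bM := bmeas_step cV cvxV h0 bS.
  (* The total variation bound concerns time k, one step too early. From [S'] the chain enters [S]
     with probability at least 1/2; [S'] has [Pi]-mass at least 1 - delta / 2, hence mass at least
     delta / 2 at time k. *)
  pose S' := [set x | 2^-1 <= M \1_S x].
  have mS' : measurable S' by apply: measurable_ge_set; exact: bM.1.
  have bS' := @bmeas_indic R _ _ S' mS'.
  have MS01 x : 0 <= M \1_S x <= 1.
    have HE := step_el cV cvxV h0 x.
    apply/andP; split; [apply: (el_geC HE bS)|apply: (el_leC HE bS)] => y;
      by have /andP[] := @indic_bounds R _ _ S y.
  have h1 : 1 - delta / 2 <= Pi \1_S'.
    have : Pi (fun x => 2 * M \1_S x - 1) <= Pi \1_S'.
      apply: (el_le HPi) => //.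
        by apply: bmeasB; [exact: bmeasZ|exact: bmeas_cst].
      move=> x; have /andP[a1 a2] := MS01 x; have [Sx|Sx] := pselect (S' x).
        by rewrite indic_in//; lra.
      rewrite indic_notin//; move/negP: Sx; rewrite -ltNge; lra.
    rewrite (elB HPi); [|exact: bmeasZ|exact: bmeas_cst].
    by rewrite (elZ HPi)// (el_cst HPi) PiM//; lra.
  have h2 : delta / 2 <= L0 (iter k M \1_S').
    have := tvk S' mS'; rewrite ler_norml => /andP[h3 _]; lra.
  have : 2^-1 * L0 (iter k M \1_S') <= L \1_S.
    rewrite /L iterSr; have E1 := elZ HLk 2^-1 bS'; cbv beta in E1; rewrite -E1.
    apply: (el_le HLk) => //; first exact: bmeasZ.
    move=> x; have [Sx|Sx] := pselect (S' x); first by rewrite indic_in// mulr1.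
    by rewrite indic_notin// mulr0; have /andP[] := MS01 x.
  lra.
have q0 : 0 <= 32 * v / delta ^+ 2 by rewrite divr_ge0 ?sqr_ge0// mulr_ge0// ltW.
have := mixing_from_neighbourhoods HL d01 q0 nbh _ mA (m := m).
rewrite /L -iterD; apply; apply: le_trans cond.
have z0 : 0 < 64 / delta ^+ 3 by rewrite divr_gt0// exprn_gt0.
(* The logarithm is absorbed into the constant through ln z <= z. *)
have : ln (64 / delta ^+ 3) <= 64 / delta ^+ 3.
  have := @le_ln1Dx R (64 / delta ^+ 3 - 1); rewrite (addrC 1) subrK => H.
  by have := H ltac:(rewrite ltrBrDl subrr; exact: z0); lra.
have -> : 4 / delta * (1 + 32 * v / delta ^+ 2 / (2 * (h * m.+1%:R))) =
   4 / delta + 64 / delta ^+ 3 * ((C' / h + 16 * k.+1%:R) / m.+1%:R).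
  by rewrite /v; field; rewrite !gt_eqF.
by move=> lz; rewrite [leRHS]addrAC lerD2l.
Qed.

End mixing.

(** * Laws of the sampler *)

Section laws.
Context {R : realType} {d : nat} (V : 'rV[R]_d -> R) (h : R).
Hypotheses (cV : continuous V) (cvxV : convex_function setT V) (h0 : 0 < h).
Implicit Types (x y v : 'rV[R]_d) (f g : 'rV[R]_d -> R).
Notation leb := (@lebesgue_rV R d).
Local Notation V0 := (fun _ : 'rV[R]_d => 0 : R).
Local Notation P := (kern V0 h).
Local Notation Q := (kern V h).
Local Notation M := (proximal_step V h).
Local Notation N := (Num.sqrt (2 * pi * h) ^+ d : R).

Lemma Rintegral_indic dT (T : measurableType dT) (mu : probability T R) (A : set T) :
  measurable A -> (\int[mu]_x \1_A x)%R%:E = mu A.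
Proof.
move=> mA; rewrite /Rintegral integral_indic// setIT fineK//.
exact: fin_num_measure.
Qed.

Lemma integral_patch_indic (A : set 'rV[R]_d) (w : 'rV[R]_d -> R) : measurable A ->
  (\int[leb]_(x in A) (w x)%:E = \int[leb]_x (\1_A x * w x)%:E)%E.
Proof.
move=> mA; rewrite integral_mkcond; apply: eq_integral => x _.
rewrite patchE indicE; case: ifP => _; first by rewrite mul1r.
by rewrite mul0r.
Qed.

Lemma EFin_Rintegral (f : 'rV[R]_d -> R) : leb.-integrable setT (EFin \o f) ->
  ((\int[leb]_x f x)%R%:E = \int[leb]_x (f x)%:E)%E.
Proof. by move=> fi; rewrite fineK// integrable_fin_num. Qed.

Lemma backwardE y (A : set 'rV[R]_d) : measurable A ->
  backward V h y A = (Q \1_A y)%:E.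
Proof.
move=> mA; rewrite /backward integral_patch_indic//.
have i1 := integrable_weight cV cvxV h0 y (bmeas_indic mA).
have i2 := gauss_density_integrable (gauss_density_weight cV cvxV h0 y).
rewrite -(EFin_Rintegral i1) -(EFin_Rintegral i2) -massE kernE inver gt_eqF//.
exact: mass_gt0.
Qed.

Lemma gaussianE x (A : set 'rV[R]_d) : measurable A ->
  gaussian h x A = (P \1_A x)%:E.
Proof.
move=> mA; rewrite /gaussian integral_patch_indic// kern0E// EFinM /gconv.
have si : leb.-integrable setT (EFin \o (fun y => \1_A y * backward_weight V0 h x y)).
  by apply: subgauss_integrable => //; apply: bmeas_subgauss; exact: bmeas_indic.
rewrite (EFin_Rintegral si) -(integralZl measurableT si).
apply: eq_integral => y _; rewrite -EFinM; congr (_%:E).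
by rewrite /backward_weight oppr0 sub0r; ring.
Qed.

(** On the sure event the conditional laws become transition formulas for the marginal laws. *)
Lemma history_setT disp (Om : measurableType disp) (Pr : probability Om R)
  (X Y : nat -> {RV Pr >-> 'rV[R]_d}) a b : history X Y a b setT.
Proof. by rewrite -setC0; apply: sigma_algebraC; exact: sigma_algebra0. Qed.

Section sampler.
Context (disp : measure_display) (Om : measurableType disp) (Pr : probability Om R)
  (X Y : nat -> {RV Pr >-> 'rV[R]_d}) (mu0 : probability 'rV[R]_d R).
Hypothesis HXY : proximal_sampler X Y V mu0 h.

Let law (Z : {RV Pr >-> 'rV[R]_d}) f := \int[distribution Pr Z]_x f x.

Lemma integral_law (Z : {RV Pr >-> 'rV[R]_d}) f : bmeas f -> (forall x, 0 <= f x) ->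
  ((law Z f)%:E = \int[Pr]_w (f (Z w))%:E)%E.
Proof.
move=> [mf [K fK]] f0; rewrite /law /Rintegral fineK.
  rewrite ge0_integral_distribution//; first exact/measurable_EFinP.
apply: integrable_fin_num => //.
apply: (@le_integrable _ _ _ (distribution Pr Z) _ measurableT _ (EFin \o (fun=> K))).
- exact/measurable_EFinP.
- by move=> x _ /=; rewrite lee_fin (le_trans (fK x))// ler_norm.
- exact: (finite_measure_integrable_cst (distribution Pr Z) K measurableT).
Qed.

Lemma law_transition (Z W : {RV Pr >-> 'rV[R]_d}) (K : ('rV[R]_d -> R) -> 'rV[R]_d -> R) :
  (forall x, expectation_like (K ^~ x)) -> (forall f, bmeas f -> bmeas (K f)) ->
  (forall B, measurable B -> Pr (W @^-1` B) = (\int[Pr]_w (K \1_B (Z w))%:E)%E) ->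
  forall f, bmeas f -> law W f = law Z (K f).
Proof.
move=> EK bK H.
have EZ := expectation_like_Rintegral (distribution Pr Z).
have EW := expectation_like_Rintegral (distribution Pr W).
apply: expectation_like_eq => //; first exact: (expectation_like_comp EZ EK bK).
move=> B mB; have bB := @bmeas_indic R _ _ B mB.
apply: EFin_inj; rewrite (integral_law Z (bK _ bB)).
  by rewrite /law Rintegral_indic// -H.
move=> x; apply: (el_ge0 (EK x)) => // z; by have /andP[] := @indic_bounds R _ _ B z.
Qed.

Lemma law_step k f : bmeas f -> law (X k.+1) f = law (X k) (M f).
Proof.
move=> bf; have [_ HY HX] := HXY.
rewrite (law_transition (Z := Y k) (K := Q))//.
- rewrite (law_transition (Z := X k) (K := P))//.
  + exact: kern0_el.
  + move=> g; apply: bmeas_kern => //; [exact: continuous_V0|exact: convex_function0].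
  + move=> B mB; have := HY k setT B (@history_setT _ Om Pr X Y _ _) mB.
    rewrite setTI => ->; apply: eq_integral => w _; exact: gaussianE.
  + exact: bmeas_kern.
- exact: kern_el.
- by move=> g; exact: bmeas_kern.
- move=> B mB; have := HX k setT B (@history_setT _ Om Pr X Y _ _) mB.
  rewrite setTI => ->; apply: eq_integral => w _; exact: backwardE.
Qed.

Lemma law_iter k f : bmeas f -> law (X k) f = \int[mu0]_x (iter k M f x).
Proof.
elim: k f => [|k IH] f bf.
  have [H0 _ _] := HXY.
  apply: (expectation_like_eq (expectation_like_Rintegral _) (expectation_like_Rintegral _)) => // A mA.
  by apply: EFin_inj; rewrite !Rintegral_indic//; exact: H0.
rewrite law_step// IH ?iterSr//; exact: bmeas_step.
Qed.

Lemma tv_distanceP k (nu : probability 'rV[R]_d R) (e : R) :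
  (tv_distance (distribution Pr (X k)) nu <= e%:E)%E <->
  forall A, measurable A -> `|\int[mu0]_x (iter k M \1_A x) - \int[nu]_x \1_A x| <= e.
Proof.
have eA A : measurable A -> (`|distribution Pr (X k) A - nu A| =
    `|\int[mu0]_x (iter k M \1_A x) - \int[nu]_x \1_A x|%:E)%E.
  move=> mA; rewrite -!Rintegral_indic//.
  have -> : \int[distribution Pr (X k)]_x \1_A x = law (X k) \1_A by [].
  by rewrite law_iter//; exact: bmeas_indic.
split=> [H A mA|H].
  rewrite -lee_fin -eA//; apply: le_trans H.
  by apply: ereal_sup_ubound; exists A.
by apply: ge_ereal_sup => _ [A mA <-]; rewrite eA// lee_fin H.
Qed.

End sampler.

(** * Stationarity of the target *)

Section target.
Variable (p : probability 'rV[R]_d R).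
Hypothesis Hp : log_concave_with_potential V p.

Let dens x := expR (- V x).

Lemma measurable_dens : measurable_fun setT dens.
Proof. by apply: measurableT_comp => //; apply: measurableT_comp => //; exact: continuous_measurable_rV. Qed.

Lemma integrable_dens : leb.-integrable setT (EFin \o dens).
Proof.
have [_ _ H] := Hp; apply/integrableP; split.
  by apply/measurable_EFinP; exact: measurable_dens.
under eq_integral => x _ do rewrite /= ger0_norm ?expR_ge0//.
by rewrite -H// probability_setT ltry.
Qed.

Lemma integrable_bmeas_dens f : bmeas f -> leb.-integrable setT (EFin \o (fun x => f x * dens x)).
Proof.
move=> [mf [K fK]].
have := integrableZl measurableT K integrable_dens; apply: le_integrable => //.
  by apply/measurable_EFinP; apply: measurable_funM => //; exact: measurable_dens.
move=> x _ /=; rewrite lee_fin normrM [X in _ <= X]ger0_norm.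
  by rewrite (ger0_norm (expR_ge0 _)) ler_wpM2r ?expR_ge0.
by rewrite mulr_ge0 ?expR_ge0// (le_trans _ (fK x)).
Qed.

Lemma target_density f : bmeas f -> \int[p]_x f x = \int[leb]_x (f x * dens x).
Proof.
apply: (expectation_like_eq (L1 := fun f => \int[p]_x f x)
  (L2 := fun f => \int[leb]_x (f x * dens x))); first exact: expectation_like_Rintegral.
  split.
  - move=> a b f1 f2 b1 b2.
    under eq_Rintegral => x _ do rewrite mulrDl -!mulrA.
    have iZ c u : bmeas u -> leb.-integrable setT (EFin \o (fun x => c * (u x * dens x))).
      move=> bu; have := integrableZl measurableT c (integrable_bmeas_dens bu).
      by apply: eq_integrable.
    rewrite RintegralD//; try exact: iZ.
    by rewrite !RintegralZl//; exact: integrable_bmeas_dens.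
  - move=> f1 f2 b1 b2 f12; apply: le_Rintegral => //; try exact: integrable_bmeas_dens.
    by move=> x _; rewrite ler_wpM2r ?expR_ge0.
  - under eq_Rintegral => x _ do rewrite mul1r.
    have [_ _ H] := Hp; apply: EFin_inj.
    by rewrite EFin_Rintegral ?integrable_dens// -H// probability_setT.
move=> A mA; have [_ _ H] := Hp; apply: EFin_inj.
rewrite Rintegral_indic// H// integral_patch_indic// EFin_Rintegral//.
by apply: integrable_bmeas_dens; exact: bmeas_indic.
Qed.

Let W (z : 'rV[R]_d * 'rV[R]_d) : R := backward_weight V h z.2 z.1.

Lemma measurable_W : measurable_fun setT W.
Proof.
apply: measurableT_comp => //; apply: measurable_funB.
  apply: measurableT_comp => //; apply: measurableT_comp => //.
  exact: continuous_measurable_rV.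
apply: measurable_funM => //; rewrite /sqnorm; apply: measurable_sum => i.
apply: measurable_funX; under eq_fun do rewrite !mxE.
apply: measurable_funB; exact: measurableT_comp (measurable_coord_rV i) _.
Qed.

(** The joint density of a point and its Gaussian perturbation read in both orders: the symmetry
    behind stationarity. *)
Lemma weight_swap x y : backward_weight V h y x = dens x * backward_weight V0 h x y.
Proof.
rewrite /backward_weight /dens -expRD oppr0 sub0r; congr expR.
by rewrite sqnormBC.
Qed.

(* Both sides equal [N^-1 int int 1_A(x) exp(- V x - |x - y|^2 / 2h) dx dy]. *)
Lemma target_stationary f : bmeas f -> \int[p]_x (M f x) = \int[p]_x f x.
Proof.
have Ep := expectation_like_Rintegral p.
apply: (expectation_like_eq (L1 := fun f => \int[p]_x (M f x))
  (L2 := fun f => \int[p]_x f x)) => //.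
  exact: (expectation_like_comp Ep (step_el cV cvxV h0) (bmeas_step cV cvxV h0)).
move=> A mA; have bA := @bmeas_indic R _ _ A mA.
have bQ := bmeas_kern cV cvxV h0 bA.
have bM := bmeas_step cV cvxV h0 bA.
have N0 : 0 < N by exact: gauss_const_gt0.
have Q0 y : 0 <= Q \1_A y.
  by apply: (el_ge0 (kern_el cV cvxV h0 y) bA) => z; have /andP[] := @indic_bounds R _ _ A z.
rewrite !target_density//; apply: EFin_inj.
rewrite !EFin_Rintegral; try exact: integrable_bmeas_dens.
have A0 x : 0 <= (\1_A x : R) by have /andP[] := @indic_bounds R _ _ A x.
have W0 z : 0 <= W z by exact: expR_ge0.
transitivity (\int[leb]_x \int[leb]_y (N^-1 * Q \1_A y * W (x, y))%:E)%E.
  apply: eq_integral => x _; rewrite /proximal_step kern0E// /gconv.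
  have i1 : leb.-integrable setT (EFin \o (fun y => Q \1_A y * backward_weight V0 h x y)).
    by apply: subgauss_integrable => //; exact: bmeas_subgauss.
  rewrite mulrAC EFinM (EFin_Rintegral i1) -(integralZl measurableT i1).
  by apply: eq_integral => y _; rewrite -EFinM /W /= weight_swap; congr (_%:E); ring.
have mF : measurable_fun setT (fun z => (N^-1 * Q \1_A z.2 * W z)%:E).
  apply/measurable_EFinP; apply: measurable_funM; last exact: measurable_W.
  apply: measurable_funM => //; apply: measurableT_comp => //; exact: bQ.1.
have F0 z : (0 <= (N^-1 * Q \1_A z.2 * W z)%:E)%E.
  by rewrite lee_fin mulr_ge0// mulr_ge0// invr_ge0 ltW.
apply: etrans (@fubini_tonelli _ _ _ _ _ leb leb _ mF F0) _ => /=.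
transitivity (\int[leb]_y \int[leb]_x (N^-1 * \1_A x * W (x, y))%:E)%E.
  apply: eq_integral => y _.
  have iw : leb.-integrable setT (EFin \o backward_weight V h y).
    exact/gauss_density_integrable/gauss_density_weight.
  have iA := integrable_weight cV cvxV h0 y bA.
  transitivity ((N^-1 * Q \1_A y)%:E * \int[leb]_x (backward_weight V h y x)%:E)%E.
    by rewrite -(integralZl measurableT iw).
  have -> : (\int[leb]_x (backward_weight V h y x)%:E = (mass V h y)%:E)%E.
    by rewrite massE EFin_Rintegral.
  rewrite -EFinM -[X in X%:E]mulrA -(kern_mass cV cvxV h0) EFinM (EFin_Rintegral iA).
  rewrite -(integralZl measurableT iA); apply: eq_integral => x _.
  by rewrite -EFinM mulrA.
have mG : measurable_fun setT (fun z => (N^-1 * \1_A z.1 * W z)%:E).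
  apply/measurable_EFinP; apply: measurable_funM; last exact: measurable_W.
  apply: measurable_funM => //; apply: measurableT_comp => //; exact: bA.1.
have G0 z : (0 <= (N^-1 * \1_A z.1 * W z)%:E)%E.
  by rewrite lee_fin mulr_ge0// mulr_ge0// invr_ge0 ltW.
apply: etrans (esym (@fubini_tonelli _ _ _ _ _ leb leb _ mG G0)) _ => /=.
apply: eq_integral => x _.
have i0 : leb.-integrable setT (EFin \o backward_weight V0 h x).
  apply/gauss_density_integrable/gauss_density_weight => //; [exact: continuous_V0|exact: convex_function0].
transitivity ((N^-1 * \1_A x * dens x)%:E * \int[leb]_y (backward_weight V0 h x y)%:E)%E.
  rewrite -(integralZl measurableT i0); apply: eq_integral => y _.
  by rewrite -EFinM /W /= weight_swap mulrA.
have -> : (\int[leb]_y (backward_weight V0 h x y)%:E = N%:E)%E.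
  by rewrite -(EFin_Rintegral i0) -massE gmass.
rewrite -EFinM; congr (_%:E).
by field; rewrite gt_eqF.
Qed.

End target.

End laws.

(** * Poincare constants and mixing times *)

Section poincare_constants.
Context {R : realType} {d : nat} (mu : probability 'rV[R]_d R).
Implicit Types f g : 'rV[R]_d -> R.
Local Notation L := (fun f => \int[mu]_x f x).

Lemma bmeas_integrable f : bmeas f -> mu.-integrable setT (EFin \o f).
Proof.
move=> [mf [K fK]]; apply: (@le_integrable _ _ _ mu _ measurableT _ (EFin \o (fun=> K))).
- exact/measurable_EFinP.
- by move=> x _ /=; rewrite lee_fin (le_trans (fK x))// ler_norm.
- exact: (finite_measure_integrable_cst mu K measurableT).
Qed.

Lemma expectation_bmeas f : bmeas f -> ('E_mu[f] = (L f)%:E)%E.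
Proof.
move=> bf; rewrite unlock /Rintegral fineK//.
by apply: integrable_fin_num => //; exact: bmeas_integrable.
Qed.

Lemma variance_bmeas f : bmeas f -> ('V_mu[f] = (variance_of L f)%:E)%E.
Proof.
move=> bf; have HL := expectation_like_Rintegral mu.
have bg : bmeas (fun x => (f x - L f) ^+ 2).
  by apply: bmeasX; apply: bmeasB => //; exact: bmeas_cst.
have := variance_shift HL (L f) bf; rewrite subrr expr0n addr0 => <-.
rewrite -expectation_bmeas// /variance covariance.unlock (expectation_bmeas bf)/=.
by congr (expectation mu _); apply/funext => x.
Qed.

Lemma poincare_constant_ge0 : (0 <= poincare_constant mu)%E.
Proof. by apply/ereal_infP => _ [C [C0 _] <-]; rewrite lee_fin. Qed.

Lemma poincare_approx (r e : R) : 0 < e -> poincare_constant mu = r%:E ->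
  exists C, [/\ 0 <= C, C <= r + e & forall f, smooth f -> bmeas f ->
    bmeas (fun x => sqnorm (grad f x)) ->
    variance_of L f <= C * L (fun x => sqnorm (grad f x))].
Proof.
move=> e0 pr.
have fr : poincare_constant mu \is a fin_num by rewrite pr.
have [_ [C [C0 HC] <-]] := lb_ereal_inf_adherent e0 fr.
rewrite -/(poincare_constant mu) pr -EFinD lte_fin => Cr.
exists C; split => //; first exact: ltW.
move=> f sf bf bg; have := HC f sf; rewrite variance_bmeas//.
have -> : (\int[mu]_x (sqnorm (grad f x))%:E = (L (fun x => sqnorm (grad f x)))%:E)%E.
  rewrite /Rintegral fineK//; apply: integrable_fin_num => //; exact: bmeas_integrable.
by rewrite -EFinM lee_fin.
Qed.

Lemma normalized_poincare_cases (h : R) : 0 < h ->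
  (normalized_poincare h mu = +oo)%E \/
  exists r, [/\ 0 <= r, poincare_constant mu = r%:E & normalized_poincare h mu = (1 + r / h)%:E].
Proof.
move=> h0; rewrite /normalized_poincare; have := poincare_constant_ge0.
case: (poincare_constant mu) => [r r0|_|//]; last first.
  by left; rewrite inver gt_eqF// gt0_mulye ?lte_fin ?invr_gt0.
by right; exists r; rewrite lee_fin in r0; split=> //; rewrite inver gt_eqF.
Qed.

End poincare_constants.

Section mixing_times.
Context {R : realType} {dT : measure_display} {T : measurableType dT}
  (mu : nat -> probability T R) (nu : probability T R).
Local Open Scope ereal_scope.

Lemma mixing_time_attained (e : R) k : tv_distance (mu k) nu <= e%:E ->
  exists j : nat, [/\ mixing_time mu nu e = (j%:R)%:E, tv_distance (mu j) nu <= e%:E & (j <= k)%N].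
Proof.
move=> H; have ex : exists j, `[< tv_distance (mu j) nu <= e%:E >] by exists k; apply/asboolP.
have [j /asboolP Hj jmin] := ex_minnP ex.
exists j; split => //; last by apply: jmin; exact/asboolP.
apply/eqP; rewrite eq_le; apply/andP; split.
  by apply: ereal_inf_lbound; exists j.
apply/ereal_infP => _ [i Hi <-]; rewrite lee_fin ler_nat.
by apply: jmin; exact/asboolP.
Qed.

Lemma mixing_time_le (e : R) k : tv_distance (mu k) nu <= e%:E ->
  mixing_time mu nu e <= (k%:R)%:E.
Proof. by move=> H; apply: ereal_inf_lbound; exists k. Qed.

Lemma mixing_time_nonincreasing (e e' : R) : (e <= e')%R ->
  mixing_time mu nu e' <= mixing_time mu nu e.
Proof.
move=> ee; apply/ereal_infP => _ [k Hk <-]; apply: mixing_time_le.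
by apply: le_trans Hk _; rewrite lee_fin.
Qed.

End mixing_times.

(** * Mixing of the sampler in total variation *)

Section sampler_mixing.
Context {R : realType} {d : nat} (V : 'rV[R]_d -> R) (p mu0 : probability 'rV[R]_d R)
  (h : R) (disp : measure_display) (Om : measurableType disp) (Pr : probability Om R)
  (X Y : nat -> {RV Pr >-> 'rV[R]_d}).
Hypotheses (Hp : log_concave_with_potential V p) (h0 : 0 < h)
  (HXY : proximal_sampler X Y V mu0 h).
Local Notation tv k := (tv_distance (distribution Pr (X k)) p).
Local Notation V0 := (fun _ : 'rV[R]_d => 0 : R).
Local Notation P := (kern V0 h).

Let cV : continuous V. Proof. by have [+ _ _] := Hp; exact: class_C_continuous. Qed.
Let cvxV : convex_function setT V. Proof. by have [_ + _] := Hp. Qed.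

(** The constant is an infimum, so an admissible [C] is taken slightly above it. The slack h raises
    C / h by at most 1, which explains the 2 (1 + r / h) and the 1 + r0 / h in [tv_window]. *)
Lemma poincare_smoothed (mu : probability 'rV[R]_d R) (r : R) :
  poincare_constant mu = r%:E -> exists C, [/\ 0 <= C, C <= r + h & forall g, bmeas g ->
    variance_of (fun f => \int[mu]_x f x) (P g) <= C * \int[mu]_x sqnorm (grad (P g) x)].
Proof.
move=> /(poincare_approx h0) [C [C0 Cr HC]]; exists C; split => // g bg.
apply: HC; first exact: smooth_kern0.
  apply: bmeas_kern => //; [exact: continuous_V0|exact: convex_function0].
exact: bmeas_sqnorm_grad.
Qed.

Lemma tv_window (r r0 delta : R) (k m : nat) :
  0 <= r -> poincare_constant p = r%:E -> 0 <= r0 -> poincare_constant mu0 = r0%:E ->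
  0 < delta < 1 -> (tv k <= (1 - delta)%:E)%E ->
  (4 / delta + 64 / delta ^+ 3) +
    64 / delta ^+ 3 * (((1 + r0 / h) + 16 * k.+1%:R) / m.+1%:R) <=
    m.+1%:R / (2 * (1 + r / h)) ->
  (tv (k.+1 + (m.+1 + m.+1))%N <= delta%:E)%E.
Proof.
move=> rp pr r0p pr0 /andP[d0 d1] tvk cond.
have [C [C0 Cr HC]] := poincare_smoothed pr.
have [C' [C'0 C'r HC']] := poincare_smoothed pr0.
apply/(tv_distanceP cV cvxV h0 HXY) => A mA.
move/(tv_distanceP cV cvxV h0 HXY) : tvk => tvk.
have d01 : 0 < delta <= 1 by rewrite d0 ltW.
apply: (mixing_window cV cvxV h0 (expectation_like_Rintegral p) C0
  (target_stationary cV cvxV h0 Hp) HC (expectation_like_Rintegral mu0) C'0 d01 HC' tvk _ mA).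
have c1 z z' : z <= z' + h -> z / h <= 1 + z' / h.
  by move=> H; rewrite ler_pdivrMr// mulrDl mul1r divfK ?gt_eqF// addrC.
have Ch := c1 _ _ Cr; have C'h := c1 _ _ C'r.
have rh : 0 <= r / h by rewrite divr_ge0// ltW.
have Ch0 : 0 <= C / h by rewrite divr_ge0// ltW.
have m0 : 0 < m.+1%:R :> R by rewrite ltr0n.
have b0 : 0 < 64 / delta ^+ 3 by rewrite divr_gt0// exprn_gt0.
apply: (@le_trans _ _ (m.+1%:R / (2 * (1 + r / h)))).
  apply: le_trans cond; rewrite lerD2l ler_wpM2l ?(ltW b0)//.
  by rewrite ler_pM2r ?invr_gt0// lerD2r.
rewrite ler_pM2l// lef_pV2 ?posrE; [|lra|lra].
have : 0 <= r0 / h by rewrite divr_ge0// ltW.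
lra.
Qed.

Lemma ball_exhaustion (mu : probability 'rV[R]_d R) (c : R) : c < 1 ->
  exists r : R, 0 <= r /\ forall s, r <= s -> c <= \int[mu]_x \1_[set x | sqnorm x <= s] x.
Proof.
move=> c1; have b1 : bmeas (fun _ : 'rV[R]_d => 1 : R) by exact: bmeas_cst.
have mB (s : R) : measurable [set x : 'rV[R]_d | sqnorm x <= s].
  by apply: measurable_le_set; exact: measurable_sqnorm.
have HL := expectation_like_Rintegral mu.
have := cvg_Rintegral_set (A := fun n => [set x : 'rV[R]_d | sqnorm x <= n%:R]) (B := setT)
  (bmeas_integrable mu b1) (fun n => mB _) measurableT.
have -> : \int[mu]_(x in setT) 1 = 1 :> R by exact: (el_one HL).
move=> H.
have cv : (fun n : nat => \int[mu]_(x in [set x : 'rV[R]_d | sqnorm x <= n%:R]) (1 : R)) @ \oo --> (1 : R).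
  apply: H => x; near=> n; split => // _ /=; near: n; exact: nbhs_infty_ger.
have [n _ Hn] := cvgr_gt _ cv _ c1.
exists n%:R; split => // s ns.
have := Hn n (leqnn n) => /= /ltW /le_trans; apply.
rewrite Rintegral_mkcond; apply: le_Rintegral => //.
- have := bmeas_integrable mu (bmeas_indic (mB n%:R)); apply: eq_integrable => // x _.
  by rewrite /= patchE indicE; case: ifP.
- exact: (bmeas_integrable mu (bmeas_indic (mB s))).
- move=> x _; rewrite patchE; case: ifP => xn; last by have /andP[] := @indic_bounds R _ _ [set x | sqnorm x <= s] x.
  rewrite indic_in//=; move: xn; rewrite inE /= => xn; exact: le_trans ns.
Unshelve. all: end_near. Qed.

(** Mixing times are finite for an arbitrary initial law. A ball charged enough by both measures
    meets every [S] of large target mass, so all its points are within its diameter of [S]; this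
    replaces concentration. *)
Lemma tv_finite (r delta : R) : poincare_constant p = r%:E -> 0 < delta < 1 ->
  exists k, (tv k <= delta%:E)%E.
Proof.
move=> pr /andP[d0 d1].
have d01 : 0 < delta <= 1 by rewrite d0 ltW.
have [C [C0 Cr HC]] := poincare_smoothed pr.
have [s1 [s10 Hs1]] := @ball_exhaustion p 2^-1 ltac:(lra).
have [s2 [s20 Hs2]] := @ball_exhaustion mu0 (1 - delta / 4) ltac:(lra).
pose s := s1 + s2.
pose B := [set x : 'rV[R]_d | sqnorm x <= s].
have mB : measurable B by apply: measurable_le_set; exact: measurable_sqnorm.
have B1 : 2^-1 <= \int[p]_x \1_B x by apply: Hs1; rewrite /s; lra.
have B2 : 1 - delta / 4 <= \int[mu0]_x \1_B x by apply: Hs2; rewrite /s; lra.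
pose q := 4 * s.
have q0 : 0 <= q by rewrite /q /s; lra.
have Ep := expectation_like_Rintegral p.
have nbh S : measurable S -> 1 - delta / 4 <= \int[p]_x \1_S x -> exists E, [/\ measurable E,
    1 - delta / 4 <= \int[mu0]_x \1_E x &
    forall x, E x -> exists2 x', S x' & sqnorm (x - x') <= q].
  move=> mS PS; exists B; split => // x Bx.
  suff [z Sz Bz] : exists2 z, S z & B z.
    exists z => //; have := sqnorm_le2 (x - z) (- z); rewrite opprK subrK sqnormN.
    by rewrite /B /= in Bx Bz *; rewrite /q; lra.
  apply: contrapT => nz.
  have bS := @bmeas_indic R _ _ S mS; have bB := @bmeas_indic R _ _ B mB.
  have := el_le Ep (bmeasD bS bB) (bmeas_cst 1); rewrite (elD Ep bS bB) (el_cst Ep).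
  move=> H; have : \int[p]_x \1_S x + \int[p]_x \1_B x <= 1.
    apply: H => x'; have /andP[_ a1] := @indic_bounds R _ _ S x'.
    have /andP[_ a2] := @indic_bounds R _ _ B x'.
    have [Sx|Sx] := pselect (S x'); last by rewrite indic_notin// add0r.
    rewrite (indic_notin (A := B)) ?addr0// => Bx'; apply: nz; by exists x'.
  lra.
pose K := 1 + C / h.
have K1 : 1 <= K by rewrite lerDl divr_ge0// ltW.
have K0 : 0 < K by exact: lt_le_trans K1.
pose z := 4 / delta * (1 + q / (2 * h)) + ln (64 / delta ^+ 3).
pose m := Num.truncn (z * K).
have mz : z <= m.+1%:R / K by rewrite ler_pdivlMr// ltW// truncnS_gt.
exists (m.+1 + m.+1)%N.
apply/(tv_distanceP cV cvxV h0 HXY) => A mA.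
apply: (mixing_from_neighbourhoods cV cvxV h0 Ep C0
  (target_stationary cV cvxV h0 Hp) HC (expectation_like_Rintegral mu0) d01 q0 nbh _ mA).
apply: le_trans mz; rewrite /z lerD2r ler_wpM2l ?divr_ge0 ?(ltW d0)// lerD2l.
rewrite ler_wpM2l// lef_pV2 ?posrE ?mulr_gt0// ?ltr0n//.
by rewrite ler_pM2l// ler_peMr ?(ltW h0)// ler1n.
Qed.

End sampler_mixing.

(** * Cutoff *)

Section cutoff.
Context {R : realType} {d : nat} (V : 'rV[R]_d -> R) (p mu0 : probability 'rV[R]_d R)
  (h : R) (disp : measure_display) (Om : measurableType disp) (Pr : probability Om R)
  (X Y : nat -> {RV Pr >-> 'rV[R]_d}).
Hypotheses (Hp : log_concave_with_potential V p) (h0 : 0 < h)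
  (HXY : proximal_sampler X Y V mu0 h).
Local Notation tv k := (tv_distance (distribution Pr (X k)) p).

(** Collects 3 + 2 x for x = 4 a W + 2 (1 + b) (5 W + 4 Q), where a = 4 / delta + 64 / delta^3, b =
    64 / delta^3, Q = sqrt(W k) and W >= 1. *)
Definition window_const (delta : R) : R :=
  3 + 8 * (4 / delta + 64 / delta ^+ 3) + 20 * (1 + 64 / delta ^+ 3).

Lemma window_const_ge0 (delta : R) : 0 < delta -> 0 <= window_const delta.
Proof.
move=> d0; have : 0 < 64 / delta ^+ 3 by rewrite divr_gt0// exprn_gt0.
have : 0 < 4 / delta by rewrite divr_gt0.
by rewrite /window_const; lra.
Qed.

Lemma mixing_time_window (r r0 delta : R) (k : nat) :
  let W := (1 + r / h) + Num.sqrt ((1 + r / h) * (1 + r0 / h)) in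
  0 <= r -> poincare_constant p = r%:E -> 0 <= r0 -> poincare_constant mu0 = r0%:E ->
  0 < delta < 1 -> (tv k <= (1 - delta)%:E)%E ->
  exists2 j : nat, (tv j <= delta%:E)%E &
    j%:R <= k%:R + window_const delta * (W + Num.sqrt (W * k%:R)).
Proof.
move=> W rp pr r0p pr0 d01 tvk; have /andP[d0 d1] := d01.
pose a := 4 / delta + 64 / delta ^+ 3; pose b := 64 / delta ^+ 3.
have b0 : 0 < b by rewrite divr_gt0// exprn_gt0.
have a0 : 0 < a by rewrite addr_gt0// divr_gt0.
set K := 1 + r / h in W *; set K0 := 1 + r0 / h in W *.
have K1 : 1 <= K by rewrite lerDl divr_ge0// ltW.
have K01 : 1 <= K0 by rewrite lerDl divr_ge0// ltW.
have Kp : 0 < K by exact: lt_le_trans K1.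
have K0p : 0 < K0 by exact: lt_le_trans K01.
have kp : 0 <= k%:R :> R by exact: ler0n.
pose w := K0 + 16 * k.+1%:R.
have w0 : 0 < w by rewrite addr_gt0// mulr_gt0// ltr0n.
pose S := Num.sqrt (K * w).
have S0 : 0 <= S by exact: sqrtr_ge0.
have S2 : S ^+ 2 = K * w by rewrite sqr_sqrtr// mulr_ge0// ltW.
(* The condition on n = m + 1 reads 2 a K n + 2 b S^2 <= n^2: the first term of [x] pays for one
   half of n^2, the second for the other. *)
pose x := 4 * a * K + 2 * (1 + b) * S.
have aK : 0 <= 4 * a * K by rewrite !mulr_ge0// ltW.
have bS : 0 <= 2 * (1 + b) * S by rewrite !mulr_ge0// addr_ge0// ltW.
have x0 : 0 <= x by rewrite addr_ge0.
pose m := Num.truncn x.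
have mx : m%:R <= x by rewrite truncn_le.
have xm : x < m.+1%:R by exact: truncnS_gt.
exists (k.+1 + (m.+1 + m.+1))%N.
  apply: (tv_window Hp h0 HXY rp pr r0p pr0 d01 tvk).
  rewrite -/a -/b -/K -/K0 -/w.
  have n0 : 0 < m.+1%:R :> R by rewrite ltr0n.
  move: xm n0; rewrite /x; move: (m.+1%:R : R) => n xn n0.
  rewrite ler_pdivlMr; last by rewrite mulr_gt0.
  rewrite -(ler_pM2r n0).
  have -> : (a + b * (w / n)) * (2 * K) * n = 2 * a * K * n + 2 * b * (K * w).
    by field; rewrite gt_eqF.
  rewrite -S2.
  have h1 : 4 * a * K * n <= n * n by apply: ler_wpM2r; [exact: ltW|lra].
  have h2 : (2 * (1 + b) * S) ^+ 2 <= n ^+ 2.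
    by rewrite ler_pXn2r ?nnegrE//; [lra|exact: ltW].
  have h3 : b * S ^+ 2 <= (1 + b) ^+ 2 * S ^+ 2.
    by apply: ler_wpM2r; [exact: sqr_ge0|nra].
  have : (2 * (1 + b) * S) ^+ 2 = 4 * ((1 + b) ^+ 2 * S ^+ 2) by ring.
  move=> e; rewrite e in h2; rewrite expr2 in h2; lra.
have sK : K <= W by rewrite lerDl sqrtr_ge0.
have sKK : Num.sqrt (K * K0) <= W by rewrite lerDr ltW.
have W0 : 0 < W by exact: lt_le_trans sK.
pose Q := Num.sqrt (W * k%:R).
have Q0 : 0 <= Q by exact: sqrtr_ge0.
have Q2 : Q ^+ 2 = W * k%:R by rewrite sqr_sqrtr// mulr_ge0// ltW.
have SW : S <= 5 * W + 4 * Q.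
  have W5 : 0 <= 5 * W + 4 * Q by lra.
  rewrite -(@ler_pXn2r _ 2)// S2 /w -(natr1 k).
  have KK0 : K * K0 <= W ^+ 2.
    have KK : 0 <= K * K0 by rewrite mulr_ge0// ltW.
    by rewrite -[leLHS](sqr_sqrtr KK) ler_pXn2r// ?nnegrE ?sqrtr_ge0// ltW.
  have KW2 : K <= W ^+ 2.
    apply: (le_trans sK); rewrite expr2 ler_peMl//; [exact: ltW|exact: le_trans sK].
  have Kk : K * k%:R <= Q ^+ 2 by rewrite Q2 ler_wpM2r.
  have WQ : 0 <= W * Q by rewrite mulr_ge0// ltW.
  have -> : (5 * W + 4 * Q) ^+ 2 = 25 * W ^+ 2 + 40 * (W * Q) + 16 * Q ^+ 2 by ring.
  have -> : K * (K0 + 16 * (k%:R + 1)) = K * K0 + 16 * (K * k%:R) + 16 * K by ring.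
  have W2 : 0 <= W ^+ 2 by exact: sqr_ge0.
  by lra.
rewrite -/Q.
have -> : (k.+1 + (m.+1 + m.+1))%:R = k%:R + (3 + 2 * m%:R) :> R.
  by rewrite -(addn1 k) -(addn1 m) !natrD; ring.
rewrite lerD2l; apply: (@le_trans _ _ (3 + 2 * x)); first lra.
have W1 : 1 <= W by exact: le_trans sK.
have xle : x <= 4 * a * W + 2 * (1 + b) * (5 * W + 4 * Q).
  apply: lerD; first by rewrite ler_wpM2l// mulr_ge0// ltW.
  by rewrite ler_wpM2l// mulr_ge0// addr_ge0// ltW.
rewrite /window_const -/a -/b.
have bQ : 0 <= b * Q by rewrite mulr_ge0// ltW.
have aQ : 0 <= a * Q by rewrite mulr_ge0// ltW.
lra.
Qed.

End cutoff.

(** If k < L^2 W, then sqrt(W k) <= L W and t <= (L^2 + B + B L) W, a contradiction. So k >= L^2 W,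
    both L W and L sqrt(W k) are at most k, and the window is at most 2 B k / L. *)
Lemma window_negligible (R : realType) (B W k t L : R) :
  0 <= B -> 1 <= W -> 0 <= k -> 1 <= L -> t <= k + B * (W + Num.sqrt (W * k)) ->
  (L ^+ 2 + B + B * L) * W < t -> 0 < k /\ t <= (1 + 2 * B / L) * k.
Proof.
move=> B0 W1 k0 L1 tk tW.
have W0 : 0 < W by exact: lt_le_trans W1.
have L0 : 0 < L by exact: lt_le_trans L1.
set Q := Num.sqrt (W * k) in tk.
have Q0 : 0 <= Q by exact: sqrtr_ge0.
have Q2 : Q ^+ 2 = W * k by rewrite sqr_sqrtr// mulr_ge0// ltW.
have kL : L ^+ 2 * W <= k.
  rewrite leNgt; apply/negP => kW.
  have QL : Q <= L * W.
    have LW : 0 <= L * W by rewrite mulr_ge0// ltW.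
    rewrite -(@ler_pXn2r _ 2)// Q2 exprMn.
    have := ler_wpM2l (ltW W0) (ltW kW); lra.
  have := ler_wpM2l B0 QL; lra.
have L2 : 0 < L ^+ 2 by rewrite exprn_gt0.
have kp : 0 < k by apply: lt_le_trans kL; rewrite mulr_gt0.
split => //.
have LQ : L * Q <= k.
  have LQ0 : 0 <= L * Q by rewrite mulr_ge0// ltW.
  by rewrite -(@ler_pXn2r _ 2)// exprMn Q2 mulrA expr2 ler_wpM2r.
have LW : L * W <= k.
  by apply: le_trans kL; rewrite expr2 -mulrA ler_peMl// mulr_ge0// ltW.
apply: (le_trans tk); rewrite mulrDl mul1r lerD2l mulrAC ler_pdivlMr//.
have : B * (L * W + L * Q) <= B * (k + k) by apply: ler_wpM2l => //; exact: lerD.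
lra.
Qed.

Section ratio.
Context {R : realType} {d : nat} (V : 'rV[R]_d -> R) (p mu0 : probability 'rV[R]_d R)
  (h : R) (disp : measure_display) (Om : measurableType disp) (Pr : probability Om R)
  (X Y : nat -> {RV Pr >-> 'rV[R]_d}).
Hypotheses (Hp : log_concave_with_potential V p) (h0 : 0 < h)
  (HXY : proximal_sampler X Y V mu0 h).
Local Notation tmix e := (mixing_time (fun k => distribution Pr (X k)) p e).
Local Notation C mu := (normalized_poincare h mu).

(** [delta] is small enough that the times at eps and 1 - eps both lie between those at 1 - delta
    and delta, and that the lower bound at eps0 passes to delta. [L] makes 2 B / L at most eta. *)
Lemma mixing_time_ratio (eps0 eps eta : R) : 0 < eps0 < 1 -> 0 < eps < 1 -> 0 < eta ->
  let delta := Num.min eps (Num.min (1 - eps) eps0) in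
  let B := window_const delta in let L := 1 + 2 * B / eta in
  ((L ^+ 2 + B + B * L)%:E < tmix eps0 / (C p + sqrte (C p * C mu0)))%E ->
  exists2 q : R, (tmix (1 - eps)%R / tmix eps = q%:E)%E & `|1 - q| <= eta.
Proof.
move=> /andP[e0 e1] /andP[f0 f1] t0 delta B L.
have d0 : 0 < delta by rewrite !lt_min; apply/and3P; split; lra.
have de : delta <= eps by rewrite ge_min lexx.
have de1 : delta <= 1 - eps by rewrite !ge_min lexx orbT.
have de0 : delta <= eps0 by rewrite !ge_min lexx !orbT.
have d1 : delta < 1 by exact: le_lt_trans f1.
have d01 : 0 < delta < 1 by rewrite d0.
have B0 : 0 <= B by exact: window_const_ge0.
have L1 : 1 <= L by rewrite lerDl divr_ge0 ?mulr_ge0// ltW.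
have LB : 2 * B / L <= eta.
  have L0 : 0 < L by exact: lt_le_trans L1.
  rewrite ler_pdivrMr//; have -> : eta * L = eta + 2 * B by rewrite /L; field; rewrite gt_eqF.
  by rewrite lerDr ltW.
set A := L ^+ 2 + B + B * L.
have A0 : 0 <= A.
  have BL : 0 <= B * L by rewrite mulr_ge0//; exact: le_trans L1.
  by apply: addr_ge0 => //; apply: addr_ge0 => //; exact: sqr_ge0.
(* An infinite Poincare constant, here of the target and below of the initial law, makes the
   quotient 0, against its lower bound. *)
have [->|[r [rp pr ->]]] := normalized_poincare_cases p h0.
  rewrite addye; last by rewrite gt_eqF// (lt_le_trans _ (sqrte_ge0 _)).
  by rewrite invey mule0 lte_fin ltNge A0.
have rh : 0 < 1 + r / h by rewrite ltr_pwDl// divr_ge0// ltW.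
have [->|[r0 [r0p pr0 ->]]] := normalized_poincare_cases mu0 h0.
  rewrite gt0_muley ?lte_fin//= addey//.
  by rewrite invey mule0 lte_fin ltNge A0.
set W := (1 + r / h) + Num.sqrt ((1 + r / h) * (1 + r0 / h)).
have W1 : 1 <= W.
  by rewrite /W -addrA lerDl addr_ge0 ?sqrtr_ge0// divr_ge0// ltW.
have W0 : 0 < W by exact: lt_le_trans W1.
rewrite -EFinM /= -EFinD -/W.
have fin e : 0 < e < 1 -> exists j : nat, tmix e = (j%:R)%:E /\
    (tv_distance (distribution Pr (X j)) p <= e%:E)%E.
  move=> e01; have [k tvk] := tv_finite Hp h0 HXY pr e01.
  have [j [tj Hj _]] := @mixing_time_attained _ _ _ (fun k => distribution Pr (X k)) p e k tvk.
  by exists j.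
have [k [tk tvk]] := fin (1 - delta) ltac:(apply/andP; split; lra).
have [t [tt tvt]] := fin delta d01.
have [s1 [ts1 _]] := fin (1 - eps) ltac:(apply/andP; split; lra).
have [s2 [ts2 _]] := fin eps ltac:(apply/andP; split; lra).
have [u [tu _]] := fin eps0 ltac:(apply/andP; split; lra).
have mono e e' : e <= e' -> (tmix e' <= tmix e)%E by exact: mixing_time_nonincreasing.
have := mono _ _ de0; rewrite tt tu lee_fin => ut.
have := mono eps (1 - delta) ltac:(lra); rewrite tk ts2 lee_fin => ks2.
have := mono (1 - eps) (1 - delta) ltac:(lra); rewrite tk ts1 lee_fin => ks1.
have := mono _ _ de; rewrite tt ts2 lee_fin => s2t.
have := mono _ _ de1; rewrite tt ts1 lee_fin => s1t.
rewrite inver gt_eqF// -EFinM lte_fin ltr_pdivlMr// => AW.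
have [j tvj jk] := mixing_time_window Hp h0 HXY rp pr r0p pr0 d01 tvk.
have tj : t%:R <= j%:R :> R.
  by rewrite -lee_fin -tt; exact: (@mixing_time_le _ _ _ (fun k => distribution Pr (X k))).
have [kp tk'] := window_negligible B0 W1 (ler0n R k) L1 (le_trans tj jk) (lt_le_trans AW ut).
have {}tk' : t%:R <= (1 + eta) * k%:R.
  by apply: le_trans tk' _; rewrite ler_pM2r// lerD2l.
have s2p : 0 < s2%:R :> R by exact: lt_le_trans ks2.
exists (s1%:R / s2%:R); first by rewrite inver gt_eqF.
(* The times at 1 - eps and eps are compared in both directions, as eps may lie on either side of
   1/2. *)
have s1k : s1%:R <= (1 + eta) * s2%:R by nra.
have s2k : s2%:R <= (1 + eta) * s1%:R by nra.
have s1p : 0 < s1%:R :> R by exact: lt_le_trans ks1.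
rewrite ler_norml; apply/andP; split.
  by rewrite lerBrDr -lerBrDl ler_pdivrMr//; lra.
by rewrite lerBlDr -lerBlDl ler_pdivlMr//; nra.
Qed.

End ratio.

Theorem corollary1p5 (R : realType) (d : nat -> nat)
  (V : forall n, 'rV[R]_(d n) -> R)
  (pi mu0 : forall n, probability 'rV[R]_(d n) R)
  (h : nat -> R)
  (disp : nat -> measure_display) (Om : forall n, measurableType (disp n))
  (P : forall n, probability (Om n) R)
  (X Y : forall n, nat -> {RV (P n) >-> 'rV[R]_(d n)})
  (hd : forall n, (1 <= d n)%N)
  (hpi : forall n, log_concave_with_potential (V n) (pi n))
  (hh : forall n, 0 < h n)
  (hXY : forall n, proximal_sampler (X n) (Y n) (V n) (mu0 n) (h n)) :
  let tmix (n : nat) (eps : R) : \bar R :=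
    mixing_time (fun k => distribution (P n) (X n k)) (pi n) eps in
  let C n (mu : probability 'rV[R]_(d n) R) : \bar R :=
    normalized_poincare (h n) mu in
  forall eps0 : R, 0 < eps0 < 1 ->
  (fun n => tmix n eps0 /
      (C n (pi n) + sqrte (C n (pi n) * C n (mu0 n))))%E @ \oo --> +oo%E ->
  forall eps : R, 0 < eps < 1 ->
  (fun n => tmix n (1 - eps)%R / tmix n eps)%E @ \oo --> 1%E.
Proof.
move=> tmix C eps0 e0 /cvgeyPgt tinf eps e1.
have close eta : 0 < eta -> \forall n \near \oo,
    exists2 q : R, (tmix n (1 - eps)%R / tmix n eps = q%:E)%E & `|1 - q| <= eta.
  move=> eta0; near=> n; apply: (mixing_time_ratio (hpi n) (hh n) (hXY n) e0 e1 eta0).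
  near: n; exact: tinf.
apply/fine_cvgP; split.
  by apply: filterS (close 1 ltr01) => n [q -> _].
apply/cvgrPdist_le => eta eta0.
by apply: filterS (close _ eta0) => n [q /= -> ].
Unshelve. all: by end_near.
Qed.
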